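(* Let $X$ be a Brownian motion on a star graph $\mathcal G$ with star vertex $v$. Let $\overline\mu{}^v$ be the limit measure of the rescaled exit distributions of $X$ from small balls around $v$ (formed along a sequence $\varepsilon_n\downarrow0$ as described in the context). Then $$c^{v,\infty}_1:=\sum_{e\in\mathcal E}\overline\mu{}^v\big(\{(e,+\infty)\}\big)=0 .$$
   Context: Star graph. $\mathcal G$ is a metric graph with a single vertex $v$, no internal edges, and a finite nonempty set $\mathcal E$ of external edges: $\mathcal G$ is the quotient of $\bigcup_{e\in\mathcal E}\{e\}\times[0,\infty)$ obtained by identifying all points $(e,0)$, $e\in\mathcal E$, with $v$, with the shortest-path metric $d$ (so $d(v,(e,x))=x$). For $e\in\mathcal E$, $e^0:=\{e\}\times(0,\infty)$. $B_\varepsilon(v)$ is the open $d$-ball. Processes. Markov processes $X=(\Omega,\mathscr G,(\mathscr G_t),(X_t),(\Theta_t),(\mathbb P_g)_{g\in\mathcal G})$ on $\mathcal G$ are right continuous and normal ($\mathbb P_g(X_0=g)=1$), with values in $\mathcal G\cup\{\Delta\}$, $\Delta$ an isolated absorbing cemetery point; functions on $\mathcal G$ are extended by $0$ to $\Delta$; complements $\complement$ are taken in $\mathcal G\cup\{\Delta\}$. A Brownian motion on $\mathcal G$ is a right continuous, strong Markov process $X$ on $\mathcal G$ such that for all $g=(e,x)\in\mathcal G$, $H_X:=\inf\{t\ge0:X_t\notin e^0\}$ is a stopping time over $(\mathscr G_t)$ and $$\mathbb E_{(e,x)}\big(f_1(X_{t_1\wedge H_X})\cdots f_n(X_{t_n\wedge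 H_X})\big)=\mathbb E^B_x\big(f_1(e,B_{t_1\wedge H_B})\cdots f_n(e,B_{t_n\wedge H_B})\big)$$ for all $n\in\mathbb N$, bounded Borel $f_1,\dots,f_n$ on $\mathcal G$, $t_1,\dots,t_n\ge0$, where $B$ is standard Brownian motion on $\mathbb R$ and $H_B:=\inf\{t\ge0:B_t\notin(0,\infty)\}$. Limit measure. For $\varepsilon>0$ let $\tau_\varepsilon=\inf\{t\ge0:X_t\in\complement\,\overline{B_\varepsilon(v)}\}$, $\nu^v_\varepsilon(dg)=\mathbb P_v(X_{\tau_\varepsilon}\in dg)/\mathbb E_v(\tau_\varepsilon)$ on $\mathcal G\setminus\{v\}$, $K^v_\varepsilon=1+\frac{\mathbb P_v(X_{\tau_\varepsilon}=\Delta)}{\mathbb E_v(\tau_\varepsilon)}+\int_{\mathcal G\setminus\{v\}}(1-e^{-d(v,g)})\,\nu^v_\varepsilon(dg)$, $\mu^v_\varepsilon(dg)=(1-e^{-d(v,g)})\,\nu^v_\varepsilon(dg)/K^v_\varepsilon$ (quotients by $\mathbb E_v(\tau_\varepsilon)=+\infty$ are $0$). The compactification $\overline{\mathcal G\setminus\{v\}}$ is the disjoint union over $e\in\mathcal E$ of the compact intervals $\{e\}\times[0+,+\infty]$, i.e. each open half-line $e^0$ is compactified by its own endpoints $(e,0+)$ and $(e,+\infty)$. $\overline\mu{}^v_\varepsilon$ is $\mu^v_\varepsilon$ regarded as a measure on $\overline{\mathcal G\setminus\{v\}}$ (not charging the added points), and $\overline\mu{}^v=\lim_n\overline\mu{}^v_{\varepsilon_n}$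 (weak limit), where $(\varepsilon_n)$ is a sequence of positive numbers converging to $0$ such that this weak limit and the limits $\lim_n1/K^v_{\varepsilon_n}$ and $\lim_n\mathbb P_v(X_{\tau_{\varepsilon_n}}=\Delta)/(\mathbb E_v(\tau_{\varepsilon_n})K^v_{\varepsilon_n})$ exist (such sequences exist). *)

(* Defs.v *)
From HB Require Import structures.
From mathcomp Require Import all_boot all_order all_algebra generic_quotient.
From mathcomp Require Import all_classical all_reals all_analysis.
From mathcomp Require Import measurable_realfun lra.

Set Implicit Arguments.
Unset Strict Implicit.
Unset Printing Implicit Defensive.

Import Order.TTheory GRing.Theory Num.Theory.
Import numFieldNormedType.Exports.

Local Open Scope classical_set_scope.
Local Open Scope quotient_scope.
Local Open Scope ring_scope.

(* Finite nonempty types. The choice of [point] is immaterial; measurable types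
   of the library have to be pointed. *)
#[short(type="pfinType")]
HB.structure Definition PointedFinite := {T of Finite T & isPointed T}.

Section star_graph.
Context (E : pfinType) (R : realType).

Definition halflines : Type := (E * {nonneg R})%type.

Definition star_eq (p q : halflines) : bool :=
  (p == q) || ((p.2%:num == 0) && (q.2%:num == 0)).

Lemma star_eq_refl : reflexive star_eq.
Proof. by move=> p; rewrite /star_eq eqxx. Qed.

Lemma star_eq_sym : symmetric star_eq.
Proof. by move=> p q; rewrite /star_eq eq_sym andbC. Qed.

Lemma star_eq_trans : transitive star_eq.
Proof.
move=> q p r /orP[/eqP->//|/andP[p0 q0]] /orP[/eqP<-|/andP[_ r0]].
- by rewrite /star_eq p0 q0 orbT.
- by rewrite /star_eq p0 r0 orbT.
Qed.

Canonical star_equiv :=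
  EquivRel star_eq star_eq_refl star_eq_sym star_eq_trans.

Definition star : Type := {eq_quot star_equiv}.

HB.instance Definition _ := Choice.on star.

Lemma max0_ge0 (x : R) : 0 <= Num.max x 0.
Proof. by rewrite le_max lexx orbT. Qed.

(* The point (e, x). It is only meant for 0 <= x; negative x are sent to 0. *)
Definition pt (e : E) (x : R) : star := \pi_star (e, NngNum (max0_ge0 x)).

Definition vertex : star := pt point 0.

HB.instance Definition _ := isPointed.Build star vertex.

(* Length of the shortest path: along the edge if both points lie on a common
   edge, and through the vertex otherwise. *)
Definition halflines_dist (p q : halflines) : R :=
  if p.1 == q.1 then `|p.2%:num - q.2%:num| else p.2%:num + q.2%:num.

Definition star_dist (g h : star) : R := halflines_dist (repr g) (repr h).

Lemma halflines_dist_eq p p' q q' : star_eq p p' -> star_eq q q' ->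
  halflines_dist p q = halflines_dist p' q'.
Proof.
case: p p' q q' => [a x] [a' x'] [b y] [b' y'].
rewrite /star_eq /halflines_dist /=.
move=> /orP[/eqP[-> ->]|/andP[/eqP-> /eqP->]];
  move=> /orP[/eqP[-> ->]|/andP[/eqP-> /eqP->]] //;
  rewrite ?sub0r ?subr0 ?add0r ?addr0 ?normrN ?normr0 ?ger0_norm //;
  by do ![case: ifP].
Qed.

Lemma star_distE p q :
  star_dist (\pi_star p) (\pi_star q) = halflines_dist p q.
Proof.
have piK r : star_eq (repr (\pi_star r)) r.
  by have /eqP := reprK (\pi_star r); rewrite eqmodE.
exact: halflines_dist_eq.
Qed.

Lemma starP (g : star) : exists e x, 0 <= x /\ g = pt e x.
Proof.
exists (repr g).1, (repr g).2%:num; split => //; rewrite -[LHS]reprK /pt.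
congr (\pi_star _); case: (repr g) => e x /=; congr pair.
by apply/val_inj; rewrite /= max_l.
Qed.

Lemma star_dist_pt e e' x y : 0 <= x -> 0 <= y ->
  star_dist (pt e x) (pt e' y) = if e == e' then `|x - y| else x + y.
Proof. by move=> x0 y0; rewrite star_distE /halflines_dist /= !max_l. Qed.

Lemma pt0 e : pt e 0 = vertex.
Proof.
apply/eqP; rewrite eqmodE /=; apply/orP; right.
by apply/andP; split; apply/eqP/maxxx.
Qed.

Lemma star_dist_xx g : star_dist g g = 0.
Proof. by rewrite /star_dist /halflines_dist eqxx subrr normr0. Qed.

Lemma star_dist_sym g h : star_dist g h = star_dist h g.
Proof.
rewrite /star_dist /halflines_dist eq_sym distrC.
by case: ifP => // _; rewrite addrC.
Qed.

Lemma star_dist_eq0 g h : star_dist g h = 0 -> g = h.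
Proof.
have [e [x [x0 ->]]] := starP g; have [e' [y [y0 ->]]] := starP h.
rewrite star_dist_pt //.
case: eqP => [->|_].
  by move=> /eqP; rewrite normr_eq0 subr_eq0 => /eqP ->.
move=> /eqP; rewrite paddr_eq0 // => /andP[/eqP-> /eqP->].
by rewrite !pt0.
Qed.

Lemma star_dist_triangle h g k :
  star_dist g k <= star_dist g h + star_dist h k.
Proof.
have [a [x [x0 ->]]] := starP g; have [b [y [y0 ->]]] := starP h.
have [c [z [z0 ->]]] := starP k; rewrite !star_dist_pt //.
have n1 := ler_norm (x - y); have n2 := ler_norm (y - z).
have n3 := ler_norm (y - x); have n4 := ler_norm (z - y).
rewrite (distrC y x) in n3; rewrite (distrC z y) in n4.
have n5 : `|x - z| <= `|x - y| + `|y - z|.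
  by rewrite (le_trans _ (ler_normD _ _)) // addrA subrK.
have n6 : `|x - z| <= x + z.
  by rewrite ler_norml; apply/andP; split; lra.
have [ab|ab] := eqVneq a b; have [bc|bc] := eqVneq b c; subst;
  rewrite ?eqxx ?(negbTE ab) ?(negbTE bc) //; try lra.
by case: ifP => _; lra.
Qed.

HB.instance Definition _ := @isMetric.Build R star star_dist
  star_dist_xx star_dist_eq0 star_dist_sym star_dist_triangle.

HB.instance Definition _ :=
  Measurable.copy star (g_sigma_algebraType (@open star)).

Lemma mdist_vertex e x : 0 <= x -> mdist (vertex : star) (pt e x) = x.
Proof.
move=> x0; rewrite -[LHS]/(star_dist vertex (pt e x)) -(pt0 e) star_dist_pt //.
by rewrite eqxx sub0r normrN ger0_norm.
Qed.

Definition open_edge (e : E) : set star := pt e @` [set x | 0 < x].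

End star_graph.

Arguments vertex {E R}.

(* G u {Delta}, with Delta = None isolated *)
Section cemetery.

Definition cemetery (T : Type) : Type := option T.

HB.instance Definition _ (T : choiceType) := Choice.on (cemetery T).
HB.instance Definition _ (T : choiceType) :=
  isPointed.Build (cemetery T) None.

Context (T : topologicalType).

Definition cemetery_open : set_system (cemetery T) :=
  [set A | open (Some @^-1` A)].

Lemma cemetery_openT : cemetery_open setT.
Proof. exact: openT. Qed.

Lemma cemetery_openI : setI_closed cemetery_open.
Proof. by move=> A B; exact: openI. Qed.

Lemma cemetery_open_bigU (I : Type) (f : I -> set (cemetery T)) :
  (forall i, cemetery_open (f i)) -> cemetery_open (\bigcup_i f i).
Proof.
move=> fo; rewrite /cemetery_open /= preimage_bigcup.
by apply: bigcup_open => i _; exact: fo.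
Qed.

HB.instance Definition _ := @isOpenTopological.Build (cemetery T)
  cemetery_open cemetery_openT cemetery_openI cemetery_open_bigU.

HB.instance Definition _ :=
  Measurable.copy (cemetery T) (g_sigma_algebraType (@open (cemetery T))).

End cemetery.

Definition Delta {T : Type} : cemetery T := None.

Definition inG {T : Type} (g : T) : cemetery T := Some g.

Definition ext0 {T : Type} {R : realType} (f : T -> R) (y : cemetery T) : R :=
  if y is Some g then f g else 0.

Section compactification.
Context (E : pfinType) (R : realType).

Definition star_compact : Type :=
  {e : E & set_type [set x : \bar R | (0 <= x)%E]}.

HB.instance Definition _ := Topological.on star_compact.

Lemma bar_pt_subproof (x : \bar R) :
  Order.max x 0%E \in [set x : \bar R | (0 <= x)%E].
Proof. by rewrite inE /= le_max lexx orbT. Qed.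

(* The point (e, x), for x in [0, +oo]; [bar_pt e 0] is the added end (e, 0+),
   different for different edges. *)
Definition bar_pt (e : E) (x : \bar R) : star_compact :=
  existT _ e (exist _ (Order.max x 0%E) (bar_pt_subproof x)).

HB.instance Definition _ := isPointed.Build star_compact (bar_pt point 0%E).

HB.instance Definition _ :=
  Measurable.copy star_compact (g_sigma_algebraType (@open star_compact)).

(* The inclusion of G \ {v} in its compactification; its value at v is
   irrelevant. *)
Definition to_bar (g : star E R) : star_compact :=
  bar_pt (repr g).1 ((repr g).2%:num)%:E.

Lemma to_bar_pt e x : 0 < x -> to_bar (pt e x) = bar_pt e x%:E.
Proof.
move=> x0; set p := (e, NngNum (max0_ge0 x)) : halflines E R.
have : star_eq (repr (pt e x)) p.
  by have /eqP := reprK (pt e x); rewrite eqmodE.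
rewrite /to_bar => /orP[/eqP->|]; first by rewrite /p /= max_l // ltW.
by rewrite /p /= max_l ?ltW // (gt_eqF x0) andbF.
Qed.

(* As in the library's [integral], measures may be given as set functions. *)
Definition weakly_cvg (m : nat -> set star_compact -> \bar R)
    (m0 : set star_compact -> \bar R) : Prop :=
  forall f : star_compact -> R, continuous f ->
    (exists M, forall y, `|f y| <= M) ->
    (\int[m n]_y (f y)%:E)%E @[n --> \oo] --> (\int[m0]_y (f y)%:E)%E.

End compactification.

Section times.
Context (R : realType).

(* inf {t >= 0 | Y_t in A}, which is +oo if the set is empty *)
Definition entry_time (T : Type) (Y : R -> T) (A : set T) : \bar R :=
  ereal_inf [set t%:E | t in [set t | 0 <= t /\ A (Y t)]].

Definition stopped (t : R) (h : \bar R) : R := fine (Order.min t%:E h).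

End times.

Definition bounded_borel d (T : measurableType d) (R : realType) (f : T -> R) :=
  measurable_fun setT f /\ exists M, forall x, `|f x| <= M.

(* Standard Brownian motion on the line, as a family of laws indexed by the
   starting point. The times of the increments are strictly increasing because
   [normal_prob m 0] is not a Dirac mass in the library. *)
Record standard_bm (R : realType) d (Omega : measurableType d) := StandardBM {
  bm_path : R -> Omega -> R ;
  bm_law : R -> probability Omega R ;
  bm_measurable : forall t : R, 0 <= t -> measurable_fun setT (bm_path t) ;
  bm_continuous : forall w,
    {within [set t | 0 <= t], continuous (fun t => bm_path t w)} ;
  bm_start : forall x, bm_law x [set w | bm_path 0 w = x] = 1%E ;
  bm_increments : forall x n (t : nat -> R) (A : nat -> set R),
    0 <= t 0%N -> (forall i, (i < n)%N -> t i < t i.+1) ->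
    (forall i, measurable (A i)) ->
    bm_law x (\bigcap_(i < n)
        [set w | A i (bm_path (t i.+1) w - bm_path (t i) w)]) =
    (\prod_(i < n) normal_prob 0 (Num.sqrt (t i.+1 - t i)) (A i))%E }.

(* Normal, right continuous Markov processes on the star graph. Times are real
   numbers; nothing is required of negative ones. *)
Record markov_process (E : pfinType) (R : realType) d
    (Omega : measurableType d) := MarkovProcess {
  filtr : R -> set (set Omega) ;
  traj : R -> Omega -> cemetery (star E R) ;
  time_shift : R -> Omega -> Omega ;
  law : star E R -> probability Omega R ;
  filtr_sigma : forall t : R, 0 <= t -> sigma_algebra setT (filtr t) ;
  filtr_measurable : forall t : R, 0 <= t -> filtr t `<=` measurable ;
  filtr_le : forall s t : R, 0 <= s -> s <= t -> filtr s `<=` filtr t ;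
  traj_adapted : forall (t : R) A, 0 <= t -> measurable A ->
    filtr t (traj t @^-1` A) ;
  traj_right_continuous : forall w (t : R), 0 <= t ->
    traj s w @[s --> t^'+] --> traj t w ;
  traj_absorbed : forall w (s t : R), 0 <= s -> s <= t ->
    traj s w = Delta -> traj t w = Delta ;
  traj_shift : forall w (s t : R), 0 <= s -> 0 <= t ->
    traj s (time_shift t w) = traj (s + t) w ;
  law_measurable : forall (t : R) A, 0 <= t -> measurable A ->
    measurable_fun setT (fun g => law g (traj t @^-1` A)) ;
  law_normal : forall g, law g [set w | traj 0 w = inG g] = 1%E ;
  markov_property : forall g (s t : R) f L, 0 <= s -> 0 <= t -> bounded_borel f ->
    filtr s L ->
    (\int[law g]_(w in L) (ext0 f (traj (s + t) w))%:E =
     \int[law g]_(w in L) (ext0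
       (fun h => fine ('E_(law h)[fun w' => ext0 f (traj t w')]))
       (traj s w))%:E)%E }.

Section processes.
Context (E : pfinType) (R : realType) d (Omega : measurableType d).
Variable X : markov_process E R Omega.

Definition stopping_time (tau : Omega -> \bar R) : Prop :=
  (forall w, (0 <= tau w)%E) /\
  forall t : R, 0 <= t -> filtr X t [set w | (tau w <= t%:E)%E].

Definition stopped_filtr (tau : Omega -> \bar R) : set (set Omega) :=
  [set L | measurable L /\
    forall t : R, 0 <= t -> filtr X t (L `&` [set w | (tau w <= t%:E)%E])].

(* X at a possibly infinite time, with X_oo = Delta *)
Definition traj_at (t : \bar R) (w : Omega) : cemetery (star E R) :=
  if t is r%:E then traj X r w else Delta.

Definition strong_markov : Prop :=
  forall tau, stopping_time tau ->
    (forall A, measurable A ->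
      stopped_filtr tau [set w | A (traj_at (tau w) w)]) /\
    forall g (t : R) f L, 0 <= t -> bounded_borel f -> stopped_filtr tau L ->
      (\int[law X g]_(w in L) (ext0 f (traj_at (tau w + t%:E) w))%:E =
       \int[law X g]_(w in L) (ext0
         (fun h => fine ('E_(law X h)[fun w' => ext0 f (traj X t w')]))
         (traj_at (tau w) w))%:E)%E.

Definition edge_exit_time (e : E) (w : Omega) : \bar R :=
  entry_time (fun t => traj X t w) (~` (inG @` open_edge e)).

(* Up to its first exit from ]0, +oo[, the Brownian path started at x >= 0 is
   nonnegative, so that the truncation in [pt] is inactive. *)
Definition brownian_motion dB (OmegaB : measurableType dB)
    (B : standard_bm R OmegaB) : Prop :=
  let HB w := entry_time (fun t => bm_path B t w) (~` [set y | 0 < y]) in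
  strong_markov /\
  forall e x, 0 <= x ->
    stopping_time (edge_exit_time e) /\
    forall n (f : 'I_n -> star E R -> R) (t : 'I_n -> R),
      (forall i, bounded_borel (f i)) -> (forall i, 0 <= t i) ->
      ('E_(law X (pt e x))[fun w => (\prod_(i < n)
          ext0 (f i) (traj X (stopped (t i) (edge_exit_time e w)) w))%R] =
       'E_(bm_law B x)[fun w => (\prod_(i < n)
          f i (pt e (bm_path B (stopped (t i) (HB w)) w)))%R])%E.

Definition ball_exit_time (eps : R) (w : Omega) : \bar R :=
  entry_time (fun t => traj X t w) (~` (inG @` closure (ball vertex eps))).

Definition ball_exit_point (eps : R) (w : Omega) : cemetery (star E R) :=
  traj_at (ball_exit_time eps w) w.

Definition mean_exit_time (eps : R) : \bar R :=
  (\int[law X vertex]_w ball_exit_time eps w)%E.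

Definition killing_ratio (eps : R) : \bar R :=
  (law X vertex [set w | ball_exit_point eps w = Delta] / mean_exit_time eps)%E.

(* [exit_nu] and [exit_mu] are measures on G \ {v}, seen as measures on G that
   do not charge v. In \bar R, a / +oo = 0. *)
Definition exit_nu (eps : R) (A : set (star E R)) : \bar R :=
  (law X vertex [set w | (inG @` (A `\ vertex)) (ball_exit_point eps w)]
    / mean_exit_time eps)%E.

Definition exit_K (eps : R) : \bar R :=
  (1 + killing_ratio eps +
   \int[exit_nu eps]_(g in [set~ vertex]) (1 - expR (- mdist vertex g))%:E)%E.

Definition exit_mu (eps : R) (A : set (star E R)) : \bar R :=
  ((\int[exit_nu eps]_(g in A `\ vertex) (1 - expR (- mdist vertex g))%:E)
    / exit_K eps)%E.

Definition exit_mu_bar (eps : R) : set (star_compact E R) -> \bar R :=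
  pushforward (exit_mu eps) (@to_bar E R).

Definition limit_measure (eps : nat -> R)
    (m : {finite_measure set (star_compact E R) -> \bar R}) : Prop :=
  [/\ (forall n, 0 < eps n) /\ eps n @[n --> \oo] --> (0 : R),
      weakly_cvg (fun n => exit_mu_bar (eps n)) m,
      cvgn (fun n => ((exit_K (eps n))^-1)%E) &
      cvgn (fun n => (killing_ratio (eps n) / exit_K (eps n))%E)].

End processes.

Definition c1_infty (E : pfinType) (R : realType)
    (m : set (star_compact E R) -> \bar R) : \bar R :=
  (\sum_(e : E) m [set bar_pt e +oo])%E.

(* Main.v *)
(* Let U be the expectation, at an independent exponential time of rate
   a = th ^ 2 / 2, of a function that vanishes within distance c of the vertex v
   and is 1 beyond distance c + 1. By the strong Markov property U is
   supermedian. Stopping at the exit from an edge, U >= e^(- th d) U(v), because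
   e^(- th x) is the Laplace transform at a of the hitting time of 0 by Brownian
   motion; and U >= F beyond distance c + 3, for some F > 0 that depends only on
   a, because Brownian motion started so high is unlikely to come down before
   time 1. So U has the continuous minorant U(v) e^(- th d) + (F - U(v)) b, where
   b vanishes within distance c + 3 of v and is 1 beyond c + 4. Stop U at the
   exit time tau from the ball and use e^(- a tau) >= 1 - a tau: for th <= 1,
     (F - U(v)) E(b(X_tau))
       <= F a E(tau) + U(v) (P(X_tau = Delta) + E(1 - e^(- d(v, X_tau)))),
   and division by E(tau) K bounds the mass that mu_eps gives to the points
   beyond distance c + 4 by (F a + U(v)) / (F - U(v)), uniformly in eps. Here
   U(v) tends to 0 as c tends to infinity; then let a tend to 0. *)

Require Import Defs.
From HB Require Import structures.
From mathcomp Require Import all_boot all_order all_algebra.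
From mathcomp Require Import all_classical all_reals all_analysis.
From mathcomp Require Import measurable_realfun ring lra.

Set Implicit Arguments.
Unset Strict Implicit.
Unset Printing Implicit Defensive.

Import Order.TTheory GRing.Theory Num.Theory.
Import numFieldNormedType.Exports.

Local Open Scope classical_set_scope.
Local Open Scope ring_scope.

(** * Exponential times *)

(** No continuity of [U] is available, as the process is not assumed to be Feller, and [tau] need
    not be a stopping time. So [tau] is approached from the right by discrete stopping times, and it
    is a continuous minorant of [U] that survives this limit. The coefficient of [e^(- th d)] in the
    minorant has to be exactly [U(v)]: then the constant term cancels in the supermedian inequality
    at [v], and what remains is of the order of [E(tau) K], whatever the size of the ball. The
    exponential clock serves twice: its lack of memory makes [U] supermedian at every stopping time,
    and its discount costs only [a E(tau)]. The summand 1 in [K] absorbs this cost, and the rest of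
    [K] absorbs the loss of distance and of mass. Only lower bounds for [U] are used, hence only
    lower bounds for Brownian functionals; they come from optional stopping of the exponential
    martingale, carried out on grids with independent Gaussian increments. The order of the choices
    matters: [F] depends on [a], so [c] is chosen after [a]. *)

Section density.
Local Open Scope ereal_scope.
Context d (T : measurableType d) (R : realType).
Variables (mu nu : {measure set T -> \bar R}) (k : T -> R).
Hypotheses (mk : measurable_fun setT k) (k0 : forall x, (0 <= k x)%R).
Hypothesis nuE : forall A, measurable A -> nu A = \int[mu]_(x in A) (k x)%:E.

Import HBNNSimple.

(** Shared by the exponential law, by the Gaussian computation in [normal_exp] and by the exit
    measures. Monotone convergence along simple functions leaves the level sets, where [nuE] is the
    claim. *)
Lemma ge0_integral_density (f : T -> \bar R) :
  measurable_fun setT f -> (forall x, 0 <= f x) ->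
  \int[nu]_x f x = \int[mu]_x (f x * (k x)%:E).
Proof.
move=> mf f0.
pose h := nnsfun_approx measurableT mf.
have hf x : EFin \o h ^~ x @ \oo --> f x by exact: cvg_nnsfun_approx.
have mhk n : measurable_fun setT (fun x => (h n x)%:E * (k x)%:E).
  by apply: (emeasurable_funM (f := fun x => (h n x)%:E)); exact/measurable_EFinP.
have -> : \int[nu]_x f x = limn (fun n => \int[nu]_x (h n x)%:E).
  rewrite -monotone_convergence//.
  - by apply: eq_integral => x _; apply/esym/cvg_lim => //; exact: hf.
  - by move=> n; exact/measurable_EFinP/measurable_funP.
  - by move=> n x _; rewrite lee_fin.
  - by move=> x _ m n mn; rewrite lee_fin; exact/lefP/nd_nnsfun_approx.
have -> : \int[mu]_x (f x * (k x)%:E) =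
    limn (fun n => \int[mu]_x ((h n x)%:E * (k x)%:E)).
  rewrite -monotone_convergence//.
  - apply: eq_integral => x _; apply/esym/cvg_lim => //.
    by apply: cvgeZr => //; exact: hf.
  - by move=> n x _; rewrite -EFinM lee_fin mulr_ge0.
  - move=> x _ m n mn; apply: lee_wpmul2r; first by rewrite lee_fin.
    by rewrite lee_fin; exact/lefP/nd_nnsfun_approx.
congr (limn _); apply/funext => n.
transitivity (\int[nu]_x (\sum_(y \in range (h n))
   (y * \1_(h n @^-1` [set y]) x)%:E)).
  by apply: eq_integral => t _; rewrite fimfunE -fsumEFin.
have indich r : measurable_fun setT (fun x => (r * \1_(h n @^-1` [set r]) x)%:E).
  by apply: (measurable_comp measurableT) => //; exact: measurable_funM.
rewrite ge0_integral_fsum//; last by move=> y x _; exact: nnfun_muleindic_ge0.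
transitivity (\int[mu]_x (\sum_(y \in range (h n))
    (y * \1_(h n @^-1` [set y]) x)%:E * (k x)%:E)); last first.
  apply: eq_integral => x _.
  rewrite -ge0_mule_fsuml => [|y]; last exact: nnfun_muleindic_ge0.
  by rewrite fsumEFin // -(fimfunE _ x).
rewrite ge0_integral_fsum//; last 2 first.
  - move=> y; apply: (emeasurable_funM (g := fun x => (k x)%:E)) => //.
    exact/measurable_EFinP.
  - move=> y x _; rewrite mule_ge0// ?lee_fin//; exact: nnfun_muleindic_ge0.
apply: eq_fsbigr => r rn.
have r0 : (0 <= r)%R by move: rn; rewrite inE => -[x _ <-].
under [RHS]eq_integral do rewrite EFinM -muleA.
rewrite integralZl_indic_nnsfun//= integral_indic// setIT.
rewrite ge0_integralZl//; last 2 first.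
- apply: (emeasurable_funM (g := fun x => (k x)%:E)) => //; exact/measurable_EFinP.
- by move=> x _; rewrite mule_ge0// lee_fin.
congr (_ * _); rewrite nuE// integral_mkcond; apply: eq_integral => x _.
by rewrite patchE indicE; case: (x \in _); rewrite ?mul1e ?mul0e.
Qed.

End density.

Section exponential.
Context (R : realType) (a : R) (a0 : 0 < a).

Lemma ge0_integral_lebesgue_shift (c : R) (f : R -> \bar R) :
  measurable_fun setT f -> (forall x, 0 <= f x)%E ->
  (\int[lebesgue_measure]_x f (c + x)%R = \int[lebesgue_measure]_x f x)%E.
Proof.
move=> mf f0.
pose phi (x : measurableTypeR R) : measurableTypeR R := (c + x)%R.
have ms : measurable_fun [set: measurableTypeR R] phi by exact: measurable_funD.
rewrite -(@ge0_integral_pushforward _ _ _ _ _ phi ms lebesgue_measure setT f)//.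
apply: eq_measure_integral => A mA _; apply/esym.
apply/lebesgue_measure_unique => //.
move=> _ [[x y] /= xy <-]; rewrite /pushforward.
rewrite (_ : phi @^-1` _ = `]x - c, y - c]%classic); last first.
  by apply/seteqP; split => z /=; rewrite /phi !in_itv/= lerBrDl ltrBlDl.
rewrite !lebesgue_measure_itv/= !lte_fin ltrD2r; case: ifPn => // _.
by rewrite -!EFinD; congr (_%:E); lra.
Qed.

Definition expo : probability (measurableTypeR R) R :=
  @exponential_distribution_exponential_prob__canonical__probability_measure_Probability R a a0.

Arguments expo : simpl never.

Lemma ge0_integral_expo (f : R -> \bar R) :
  measurable_fun setT f -> (forall x, 0 <= f x)%E ->
  (\int[expo]_x f x = \int[lebesgue_measure]_x (f x * (exponential_pdf a x)%:E))%E.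
Proof.
move=> mf f0; apply: ge0_integral_density => //.
- exact: measurable_exponential_pdf.
- by move=> x; rewrite exponential_pdf_ge0// ltW.
Qed.

(** For [0 <= s] the density at [c + s] is [expR (- a * c)] times the density at [s]; the rest is
    translation invariance of Lebesgue measure. *)
Lemma expo_memoryless (c : R) (f : R -> \bar R) : 0 <= c ->
  measurable_fun setT f -> (forall x, 0 <= f x)%E ->
  ((expR (- a * c))%:E * \int[expo]_s f (c + s)%R =
   \int[expo]_t (f t * (\1_`[c, +oo[ t)%:E))%E.
Proof.
move=> c0 mf f0.
have mfc : measurable_fun setT (fun s : R => f (c + s)).
  by apply: measurableT_comp => //; exact: measurable_funD.
rewrite !ge0_integral_expo//; last 2 first.
- by apply: (emeasurable_funM mf); apply/measurable_EFinP.
- by move=> x; rewrite mule_ge0// lee_fin.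
rewrite -ge0_integralZl//; last 2 first.
- apply: (emeasurable_funM mfc); apply/measurable_EFinP.
  exact: measurable_exponential_pdf.
- by move=> x _; rewrite mule_ge0// lee_fin exponential_pdf_ge0// ltW.
rewrite -(ge0_integral_lebesgue_shift c); last 2 first.
- apply: (emeasurable_funM (f := fun t => f t * (\1_`[c, +oo[ t)%:E)%E).
    by apply: (emeasurable_funM mf); apply/measurable_EFinP.
  by apply/measurable_EFinP; exact: measurable_exponential_pdf.
- move=> x; rewrite !mule_ge0// lee_fin// exponential_pdf_ge0// ltW//.
apply: eq_integral => s _; rewrite muleCA -!muleA; congr (_ * _)%E.
rewrite -!EFinM; congr (_%:E); rewrite indicE.
(* For negative [s] the density at [c + s] may well be positive; there it is the indicator that
   vanishes. *)
have [s0|s0] := ltP s 0.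
  rewrite lt0_exponential_pdf// mulr0 memNset ?mul0r//=.
  by rewrite in_itv/= andbT; lra.
rewrite mem_set/= ?in_itv/= ?andbT; last lra.
rewrite !exponential_pdfE//; last lra.
by rewrite mul1r mulrCA -expRD; congr (_ * expR _); ring.
Qed.

Lemma expo_itvcy (c : R) : 0 <= c -> expo `[c, +oo[%classic = (expR (- a * c))%:E.
Proof.
move=> c0; have := @expo_memoryless c (fun=> 1%E) c0.
have -> : (\int[expo]_s 1 = 1)%E by rewrite integral_cst// mul1e; exact: (probability_setT expo).
rewrite mule1.
move=> ->//; under eq_integral do rewrite mul1e.
by rewrite integral_indic// setIT.
Qed.

Definition lap (x : \bar R) : R := if x is r%:E then expR (- a * r) else 0.

Lemma lap_ge0 x : 0 <= lap x.
Proof. by case: x => //= r; exact: expR_ge0. Qed.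

Lemma lap_le1 x : (0 <= x)%E -> lap x <= 1.
Proof.
case: x => //= r; rewrite lee_fin => r0.
by rewrite -expR0 ler_expR mulNr oppr_le0 mulr_ge0// ltW.
Qed.

Lemma lapE x : (0 <= x)%E -> (lap x)%:E = expo [set r | (x <= r%:E)%E].
Proof.
case: x => //= [r|_]; last first.
  by rewrite (_ : [set _ | _] = set0) ?measure0//; apply/seteqP; split.
rewrite lee_fin => r0; rewrite -expo_itvcy//; congr (expo _).
by apply/seteqP; split => z /=; rewrite in_itv/= andbT lee_fin.
Qed.

(* [lap sg] is the probability that [sg] is before an independent exponential
   time. *)
Lemma integral_lap d (Om : measurableType d) (P : {sigma_finite_measure set Om -> \bar R})
    (sg : Om -> \bar R) (Y : Om -> \bar R) :
  measurable_fun setT sg -> (forall w, 0 <= sg w)%E ->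
  measurable_fun setT Y -> (forall w, 0 <= Y w)%E ->
  (\int[P]_w ((lap (sg w))%:E * Y w) =
   \int[expo]_r \int[P]_(w in [set w | sg w <= r%:E]) Y w)%E.
Proof.
move=> msg sg0 mY Y0.
pose D : set (Om * measurableTypeR R) := [set z | (sg z.1 <= z.2%:E)%E].
have mD : measurable D.
  rewrite -[D]setTI; apply: (@measurable_lee _ _ _ setT measurableT (sg \o fst) (EFin \o snd)) => //.
  - exact: measurableT_comp.
  - by apply/measurable_EFinP.
pose f (z : Om * measurableTypeR R) := (Y z.1 * (\1_D z)%:E)%E.
have mf : measurable_fun setT f.
  apply: (emeasurable_funM (f := Y \o fst)); first exact: measurableT_comp.
  by apply/measurable_EFinP.
have f0 z : (0 <= f z)%E by rewrite mule_ge0// lee_fin.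
have FT : (\int[P]_x \int[expo]_y (Y x * (\1_D (x, y))%:E) =
    \int[expo]_y \int[P]_x (Y x * (\1_D (x, y))%:E))%E.
  exact: (@fubini_tonelli _ _ _ _ _ P expo f mf f0).
transitivity (\int[P]_x \int[expo]_y (Y x * (\1_D (x, y))%:E))%E.
  apply: eq_integral => w _; rewrite ge0_integralZl//; last first.
    apply: (measurable_fun_pair2 (f := fun z => (\1_D z)%:E) w).
    exact/measurable_EFinP.
  rewrite muleC lapE//; congr (_ * _)%E.
  rewrite (eq_integral (fun r : measurableTypeR R =>
    (\1_[set r : measurableTypeR R | (sg w <= r%:E)%E] r)%:E)).
    rewrite integral_indic ?setIT//; rewrite -[X in measurable X]setTI.
    by apply: measurable_lee => //; exact: measurable_EFin.
  by move=> r _; rewrite !indicE; congr (_%:R%:E).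
rewrite FT; apply: eq_integral => r _.
rewrite [RHS]integral_mkcond; apply: eq_integral => w _.
rewrite patchE indicE; have [h|h] := boolP (sg w <= r%:E)%E.
  by rewrite !mem_set// mule1.
by rewrite !memNset ?mule0//; exact/negP.
Qed.

End exponential.

(** By [lapE] the discount is an integral over the exponential time, so that measurability comes
    from Tonelli without treating infinite values apart. *)
Lemma measurable_lap (R : realType) (a : R) (a0 : 0 < a) d (Om : measurableType d)
    (sg : Om -> \bar R) : measurable_fun setT sg -> (forall w, 0 <= sg w)%E ->
  measurable_fun setT (fun w => (lap a (sg w))%:E).
Proof.
move=> msg sg0.
rewrite (_ : (fun _ => _) = fun w =>
    \int[expo a0]_r (\1_[set z : Om * measurableTypeR R | (sg z.1 <= z.2%:E)%E] (w, r))%:E)%E.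
  pose D : set (Om * measurableTypeR R) := [set z | (sg z.1 <= z.2%:E)%E].
  have mD : measurable D.
    rewrite -[D]setTI; apply: (@measurable_lee _ _ _ setT measurableT (sg \o fst) (EFin \o snd)) => //.
    - exact: measurableT_comp.
    - by apply/measurable_EFinP.
  apply: (@measurable_fun_fubini_tonelli_F _ _ Om _ R (expo a0) (fun z => (\1_D z)%:E)).
    exact/measurable_EFinP.
  by move=> z; rewrite lee_fin.
apply/funext => w; rewrite (lapE a0)//.
rewrite (eq_integral (fun r : measurableTypeR R =>
  (\1_[set r : measurableTypeR R | (sg w <= r%:E)%E] r)%:E)).
  rewrite integral_indic ?setIT//; rewrite -[X in measurable X]setTI.
  by apply: measurable_lee => //; exact: measurable_EFin.
by move=> r _; rewrite !indicE; congr (_%:R%:E).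
Qed.

(** * Approximation of times from the right *)

Section discretization.
Context (R : realType).

(* Strictly after [t], so that right continuous paths at [up n t] converge to
   their value at [t]. *)
Definition up (n : nat) (t : R) : R := (Num.truncn (n.+1%:R * t)).+1%:R / n.+1%:R.

Lemma up_gt n t : 0 <= t -> t < up n t.
Proof.
move=> t0; rewrite /up ltr_pdivlMr// mulrC.
by apply: Num.Theory.truncnS_gt.
Qed.

Lemma up_le n t : 0 <= t -> up n t <= t + n.+1%:R^-1.
Proof.
move=> t0; rewrite /up ler_pdivrMr// mulrDl mulVf// mulrC -natr1 lerD2r.
by rewrite Num.Theory.truncn_le// mulr_ge0.
Qed.

Lemma up_ge0 n t : 0 <= up n t.
Proof. by rewrite divr_ge0. Qed.

Lemma cvg_up t : 0 <= t -> up n t @[n --> \oo] --> t.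
Proof.
move=> t0; apply: (@squeeze_cvgr _ _ _ _ (fun=> t) (fun n => t + n.+1%:R^-1)).
- by apply: nearW => n; rewrite up_le// ltW// up_gt.
- exact: cvg_cst.
- by rewrite -[X in _ --> X]addr0; apply: cvgD; [exact: cvg_cst|exact: cvg_harmonic].
Qed.

Lemma cvg_up_right t : 0 <= t -> up n t @[n --> \oo] --> t^'+.
Proof.
move=> t0 A; rewrite /at_right /within/= => tA.
suff: \forall n \near \oo, A (up n t) by [].
have : \forall n \near \oo, (t < up n t -> A (up n t)) by exact: (cvg_up t0 tA).
by apply: filterS => n; apply; exact: up_gt.
Qed.

(* The truncation at 0 is there because processes are only known at nonnegative
   times. *)
Lemma measurable_right_continuous d (T : measurableType d) (u : R -> T -> R) :
  (forall t, 0 <= t -> measurable_fun setT (u t)) ->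
  (forall x t, 0 <= t -> u s x @[s --> t^'+] --> u t x) ->
  measurable_fun setT (fun z : T * measurableTypeR R => u (Num.max z.2 0) z.1).
Proof.
move=> mu cu.
apply: (@measurable_fun_cvg _ _ _ _ (fun n (z : T * measurableTypeR R) => u (up n (Num.max z.2 0)) z.1)); last first.
  move=> [x t] _ /=.
  have t0 : 0 <= Num.max t 0 by rewrite le_max lexx orbT.
  by apply: (cvg_comp (up ^~ (Num.max t 0)) (u ^~ x) (cvg_up_right t0)); exact: cu.
move=> n _ A mA; rewrite setTI.
(* Where the integer part is [k], [up n] is the constant [k.+1%:R / n.+1%:R]: the preimage is a
   countable union of rectangles. *)
rewrite (_ : _ @^-1` A = \bigcup_k
   ((u (k.+1%:R / n.+1%:R) @^-1` A) `*`
    ((fun t : R => Num.max t 0) @^-1` [set t | Num.truncn (n.+1%:R * t) = k]))); last first.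
  apply/seteqP; split => [[x t] /= Ax|[x t] [k _ [/= Au tk]]]; last first.
    by rewrite /= /up tk.
  by exists (Num.truncn (n.+1%:R * Num.max t 0)).
apply: bigcupT_measurable => k; apply: measurableX.
  by rewrite -[X in measurable X]setTI; apply: mu => //; rewrite divr_ge0.
rewrite (_ : _ @^-1` _ = (fun t : R => Num.max t 0) @^-1`
    (`[k%:R / n.+1%:R, k.+1%:R / n.+1%:R[)); last first.
  apply/seteqP; split => t /=; set s := Num.max t 0;
    have s0 : 0 <= n.+1%:R * s by rewrite mulr_ge0// /s le_max lexx orbT.
    move=> <-; rewrite in_itv/=.
    by rewrite ler_pdivrMr// ltr_pdivlMr// (mulrC s); exact: Num.Theory.truncn_itv.
  rewrite in_itv/= ler_pdivrMr// ltr_pdivlMr// (mulrC s) => /andP[h1 h2].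
  by apply/eqP; rewrite Num.Theory.truncn_eq// h1.
rewrite -[X in measurable X]setTI.
by apply: measurable_maxr.
Qed.

End discretization.

(** * Hitting times of continuous paths *)

Section entry.
Context (R : realType).

Lemma entry_time_ge0 (T : Type) (Y : R -> T) (A : set T) : (0 <= entry_time Y A)%E.
Proof. by apply: le_ereal_inf_tmp => _ [t [t0 _] <-]; rewrite lee_fin. Qed.

Lemma entry_time_le (T : Type) (Y : R -> T) (A : set T) (t : R) :
  0 <= t -> A (Y t) -> (entry_time Y A <= t%:E)%E.
Proof. by move=> t0 At; apply: ereal_inf_lbound; exists t. Qed.

Lemma entry_time_lt (T : Type) (Y : R -> T) (A : set T) (x : \bar R) :
  (entry_time Y A < x)%E -> exists t, [/\ 0 <= t, (t%:E < x)%E & A (Y t)].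
Proof. by move=> /ereal_inf_lt[_ [t [t0 At] <-] tx]; exists t. Qed.

Lemma stoppedE (t : R) (h : \bar R) : 0 <= t -> (0 <= h)%E ->
  (stopped t h)%:E = Order.min t%:E h.
Proof.
move=> t0 h0; rewrite /stopped fineK// ge0_fin_numE.
  by rewrite gt_min ltry.
by rewrite le_min lee_fin t0.
Qed.

Lemma stopped_ge0 (t : R) (h : \bar R) : 0 <= t -> (0 <= h)%E -> 0 <= stopped t h.
Proof. by move=> t0 h0; rewrite -lee_fin stoppedE// le_min lee_fin t0. Qed.

Lemma stopped_le (t : R) (h : \bar R) : 0 <= t -> (0 <= h)%E -> stopped t h <= t.
Proof. by move=> t0 h0; rewrite -lee_fin stoppedE// ge_min lexx. Qed.

Lemma stopped_l (t : R) (h : \bar R) : (t%:E <= h)%E -> stopped t h = t.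
Proof. by move=> th; rewrite /stopped min_l. Qed.

Lemma stopped_r (t : R) (h : R) : h <= t -> stopped t h%:E = h.
Proof. by move=> th; rewrite /stopped min_r. Qed.

End entry.

Section paths.
Context (R : realType) (b : R -> R).
Hypothesis cb : {within [set t | 0 <= t], continuous b}.

Lemma path_cvg (I : Type) (F : set_system I) {FF : ProperFilter F} (s : I -> R) (t : R) :
  (forall n, 0 <= s n) -> 0 <= t -> s n @[n --> F] --> t ->
  b (s n) @[n --> F] --> b t.
Proof.
move=> s0 t0 st.
have /subspace_continuousP/(_ t t0) bt := cb.
move=> A /bt; rewrite /= /within/= => tA.
suff: \forall n \near F, A (b (s n)) by [].
have : \forall n \near F, (0 <= s n -> A (b (s n))) by exact: (st _ tA).
by apply: filterS => n; apply.
Qed.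

Lemma path_open_right (t : R) (A : set R) : 0 <= t -> open A -> A (b t) ->
  exists2 e, 0 < e & forall s, t <= s < t + e -> A (b s).
Proof.
move=> t0 oA At.
have /subspace_continuousP/(_ t t0) bt := cb.
have /bt : nbhs (b t) A by exact: open_nbhs_nbhs.
rewrite /= /within/= => -[e /= e0 he]; exists e => // s /andP[ts se].
by apply: he => /=; [rewrite distrC ger0_norm ?subr_ge0//; lra|lra].
Qed.

Lemma path_open_left (t : R) (A : set R) : 0 < t -> open A -> A (b t) ->
  exists2 s, 0 <= s < t & A (b s).
Proof.
move=> t0 oA At.
have /subspace_continuousP/(_ t (ltW t0)) bt := cb.
have /bt : nbhs (b t) A by exact: open_nbhs_nbhs.
rewrite /= /within/= => -[e /= e0 he].
exists (Num.max 0 (t - e / 2)); first by rewrite le_max lexx/= gt_max t0; lra.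
apply: he => /=; last by rewrite le_max lexx.
by rewrite ger0_norm ?subr_ge0 ?ge_max ?ltW// ?ltrBlDr -?ltrBlDl ?lt_max; lra.
Qed.

Definition hit := entry_time b (~` [set y | 0 < y]).

Lemma hit_ge0 : (0 <= hit)%E.
Proof. exact: entry_time_ge0. Qed.

Lemma path_hit_gt0 (t : R) : 0 <= t -> (t%:E < hit)%E -> 0 < b t.
Proof.
move=> t0; rewrite ltNge => /negP h; rewrite ltNge; apply/negP => bt.
by apply: h; apply: entry_time_le => //=; apply/negP; rewrite -leNgt.
Qed.

Lemma path_at_hit (h : R) : hit = h%:E -> b h <= 0.
Proof.
move=> hE; have h0 : 0 <= h by rewrite -lee_fin -hE; exact: entry_time_ge0.
rewrite leNgt; apply/negP => bh.
have [e e0 he] := path_open_right h0 (@open_gt R 0) bh.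
have : (hit < (h + e)%:E)%E by rewrite hE lte_fin ltrDl.
move=> /entry_time_lt[t [t0 te nb]]; apply: (nb); apply: he.
by rewrite -[t < _]lte_fin te andbT -lee_fin -hE; exact: entry_time_le.
Qed.

(** Turns the event [hit <= r] into an event on the single value at the stopped time; the Brownian
    property on the edges is a statement about such values. *)
Lemma path_stopped_le0 (r : R) : 0 <= r -> (b (stopped r hit) <= 0) = (hit <= r%:E)%E.
Proof.
move=> r0; have h0 : (0 <= hit)%E by exact: entry_time_ge0.
have [hr|rh] := leP hit r%:E; last first.
  by rewrite stopped_l ?(ltW rh)// leNgt path_hit_gt0.
have : hit = (fine hit)%:E by rewrite fineK// ge0_fin_numE// (le_lt_trans hr) ?ltry.
by move=> hE; rewrite {1}hE stopped_r ?(path_at_hit hE)// -lee_fin -hE.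
Qed.

(** By continuity a negative value there would already occur a little earlier, before [hit], where
    the path is positive. *)
Lemma path_stopped_ge0 (r : R) : 0 <= r -> 0 < b 0 -> 0 <= b (stopped r hit).
Proof.
move=> r0 b0; have h0 : (0 <= hit)%E by exact: entry_time_ge0.
rewrite leNgt; apply/negP => bs.
have s0 := stopped_ge0 r0 h0.
have {}s0 : 0 < stopped r hit.
  by rewrite lt_def s0 andbT; apply/eqP => s0'; move: bs; rewrite s0'; lra.
have [s /andP[ss sr]] := path_open_left s0 (@open_lt R 0) bs.
rewrite /= ltNge => /negP; apply; apply/ltW/path_hit_gt0 => //.
rewrite -(@lte_fin R) in sr; apply: lt_le_trans sr _.
by rewrite stoppedE// ge_min lexx orbT.
Qed.

(** A grid can miss a path that touches a level and turns back, but not one that enters an open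
    half-line. Hence [hit] is approached through entries below small [del > 0], and each of these
    through grids. *)
Definition below (del : R) := entry_time b [set y | y < del].

Lemma below_ge0 (del : R) : (0 <= below del)%E.
Proof. exact: entry_time_ge0. Qed.

Lemma below_le_hit (del : R) : 0 < del -> (below del <= hit)%E.
Proof.
move=> d0; apply: ereal_inf_le_tmp => _ [t [t0 /= bt] <-]; exists t => //; split => //.
by move/negP: bt; rewrite -leNgt => /le_lt_trans; apply.
Qed.

Lemma path_stopped_below (r del : R) : 0 <= r -> del < b 0 ->
  del <= b (stopped r (below del)).
Proof.
move=> r0 b0; have h0 : (0 <= below del)%E by exact: entry_time_ge0.
rewrite leNgt; apply/negP => bs.
have s0 := stopped_ge0 r0 h0.
have {}s0 : 0 < stopped r (below del).
  by rewrite lt_def s0 andbT; apply/eqP => s0'; move: bs; rewrite s0'; lra.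
have [s /andP[ss sr] bs'] := path_open_left s0 (@open_lt R del) bs.
have := entry_time_le ss bs'; rewrite leNgt => /negP; apply.
rewrite -(@lte_fin R) in sr; apply: lt_le_trans sr _.
by rewrite stoppedE// ge_min lexx orbT.
Qed.

(** On a compact interval before [hit] the path has a positive minimum, and [del n] is eventually
    smaller than this minimum. *)
Lemma cvg_below (r : R) (del : nat -> R) : 0 <= r ->
  (forall n, 0 < del n) -> del n @[n --> \oo] --> 0 ->
  stopped r (below (del n)) @[n --> \oo] --> stopped r hit.
Proof.
move=> r0 del0 cdel; apply/cvgrPdist_lt => e e0.
have h0 : (0 <= hit)%E by exact: entry_time_ge0.
have g0 z : (0 <= below z)%E by exact: entry_time_ge0.
have le n : stopped r (below (del n)) <= stopped r hit.
  rewrite -lee_fin !stoppedE// le_min ge_min lexx/= ge_min.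
  by rewrite below_le_hit ?orbT.
have [S0|S0] := leP (stopped r hit) 0.
  apply: nearW => n; rewrite ger0_norm ?subr_ge0//.
  by have := stopped_ge0 r0 (g0 (del n)); lra.
pose s := Num.max 0 (stopped r hit - e / 2).
have s0 : 0 <= s by rewrite le_max lexx.
have sS : s < stopped r hit by rewrite gt_max S0/=; lra.
have sh : (s%:E < hit)%E.
  rewrite -(@lte_fin R) in sS; apply: lt_le_trans sS _.
  by rewrite stoppedE// ge_min lexx orbT.
have [|c cs mc] := @EVT_min R b 0 s s0.
  by apply: continuous_subspaceW cb => t/=; rewrite in_itv/= => /andP[].
have bc : 0 < b c.
  move: cs; rewrite in_itv/= => /andP[c0 cs]; apply: path_hit_gt0 => //.
  by apply: le_lt_trans sh; rewrite lee_fin.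
have : \forall n \near \oo, del n < b c by exact: (cvgr_lt 0 cdel).
apply: filterS => n /= nc.
rewrite ger0_norm ?subr_ge0//.
suff : s <= stopped r (below (del n)).
  have : stopped r hit - e / 2 <= s by rewrite le_max lexx orbT.
  lra.
rewrite -lee_fin stoppedE// le_min; apply/andP; split.
  by rewrite lee_fin (le_trans (ltW sS))// stopped_le.
rewrite leNgt; apply/negP => /entry_time_lt[t [t0 ts /=]].
apply/negP; rewrite -leNgt (le_trans (ltW nc))// mc// in_itv/= t0/= ltW//.
Qed.

Section grid.
Variables (del h : R).
Hypothesis h0 : 0 < h.

(** The first grid index at which the path is under [del], capped at [k]. The recursion is that of
    [frozen], so that [grid_exp] can match the two by induction. *)
Fixpoint gridx (k : nat) : nat :=
  if k is k'.+1 then if del <= b (h * (gridx k')%:R) then k else gridx k' else 0.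

Lemma gridxP k : [/\ (gridx k <= k)%N,
  forall j, (j < gridx k)%N -> del <= b (h * j%:R) &
  (gridx k < k)%N -> b (h * (gridx k)%:R) < del].
Proof.
elim: k => [|k [lek before after]]//=.
case: ifPn => [alive|]; last first.
  by rewrite -ltNge => dead; split => //; exact: leqW.
have kE : gridx k = k.
  apply/eqP; rewrite eqn_leq lek leqNgt; apply/negP => /after.
  by rewrite ltNge alive.
split => //; last by rewrite ltnn.
move=> j; rewrite ltnS leq_eqVlt => /orP[/eqP->|jk]; first by rewrite -{1}kE.
by apply: before; rewrite kE.
Qed.

End grid.

(** The mesh is such that the cap [n.+1] falls on time [r]. Grid times are never early; they are not
    late either, because the path stays under [del] for a while soon after its entry. *)
Lemma cvg_gridx (del r : R) : 0 < r ->
  r / n.+1%:R * (gridx del (r / n.+1%:R) n.+1)%:R @[n --> \oo] -->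
  stopped r (below del).
Proof.
move=> r0; pose h n := r / n.+1%:R; set S := stopped r (below del).
have g0 : (0 <= below del)%E by exact: entry_time_ge0.
have h0 n : 0 < h n by rewrite divr_gt0.
have hr n : h n * n.+1%:R = r by rewrite /h divfK.
pose rho n := h n * (gridx del (h n) n.+1)%:R.
have rho_le n : rho n <= r.
  rewrite -(hr n) ler_pM2l// ler_nat.
  by have [] := gridxP del (h n) n.+1.
have S_le n : S <= rho n.
  have [_ _ af] := gridxP del (h n) n.+1.
  have [/af bd|ge] := ltnP (gridx del (h n) n.+1) n.+1.
    rewrite -lee_fin stoppedE ?(ltW r0)// ge_min; apply/orP; right.
    by apply: entry_time_le => //; rewrite mulr_ge0// ltW.
  apply: (@le_trans _ _ r); first by rewrite stopped_le// ltW.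
  by rewrite -(hr n) ler_pM2l// ler_nat.
apply/cvgrPdist_lt => e e0.
have [rb|br] := leP r%:E (below del).
  apply: nearW => n; rewrite /= -/(h n) -/(rho n).
  have := S_le n; have := rho_le n; rewrite /S stopped_l// => ? ?.
  by rewrite ler0_norm; lra.
have bE : (below del) = S%:E by rewrite stoppedE ?(ltW r0)// min_r// ltW.
have : (below del < (S + e / 2)%:E)%E by rewrite bE lte_fin; lra.
move=> /entry_time_lt[t [t0]]; rewrite lte_fin => tS bt.
have [e' e'0 he'] := path_open_right t0 (@open_lt R del) bt.
(* A mesh below [e'] puts a grid point into the interval where the path is under [del]; a mesh below
   [e / 2], added to [t < S + e / 2], keeps that point within [e] of [S]. *)
have eps0 : 0 < Num.min e' (e / 2) / r by rewrite divr_gt0// lt_min e'0; lra.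
have := near_infty_natSinv_lt (PosNum eps0); apply: filterS => n /=.
rewrite ltr_pdivlMr// mulrC -/(h n) lt_min => /andP[he hee].
rewrite -/(h n) -/(rho n) distrC ger0_norm ?subr_ge0//.
(* The first grid index strictly after [t]. *)
pose k := (Num.truncn (t / h n)).+1.
have tk : t < h n * k%:R <= t + h n.
  have /truncn_itv/andP[h1 h2] : 0 <= t / h n by rewrite divr_ge0// ltW.
  rewrite mulrC -ltr_pdivrMr// h2/= /k -natr1 mulrDl mul1r lerD2r.
  by rewrite -ler_pdivlMr.
case/andP: tk => tk1 tk2.
suff : rho n <= h n * k%:R by lra.
rewrite leNgt; apply/negP; rewrite /rho ltr_pM2l// ltr_nat => kg.
have [_ /(_ _ kg) + _] := gridxP del (h n) n.+1.
by rewrite leNgt he'//; lra.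
Qed.

End paths.

(** * Exponential martingale of a Gaussian walk *)

Lemma ge0_integral_setUC d (T : measurableType d) (R : realType)
    (mu : {measure set T -> \bar R}) (D : set T) (f : T -> \bar R) :
  measurable D -> measurable_fun setT f -> (forall x, 0 <= f x)%E ->
  (\int[mu]_x f x = \int[mu]_(x in D) f x + \int[mu]_(x in ~` D) f x)%E.
Proof.
move=> mD mf f0; rewrite -(setUv D) ge0_integral_setU//.
- exact: measurableC.
- by rewrite setUv.
- exact/disj_setPCl.
Qed.

Section independence.
Context d (Om : measurableType d) (R : realType) (P : probability Om R).
Variables (xi : nat -> Om -> R) (m : nat -> probability (measurableTypeR R) R).
Hypothesis mxi : forall i, measurable_fun setT (xi i).
Hypothesis Pxi : forall n (A : nat -> set R), (forall i, measurable (A i)) ->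
  P (\bigcap_(i < n) [set w | A i (xi i w)]) = (\prod_(i < n) m i (A i))%E.

Definition history (n : nat) : set (set Om) :=
  [set S | exists2 A : nat -> set R, (forall i, measurable (A i)) &
    S = \bigcap_(i < n) [set w | A i (xi i w)]].

(** The same space with the sigma-algebra of the first [n] increments. Being a measurable type of
    its own, it can be a factor of a product. *)
Definition past (n : nat) := g_sigma_algebraType (history n).

Lemma history_measurable n : history n `<=` measurable.
Proof.
move=> _ [A mA ->]; apply: bigcap_measurableType => i _.
by rewrite -[X in measurable X]setTI; exact: mxi.
Qed.

Lemma past_measurable n (S : set (past n)) : measurable S -> d.-measurable (S : set Om).
Proof.
apply: smallest_sub; last exact: history_measurable.
exact: sigma_algebra_measurable.
Qed.

Lemma measurable_past_xi n i : (i < n)%N -> measurable_fun setT (xi i : past n -> R).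
Proof.
move=> lin _ A mA; rewrite setTI; apply: sub_sigma_algebra.
exists (fun j => if j == i then A else setT); first by move=> j; case: ifP.
apply/seteqP; split => [w /= Aw j /= _|w /(_ i lin)/=]; last by rewrite eqxx.
by case: eqP => // ->.
Qed.

(** Both sides are finite measures in [S]. The hypothesis on [n.+1] increments makes them agree on
    [history n], which generates and is stable under intersections. *)
Lemma past_indep n (S : set Om) (C : set R) : <<s history n >> S -> measurable C ->
  P (S `&` [set w | C (xi n w)]) = (P S * m n C)%E.
Proof.
move=> hS mC.
have mD : measurable [set w | C (xi n w)].
  by rewrite -[X in measurable X]setTI; exact: mxi.
have mCfin : m n C \is a fin_num by exact: fin_num_measure.
have c0 : 0 <= fine (m n C) by rewrite fine_ge0.
suff : mrestr P mD S = mscale (NngNum c0) P S.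
  by rewrite /mrestr/mscale/= fineK// muleC.
apply: (@g_sigma_algebra_measure_unique _ _ _ (history n)
  (@history_measurable n) (fun=> setT) _ _ (mrestr P mD) (mscale (NngNum c0) P)) => //.
- by move=> _; exists (fun=> setT) => //; apply/seteqP; split.
- by apply/seteqP; split => // w _; exists 0%N.
- move=> _ _ [A mA ->] [A' mA' ->]; exists (fun i => A i `&` A' i).
    by move=> i; exact: measurableI.
  by rewrite -bigcapI.
- move=> _ [A mA ->]; rewrite -[RHS]/((fine (m n C))%:E * P _)%E fineK// Pxi//.
  rewrite -[LHS]/(P (_ `&` _)).
  pose A' i := if i == n then C else A i.
  have := Pxi n.+1 (A := A'); rewrite big_ord_recr/= /A' eqxx => H.
  rewrite muleC; under [in RHS]eq_bigr => i _.
    rewrite (_ : A i = A' i); last by rewrite /A' ltn_eqF.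
    over.
  rewrite /A' -H; last by move=> i; case: ifP.
  congr (P _); apply/seteqP; split => [w [/= wA wC] i /= lin|w wA].
    case: eqP => [->//|/eqP ni]; apply: wA => /=.
    by rewrite ltn_neqAle ni -ltnS.
  split => [i /= lin|]; last by have := wA n (ltnSn n); rewrite /= eqxx.
  by have := wA i (leqW lin); rewrite /= ltn_eqF.
- by move=> _; rewrite -[ltLHS]/(P (setT `&` _)) setTI (le_lt_trans (probability_le1 _ _))// ltry.
Qed.

(** Independence says that the law of [(w, xi n w)] on [past n] times the line is a product measure;
    Tonelli then separates the two integrals. *)
Lemma integral_past n (f : past n -> \bar R) (k : measurableTypeR R -> \bar R) :
  measurable_fun setT f -> (forall w, 0 <= f w)%E ->
  measurable_fun setT k -> (forall x, 0 <= k x)%E ->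
  (\int[P]_w (f w * k (xi n w)) = (\int[P]_w f w) * \int[m n]_x k x)%E.
Proof.
move=> mf f0 mk k0.
have mid : measurable_fun setT (id : Om -> past n).
  by move=> _ A mA; rewrite setTI; exact: (past_measurable mA).
pose phi (w : Om) : past n * measurableTypeR R := (w, xi n w).
have mphi : measurable_fun setT phi by apply: measurable_fun_pair => //; exact: mxi.
pose mid_pack : {mfun Om >-> past n} :=
  HB.pack (id : Om -> past n) (isMeasurableFun.Build _ _ _ _ _ mid).
pose mphi_pack : {mfun Om >-> (past n * measurableTypeR R)%type} :=
  HB.pack phi (isMeasurableFun.Build _ _ _ _ _ mphi).
pose P1 : probability (past n) R := distribution P mid_pack.
pose Q : probability (past n * measurableTypeR R)%type R := distribution P mphi_pack.
have PQ : forall X, measurable X -> (P1 \x m n)%E X = Q X.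
  apply: product_measure_unique => A B mA mB.
  exact: (past_indep mA mB).
pose F (z : past n * measurableTypeR R) := (f z.1 * k z.2)%E.
have mF : measurable_fun setT F.
  by apply: (emeasurable_funM (f := f \o fst) (g := k \o snd)); exact: measurableT_comp.
have F0 z : (0 <= F z)%E by rewrite mule_ge0.
transitivity (\int[Q]_z F z)%E.
  by rewrite (ge0_integral_pushforward mphi).
transitivity (\int[P1 \x m n]_z F z)%E.
  by apply: eq_measure_integral => A mA _; exact/esym/PQ.
rewrite fubini_tonelli1//.
have kI : (0 <= \int[m n]_x k x)%E by exact: integral_ge0.
transitivity (\int[P1]_w (f w * \int[m n]_x k x))%E.
  by apply: eq_integral => w _; rewrite /fubini_F -ge0_integralZl.
by rewrite ge0_integralZr// (ge0_integral_pushforward mid).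
Qed.

End independence.

Section martingale.
Context d (Om : measurableType d) (R : realType) (P : probability Om R).
Variables (xi : nat -> Om -> R) (h : R) (h0 : 0 < h).
Let m (i : nat) : probability (measurableTypeR R) R := normal_prob 0 (Num.sqrt h).
Hypothesis mxi : forall i, measurable_fun setT (xi i).
Hypothesis Pxi : forall n (A : nat -> set R), (forall i, measurable (A i)) ->
  P (\bigcap_(i < n) [set w | A i (xi i w)]) = (\prod_(i < n) m i (A i))%E.
Variables (y del th : R).

(** Completing the square turns the weighted density into the normal density with mean
    [- th * h]. *)
Lemma normal_exp : (\int[m 0]_x (expR (- th * x - th ^+ 2 / 2 * h))%:E = 1)%E.
Proof.
have s0 : Num.sqrt h != 0 by rewrite gt_eqF// sqrtr_gt0.
rewrite (@ge0_integral_density _ _ _ lebesgue_measure _ (normal_pdf 0 (Num.sqrt h)))//.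
- rewrite -(integral_normal_pdf (- th * h) (Num.sqrt h)).
  apply: eq_integral => x _; rewrite -EFinM; congr (_%:E).
  rewrite !normal_pdfE// mulrCA /normal_fun -expRD; congr (_ * expR _).
  rewrite sqr_sqrtr ?(ltW h0)//; field; exact: lt0r_neq0.
- exact: measurable_normal_pdf.
- by move=> x; exact: normal_pdf_ge0.
- apply/measurable_EFinP; apply: measurableT_comp => //.
  by apply: measurable_funB => //; exact: measurable_funM.
Qed.

Definition walk (k : nat) (w : Om) : R := y + \sum_(i < k) xi i w.

(* The walk and the current time, both frozen as soon as the walk is below
   [del]. *)
Fixpoint frozen (k : nat) (w : Om) : R * R :=
  if k is k'.+1 then
    if del <= (frozen k' w).1 then (walk k w, k%:R) else frozen k' w
  else (walk 0 w, 0).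

Definition frozen_exp (k : nat) (w : Om) : R :=
  expR (- th * (frozen k w).1 - th ^+ 2 / 2 * h * (frozen k w).2).

Lemma frozen_alive k w : del <= (frozen k w).1 -> frozen k w = (walk k w, k%:R).
Proof.
by case: k => //= k; case: ifPn => // /negbTE h1; rewrite h1.
Qed.

Lemma measurable_walk n k : (k <= n)%N ->
  measurable_fun setT (walk k : past xi n -> R).
Proof.
move=> kn; apply: measurable_funD => //; apply: measurable_sum => i.
by apply: measurable_past_xi; apply: leq_trans kn.
Qed.

Lemma measurable_frozen n k : (k <= n)%N ->
  measurable_fun setT (fun w : past xi n => (frozen k w).1) /\
  measurable_fun setT (fun w : past xi n => (frozen k w).2).
Proof.
elim: k => [|k IH] kn /=; first by split => //; exact: measurable_walk.
have [IH1 IH2] := IH (ltnW kn).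
have mb : measurable_fun setT (fun w : past xi n => del <= (frozen k w).1).
  exact: measurable_fun_ler.
split.
  rewrite (_ : (fun _ => _) = fun w => if del <= (frozen k w).1
    then walk k.+1 w else (frozen k w).1); last by apply/funext => w; case: ifP.
  by apply: measurable_fun_ifT => //; exact: measurable_walk.
rewrite (_ : (fun _ => _) = fun w => if del <= (frozen k w).1
    then k.+1%:R else (frozen k w).2); last by apply/funext => w; case: ifP.
exact: measurable_fun_ifT.
Qed.

Lemma measurable_frozen_exp n k : (k <= n)%N ->
  measurable_fun setT (frozen_exp k : past xi n -> R).
Proof.
move=> kn; have [m1 m2] := measurable_frozen kn.
apply: measurableT_comp => //; apply: measurable_funB; exact: measurable_funM.
Qed.

(** Optional stopping by hand: whether the walk is still above [del] is known to [past n]. If it is,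
    the next factor has mean 1 by [normal_exp]; if not, nothing changes any more. *)
Lemma integral_frozen_exp n : (\int[P]_w (frozen_exp n w)%:E = (expR (- th * y))%:E)%E.
Proof.
elim: n => [|n IH].
  rewrite (eq_integral (fun=> (expR (- th * y))%:E)).
    by rewrite integral_cst//= probability_setT mule1.
  by move=> w _; rewrite /frozen_exp/= /walk big_ord0 addr0 mulr0 subr0.
rewrite -IH; pose D := [set w | del <= (frozen n w).1].
have mD : measurable (D : set (past xi n)).
  rewrite -[X in measurable X]setTI.
  exact: (measurable_fun_ler (measurable_cst _) (measurable_frozen (leqnn n)).1 measurableT (Y := [set true])).
have mDO : measurable D by exact: (past_measurable mxi mD).
have mE k : measurable_fun setT (frozen_exp k : Om -> R).
  move=> _ A mA; rewrite setTI; apply: (@past_measurable _ _ _ _ mxi k).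
  by rewrite -[X in measurable X]setTI; exact: measurable_frozen_exp.
have E0 k w : (0 <= (frozen_exp k w)%:E)%E by rewrite lee_fin expR_ge0.
rewrite (@ge0_integral_setUC _ _ _ P D) ?[RHS](@ge0_integral_setUC _ _ _ P D)//; last 2 first.
- exact/measurable_EFinP.
- exact/measurable_EFinP.
congr (_ + _)%E; last first.
  apply: eq_integral => w; rewrite inE /D/= => /negP/negbTE nD.
  by rewrite /frozen_exp/= nD.
pose f (w : past xi n) := (frozen_exp n w * \1_D w)%:E.
pose k (x : measurableTypeR R) := (expR (- th * x - th ^+ 2 / 2 * h))%:E.
transitivity (\int[P]_w (f w * k (xi n w)))%E.
  rewrite integral_mkcond; apply: eq_integral => w _.
  rewrite patchE /f indicE; case: ifPn => [|]; last by rewrite mulr0 mul0e.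
  rewrite inE /D/= => Dw; rewrite mulr1 /k -EFinM /frozen_exp/= Dw frozen_alive//=.
  rewrite -expRD /walk big_ord_recr/=; congr (expR _)%:E.
  by rewrite -natr1; ring.
rewrite (integral_past mxi Pxi)//.
- rewrite normal_exp mule1 [RHS]integral_mkcond; apply: eq_integral => w _.
  by rewrite patchE /f indicE; case: (w \in D); rewrite ?mulr1 ?mulr0.
- apply/measurable_EFinP; apply: measurable_funM; first exact: measurable_frozen_exp.
  exact: measurable_indic.
- by move=> w; rewrite lee_fin mulr_ge0// expR_ge0.
- apply/measurable_EFinP; apply: measurableT_comp => //.
  by apply: measurable_funB => //; exact: measurable_funM.
- by move=> x; rewrite lee_fin expR_ge0.
Qed.

End martingale.

(** * Hitting times of Brownian motion *)

Lemma near_natS (R : realType) (x : R) : \forall n \near \oo, x <= n.+1%:R.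
Proof.
by have := nbhs_infty_ger x; apply: filterS => n /le_trans; apply; rewrite ler_nat.
Qed.

Lemma cvg_natS (R : realType) : (n.+1%:R : R) @[n --> \oo] --> +oo.
Proof. by apply/cvgryPge => x; exact: near_natS. Qed.

Lemma cvg_mul_natS (R : realType) (a : R) : 0 < a ->
  a * n.+1%:R @[n --> \oo] --> +oo.
Proof.
move=> a0; apply/cvgryPge => x; have := near_natS (x / a).
by apply: filterS => n; rewrite ler_pdivrMr// mulrC.
Qed.

Section path_measurability.
Context d (Om : measurableType d) (R : realType) (b : R -> Om -> R).
Hypothesis mb : forall t, 0 <= t -> measurable_fun setT (b t).
Hypothesis cb : forall w, {within [set t | 0 <= t], continuous (b ^~ w)}.

(** Measurability of times and of positions at these times is obtained together, first on grids,
    then for [below] and finally for [hit], by pointwise limits. *)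
Lemma measurable_grid (del h : R) k : 0 <= h ->
  measurable_fun setT (fun w => h * (gridx (b ^~ w) del h k)%:R) /\
  measurable_fun setT (fun w => b (h * (gridx (b ^~ w) del h k)%:R) w).
Proof.
move=> h0; elim: k => [|k [IH1 IH2]]/=; first by split => //; apply: mb; rewrite mulr0.
have mif : measurable_fun setT
    (fun w => del <= b (h * (gridx (b ^~ w) del h k)%:R) w).
  exact: measurable_fun_ler.
split.
  rewrite (_ : (fun _ => _) = fun w =>
      if del <= b (h * (gridx (b ^~ w) del h k)%:R) w then h * k.+1%:R
      else h * (gridx (b ^~ w) del h k)%:R); last by apply/funext => w; case: ifP.
  exact: measurable_fun_ifT.
rewrite (_ : (fun _ => _) = fun w =>
    if del <= b (h * (gridx (b ^~ w) del h k)%:R) w then b (h * k.+1%:R) w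
    else b (h * (gridx (b ^~ w) del h k)%:R) w); last by apply/funext => w; case: ifP.
by apply: measurable_fun_ifT => //; apply: mb; rewrite mulr_ge0.
Qed.

Lemma grid_path_cvg (del r : R) w : 0 < r ->
  b (r / n.+1%:R * (gridx (b ^~ w) del (r / n.+1%:R) n.+1)%:R) w @[n --> \oo] -->
  b (stopped r (below (b ^~ w) del)) w.
Proof.
move=> r0; apply: (@path_cvg _ _ (@cb w) _ _ _
  (fun n => r / n.+1%:R * (gridx (b ^~ w) del (r / n.+1%:R) n.+1)%:R) _ _ _ (cvg_gridx (@cb w) r0)).
- by move=> n; rewrite mulr_ge0// divr_ge0// ltW.
- by apply: stopped_ge0; [exact: ltW|exact: below_ge0].
Qed.

Lemma measurable_below (del r : R) : 0 < r ->
  measurable_fun setT (fun w => stopped r (below (b ^~ w) del)) /\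
  measurable_fun setT (fun w => b (stopped r (below (b ^~ w) del)) w).
Proof.
move=> r0; split.
  apply: (measurable_fun_cvg (h := fun n w => r / n.+1%:R * (gridx (b ^~ w) del (r / n.+1%:R) n.+1)%:R)).
    by move=> n; apply: (measurable_grid _ _ _).1; rewrite divr_ge0// ltW.
  by move=> w _; exact: (cvg_gridx (@cb w) r0).
apply: (measurable_fun_cvg (h := fun n w => b (r / n.+1%:R * (gridx (b ^~ w) del (r / n.+1%:R) n.+1)%:R) w)).
  by move=> n; apply: (measurable_grid _ _ _).2; rewrite divr_ge0// ltW.
by move=> w _; exact: grid_path_cvg.
Qed.

Lemma below_path_cvg (del : nat -> R) (r : R) w : 0 <= r ->
  (forall n, 0 < del n) -> del n @[n --> \oo] --> 0 ->
  b (stopped r (below (b ^~ w) (del n))) w @[n --> \oo] -->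
  b (stopped r (hit (b ^~ w))) w.
Proof.
move=> r0 del0 cdel.
apply: (@path_cvg _ _ (@cb w) _ _ _ (fun n => stopped r (below (b ^~ w) (del n)))
  _ _ _ (cvg_below (@cb w) r0 del0 cdel)).
- by move=> n; rewrite stopped_ge0// below_ge0.
- by rewrite stopped_ge0// hit_ge0.
Qed.

Lemma measurable_hit_stopped (r : R) : 0 < r ->
  measurable_fun setT (fun w => stopped r (hit (b ^~ w))) /\
  measurable_fun setT (fun w => b (stopped r (hit (b ^~ w))) w).
Proof.
move=> r0.
pose del n : R := n.+1%:R^-1.
have del0 n : 0 < del n by rewrite invr_gt0.
have cdel : del n @[n --> \oo] --> 0 by exact: cvg_harmonic.
split.
  apply: (measurable_fun_cvg (h := fun n w => stopped r (below (b ^~ w) (del n)))).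
    by move=> n; exact: (measurable_below _ r0).1.
  by move=> w _; exact: (cvg_below (@cb w) (ltW r0) del0 cdel).
apply: (measurable_fun_cvg (h := fun n w => b (stopped r (below (b ^~ w) (del n))) w)).
  by move=> n; exact: (measurable_below _ r0).2.
by move=> w _; apply: below_path_cvg => //; exact: ltW.
Qed.

Lemma measurable_hit : measurable_fun setT (fun w => hit (b ^~ w)).
Proof.
apply: (emeasurable_fun_cvg (fun n w => (stopped n.+1%:R (hit (b ^~ w)))%:E)).
  by move=> n; apply/measurable_EFinP; exact: (measurable_hit_stopped _).1.
move=> w _; have h0 : (0 <= hit (b ^~ w))%E by exact: entry_time_ge0.
case hE : (hit (b ^~ w)) h0 => [h| |]// h0.
  apply: cvg_near_cst; near=> n; rewrite stopped_r//.
  by near: n; exact: near_natS.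
rewrite (_ : (fun _ => _) = fun n => (n.+1%:R)%:E); last first.
  by apply/funext => n; rewrite stopped_l ?leey.
apply/cvgeryP; exact: cvg_natS.
Unshelve. all: by end_near. Qed.

End path_measurability.

(* [Y n <= min (Y n) K + (Y n) ^ 2 / K], and [min (Y n) K] is dominated. *)
Lemma integral_cvg_L2 d (Om : measurableType d) (R : realType) (P : probability Om R)
    (Y : nat -> Om -> R) (Z : Om -> R) (c C : R) :
  (forall n, measurable_fun setT (Y n)) -> (forall n w, 0 <= Y n w) ->
  (forall w, Y n w @[n --> \oo] --> Z w) -> (forall w, Z w <= 1) ->
  (forall n, \int[P]_w (Y n w)%:E = c%:E)%E ->
  (forall n, \int[P]_w (Y n w ^+ 2)%:E <= C%:E)%E ->
  (\int[P]_w (Z w)%:E = c%:E)%E.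
Proof.
move=> mY Y0 YZ Z1 Yc YC.
have mZ : measurable_fun setT Z by exact: (measurable_fun_cvg mY).
have Z0 w : 0 <= Z w by apply: (cvgr_to_ge (YZ w)); exact: nearW.
have C0 : 0 <= C.
  rewrite -lee_fin; apply: le_trans (YC 0%N); apply: integral_ge0 => w _.
  by rewrite lee_fin sqr_ge0.
pose YK (K : R) n w := Num.min (Y n w) K.
have mYK K n : measurable_fun setT (YK K n) by exact: measurable_minr.
have YK0 K n w : 1 < K -> 0 <= YK K n w.
  by move=> K1; rewrite le_min Y0/= (le_trans ler01)// ltW.
have cvgK K : 1 < K -> (\int[P]_w (YK K n w)%:E @[n --> \oo] --> \int[P]_w (Z w)%:E)%E.
  move=> K1.
  have [] := @dominated_convergence _ _ _ P setT measurableT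
    (fun n w => (YK K n w)%:E) (fun w => (Z w)%:E) (fun=> K%:E) => //.
  - by move=> n; exact/measurable_EFinP.
  - exact/measurable_EFinP.
  - apply: aeW => w _; apply: cvg_EFin; first exact: nearW.
    apply: cvg_trans (YZ w); apply: near_eq_cvg.
    have : \forall n \near \oo, Y n w < K.
      by apply: (cvgr_lt _ (YZ w)); exact: le_lt_trans K1.
    by apply: filterS => n /ltW h; rewrite /YK /= min_l.
  - apply/integrableP; split => //; rewrite integral_cst//= probability_setT mule1.
    by rewrite ltry.
  - apply: aeW => w n _; rewrite /= lee_fin ger0_norm ?YK0//.
    by rewrite ge_min lexx orbT.
have up (K : R) : 1 < K -> (\int[P]_w (Z w)%:E <= c%:E)%E.
  move=> K1; apply: (cvge_to_le (cvgK K K1)); apply: nearW => n.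
  rewrite -(Yc n); apply: ge0_le_integral => //.
  - by move=> w _; rewrite lee_fin YK0.
  - exact/measurable_EFinP.
  - exact/measurable_EFinP.
  - by move=> w _; rewrite lee_fin ge_min lexx.
have dn (K : R) : 1 < K -> (c%:E - (C / K)%:E <= \int[P]_w (Z w)%:E)%E.
  move=> K1; apply: (cvge_to_ge (cvgK K K1)); apply: nearW => n.
  have K0 : 0 < K by apply: lt_trans K1.
  rewrite leeBlDr// -(Yc n).
  apply: (@le_trans _ _ (\int[P]_w ((YK K n w)%:E + (K^-1)%:E * (Y n w ^+ 2)%:E)))%E.
    apply: ge0_le_integral => //.
    - by move=> w _; rewrite lee_fin.
    - exact/measurable_EFinP.
    - apply: emeasurable_funD; first exact/measurable_EFinP.
      by apply/measurable_EFinP; apply: measurable_funM => //; exact: measurable_funX.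
    - move=> w _; rewrite -EFinM -EFinD lee_fin /YK.
      have [YlK|KY] := leP (Y n w) K.
        by rewrite lerDl mulr_ge0 ?sqr_ge0// invr_ge0 ltW.
      have : Y n w <= K^-1 * Y n w ^+ 2.
        rewrite expr2 mulrA ler_peMl// mulrC ler_pdivlMr// mul1r ltW//.
      lra.
  rewrite ge0_integralD//.
  - apply: leeD => //; rewrite ge0_integralZl//.
    + by rewrite mulrC EFinM lee_wpmul2l// lee_fin invr_ge0 ltW.
    + by apply/measurable_EFinP; exact: measurable_funX.
    + by move=> w _; rewrite lee_fin sqr_ge0.
    + by rewrite lee_fin invr_ge0 ltW.
  - by move=> w _; rewrite lee_fin YK0.
  - exact/measurable_EFinP.
  - by move=> w _; rewrite -EFinM lee_fin mulr_ge0 ?sqr_ge0// invr_ge0 ltW.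
  - by apply/measurable_EFinP; apply: measurable_funM => //; exact: measurable_funX.
apply/eqP; rewrite eq_le (up 2)//= ?ltr1n//.
apply/lee_addgt0Pr => e e0.
have Ce : 0 <= C / e by rewrite divr_ge0// ltW.
(* At the truncation level [K = 2 + C / e] the error [C / K] is at most [e]. *)
have K1 : 1 < 2 + C / e by lra.
have K0 : 0 < 2 + C / e by lra.
have := dn _ K1; rewrite leeBlDr// => /le_trans; apply.
rewrite leeD2l// lee_fin ler_pdivrMr// mulrDr mulrCA divff ?gt_eqF//.
by rewrite mulr1 lerDr mulr_ge0// ltW.
Qed.

Section stopped_exponential.
Context d (Om : measurableType d) (R : realType) (P : probability Om R).
Variables (b : R -> Om -> R) (y : R).
Hypothesis mb : forall t, 0 <= t -> measurable_fun setT (b t).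
Hypothesis cb : forall w, {within [set t | 0 <= t], continuous (b ^~ w)}.
Hypothesis b0 : forall w, b 0 w = y.
Hypothesis incr : forall n (t : nat -> R) (A : nat -> set R),
  0 <= t 0%N -> (forall i, (i < n)%N -> t i < t i.+1) ->
  (forall i, measurable (A i)) ->
  P (\bigcap_(i < n) [set w | A i (b (t i.+1) w - b (t i) w)]) =
  (\prod_(i < n) normal_prob 0 (Num.sqrt (t i.+1 - t i)) (A i))%E.

(** The exponential martingale of Brownian motion. *)
Definition mart (th t : R) (w : Om) := expR (- th * b t w - th ^+ 2 / 2 * t).

Lemma grid_exp (th del r : R) n : 0 < r ->
  (\int[P]_w (mart th (r / n.+1%:R * (gridx (b ^~ w) del (r / n.+1%:R) n.+1)%:R) w)%:E =
   (expR (- th * y))%:E)%E.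
Proof.
move=> r0; set h := r / n.+1%:R.
have h0 : 0 < h by rewrite divr_gt0.
pose xi i w := b (h * i.+1%:R) w - b (h * i%:R) w.
have mxi i : measurable_fun setT (xi i).
  by apply: measurable_funB; apply: mb; rewrite mulr_ge0// ltW.
have Pxi k (A : nat -> set R) : (forall i, measurable (A i)) ->
    P (\bigcap_(i < k) [set w | A i (xi i w)]) =
    (\prod_(i < k) normal_prob 0 (Num.sqrt h) (A i))%E.
  move=> mA; have H : P (\bigcap_(i < k) [set w | A i (xi i w)]) =
      (\prod_(i < k) normal_prob 0 (Num.sqrt (h * i.+1%:R - h * i%:R)) (A i))%E.
    apply: (@incr k (fun i => h * i%:R) A) => //; first by rewrite mulr0.
    by move=> i _; rewrite ltr_pM2l// ltr_nat.
  apply: (eq_trans H); apply: eq_bigr => i _.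
  by rewrite -mulrBr -natr1 addrAC subrr add0r mulr1.
rewrite -(integral_frozen_exp h0 mxi Pxi y del th n.+1).
have walkE k w : walk xi y k w = b (h * k%:R) w.
  elim: k => [|k IH]; first by rewrite /walk big_ord0 addr0 mulr0 b0.
  by move: IH; rewrite /walk big_ord_recr/= addrA => ->; rewrite /xi; ring.
have frozenE k w : frozen xi y del k w =
    (b (h * (gridx (b ^~ w) del h k)%:R) w, (gridx (b ^~ w) del h k)%:R).
  elim: k => [|k IH]; first by rewrite /= walkE.
  by rewrite /= IH walkE /=; case: ifP.
apply: eq_integral => w _; rewrite /frozen_exp frozenE/= /mart.
by congr (expR _)%:E; ring.
Qed.

(** At its first grid point under [del] the path may be far below 0, so [mart th] is unbounded along
    the grids. But its square at a time [q <= r] is [expR (th ^+ 2 * q)] times [mart (2 * th)],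
    whose mean [grid_exp] computes too: this bounds the second moments. *)
Lemma below_exp (th del r : R) : 0 < th -> 0 <= del -> del < y -> 0 < r ->
  (\int[P]_w (mart th (stopped r (below (b ^~ w) del)) w)%:E =
   (expR (- th * y))%:E)%E.
Proof.
move=> th0 del0 dy r0.
pose rho n w := r / n.+1%:R * (gridx (b ^~ w) del (r / n.+1%:R) n.+1)%:R.
have rho0 n w : 0 <= rho n w by rewrite mulr_ge0// divr_ge0// ltW.
have rhor n w : rho n w <= r.
  rewrite /rho mulrAC ler_pdivrMr// ler_pM2l// ler_nat.
  by have [] := gridxP (b ^~ w) del (r / n.+1%:R) n.+1.
have [m1 m2] : (forall n, measurable_fun setT (rho n)) /\
    (forall n, measurable_fun setT (fun w => b (rho n w) w)).
  split => n; first by apply: (measurable_grid _ _ _ _).1 => //; rewrite divr_ge0// ltW.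
  by apply: (measurable_grid _ _ _ _).2 => //; rewrite divr_ge0// ltW.
have mm t n : measurable_fun setT (fun w => mart t (rho n w) w).
  by apply: measurableT_comp => //; apply: measurable_funB; exact: measurable_funM.
apply: (@integral_cvg_L2 _ _ _ P (fun n w => mart th (rho n w) w) _ _
  (expR (th ^+ 2 * r) * expR (- (2 * th) * y))) => //.
- by move=> n w; exact: expR_ge0.
- move=> w; apply: (cvg_comp _ expR); last exact: continuous_expR.
  apply: cvgB; apply: cvgMl_tmp.
    exact: grid_path_cvg.
  exact: (cvg_gridx (@cb w) r0).
- move=> w; rewrite -expR0 ler_expR.
  have s0 : 0 <= stopped r (below (b ^~ w) del) by rewrite stopped_ge0 ?below_ge0 ?hit_ge0// ltW.
  have bs : del <= b (stopped r (below (b ^~ w) del)) w.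
    by apply: (path_stopped_below (@cb w)); rewrite ?b0// ltW.
  have p1 : 0 <= th * b (stopped r (below (b ^~ w) del)) w.
    by apply: mulr_ge0; [exact: ltW|exact: le_trans bs].
  have p2 : 0 <= th ^+ 2 / 2 * stopped r (below (b ^~ w) del) by rewrite mulr_ge0// divr_ge0// sqr_ge0.
  by lra.
- by move=> n; exact: grid_exp.
- move=> n; rewrite EFinM -(grid_exp (2 * th) del n r0) -ge0_integralZl//.
  + apply: ge0_le_integral => //.
    * by move=> w _; rewrite lee_fin sqr_ge0.
    * by apply/measurable_EFinP; exact: measurable_funX.
    * by apply/measurable_EFinP; apply: measurable_funM => //; exact: mm.
    * move=> w _; rewrite -EFinM lee_fin -/(rho n w) /mart -expRM_natl -expRD ler_expR.
      have : th ^+ 2 * rho n w <= th ^+ 2 * r by rewrite ler_wpM2l ?sqr_ge0.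
      set B := b _ _; set q := rho n w; rewrite !expr2; move=> ?.
      rewrite -subr_ge0 (_ : _ - _ = th * th * r - th * th * q) ?subr_ge0//.
      by field.
  + exact/measurable_EFinP/mm.
  + by move=> w _; rewrite lee_fin expR_ge0.
Qed.

(** Up to the entry below [del n] the path is at least [del n > 0], so the stopped martingale is at
    most 1, and so is its second moment. *)
Lemma hit_exp (th r : R) : 0 < th -> 0 < y -> 0 < r ->
  (\int[P]_w (mart th (stopped r (hit (b ^~ w))) w)%:E = (expR (- th * y))%:E)%E.
Proof.
move=> th0 y0 r0.
(* The factor [y / 2] keeps every level strictly below the starting point, as [below_exp]
   requires. *)
pose del n : R := y / 2 * n.+1%:R^-1.
have del0 n : 0 < del n by rewrite mulr_gt0 ?divr_gt0// invr_gt0.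
have dely n : del n < y.
  rewrite /del ltr_pdivrMr// (@lt_le_trans _ _ y)//; first lra.
  by apply: ler_peMr; [exact: ltW|rewrite ler1n].
have cdel : del n @[n --> \oo] --> 0.
  by rewrite -[X in _ --> X](mulr0 (y / 2)); apply: cvgMl_tmp; exact: cvg_harmonic.
have ge0p w : 0 <= b (stopped r (hit (b ^~ w))) w.
  by apply: (path_stopped_ge0 (@cb w)); rewrite ?b0// ltW.
apply: (@integral_cvg_L2 _ _ _ P
  (fun n w => mart th (stopped r (below (b ^~ w) (del n))) w) _ _ 1) => //.
- move=> n; have [m1 m2] := measurable_below mb cb (del n) r0.
  by apply: measurableT_comp => //; apply: measurable_funB; exact: measurable_funM.
- by move=> n w; exact: expR_ge0.
- move=> w; apply: (cvg_comp _ expR); last exact: continuous_expR.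
  apply: cvgB; apply: cvgMl_tmp.
    by apply: below_path_cvg => //; exact: ltW.
  by exact: (cvg_below (@cb w) (ltW r0) del0 cdel).
- move=> w; rewrite -expR0 ler_expR.
  have s0 : 0 <= stopped r (hit (b ^~ w)) by rewrite stopped_ge0 ?below_ge0 ?hit_ge0// ltW.
  have p1 : 0 <= th * b (stopped r (hit (b ^~ w))) w by apply: mulr_ge0; [exact: ltW|exact: ge0p].
  have p2 : 0 <= th ^+ 2 / 2 * stopped r (hit (b ^~ w)) by rewrite mulr_ge0// divr_ge0// sqr_ge0.
  by lra.
- by move=> n; apply: below_exp => //; exact: ltW.
- move=> n; have [m1 m2] := measurable_below mb cb (del n) r0.
  rewrite -[leRHS](@probability_setT _ _ _ P) -[leRHS]mul1e -integral_cst//.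
  apply: ge0_le_integral => //.
  + by move=> w _; rewrite lee_fin sqr_ge0.
  + apply/measurable_EFinP; apply: measurable_funX.
    by apply: measurableT_comp => //; apply: measurable_funB; exact: measurable_funM.
  + move=> w _; rewrite lee_fin exprn_ile1 ?expR_ge0// -expR0 ler_expR.
    have s0 : 0 <= stopped r (below (b ^~ w) (del n)) by rewrite stopped_ge0 ?below_ge0 ?hit_ge0// ltW.
    have bs : del n <= b (stopped r (below (b ^~ w) (del n))) w.
      by apply: (path_stopped_below (@cb w)); rewrite ?b0// ltW.
    have p1 : 0 <= th * b (stopped r (below (b ^~ w) (del n))) w.
      by rewrite mulr_ge0 ?ltW// (lt_le_trans (del0 n)).
    have p2 : 0 <= th ^+ 2 / 2 * stopped r (below (b ^~ w) (del n)).
      by rewrite mulr_ge0// divr_ge0// sqr_ge0.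
    by lra.
Qed.

(* Below [c + 1] the stopped martingale [mart 1] is at least
   [expR (- (c + 3 / 2))], and its mean is at most [expR (- (c + 3))]. *)
Lemma stay_high (c r : R) : 0 <= c -> c + 3 <= y -> 0 < r -> r <= 1 ->
  ((1 - expR (-1))%:E <=
   \int[P]_w (Num.min 1 (Num.max 0 (b (stopped r (hit (b ^~ w))) w - c)))%:E)%E.
Proof.
move=> c0 cy r0 r1.
have [m1 m2] := measurable_hit_stopped mb cb r0.
pose M w := mart 1 (stopped r (hit (b ^~ w))) w.
pose f w := Num.min 1 (Num.max 0 (b (stopped r (hit (b ^~ w))) w - c)).
have f0 w : 0 <= f w by rewrite le_min ler01 le_max lexx.
have y0 : 0 < y by lra.
have mM : measurable_fun setT M.
  by apply: measurableT_comp => //; apply: measurable_funB; exact: measurable_funM.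
have mf : measurable_fun setT f.
  by apply: measurable_minr => //; apply: measurable_maxr => //; exact: measurable_funB.
pose K := expR (c + 3 / 2).
have key w : 1 <= f w + K * M w.
  have KM : 0 <= K * M w by rewrite mulr_ge0// expR_ge0.
  rewrite /f; set z := b _ _.
  have [cz|zc] := leP (c + 1) z.
    by rewrite min_l ?lerDl// le_max; apply/orP; right; lra.
  suff : 1 <= K * M w by have := f0 w; rewrite /f -/z; lra.
  rewrite /K /M /mart -/z -expRD -[leLHS]expR0 ler_expR expr1n.
  have := stopped_le (ltW r0) (entry_time_ge0 (b ^~ w) (~` [set y | 0 < y])).
  by rewrite -/(hit _); set q := stopped _ _; lra.
have : (1 <= \int[P]_w (f w)%:E + (expR (-1))%:E)%E.
  rewrite -[leLHS](@probability_setT _ _ _ P) -[leLHS]mul1e -integral_cst//.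
  apply: (@le_trans _ _ (\int[P]_w ((f w)%:E + K%:E * (M w)%:E)))%E.
    apply: ge0_le_integral => //.
    - apply: emeasurable_funD; first exact/measurable_EFinP.
      by apply/measurable_EFinP; exact: measurable_funM.
    - by move=> w _; rewrite -EFinM -EFinD lee_fin key.
  rewrite ge0_integralD//.
  - apply: leeD => //; rewrite ge0_integralZl//.
    + rewrite hit_exp// -EFinM lee_fin /K -expRD ler_expR; lra.
    + exact/measurable_EFinP.
    + by move=> w _; rewrite lee_fin expR_ge0.
    + by rewrite lee_fin expR_ge0.
  - by move=> w _; rewrite lee_fin.
  - exact/measurable_EFinP.
  - by move=> w _; rewrite -EFinM lee_fin mulr_ge0// expR_ge0.
  - by apply/measurable_EFinP; exact: measurable_funM.
by rewrite EFinB leeBlDr.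
Qed.

(* The stopped martingale is at most [expR (- a * hit)] if [hit <= r], and at
   most [expR (- a * r)] otherwise. *)
Lemma hit_lap (th a : R) (a0 : 0 < a) : 0 < th -> a = th ^+ 2 / 2 -> 0 < y ->
  ((expR (- th * y))%:E <=
   \int[expo a0]_r P [set w | (hit (b ^~ w) <= r%:E)%E])%E.
Proof.
move=> th0 aE y0.
have mh := measurable_hit mb cb.
have mlap := measurable_lap a0 mh (fun w => hit_ge0 (b ^~ w)).
have -> : (\int[expo a0]_r P [set w | (hit (b ^~ w) <= r%:E)%E] =
    \int[P]_w (lap a (hit (b ^~ w)))%:E)%E.
  have := @integral_lap _ _ a0 _ _ P (fun w => hit (b ^~ w)) (fun=> 1%E) mh.
  move=> H; transitivity (\int[P]_w ((lap a (hit (b ^~ w)))%:E * 1))%E; last first.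
    by apply: eq_integral => w _; rewrite mule1.
  rewrite H//; last by move=> w; exact: entry_time_ge0.
  apply: eq_integral => r _; rewrite integral_cst ?mul1e//.
  by rewrite -[X in measurable X]setTI; apply: measurable_lee.
have key r : 0 < r -> ((expR (- th * y))%:E <=
    \int[P]_w (lap a (hit (b ^~ w)))%:E + (expR (- a * r))%:E)%E.
  move=> r0; rewrite -(hit_exp th0 y0 r0).
  rewrite -[X in (_ + X)%E]mule1 -[X in (_ + _ * X)%E](@probability_setT _ _ _ P).
  rewrite -(integral_cst P)//= -ge0_integralD//; last first.
    by move=> w _; rewrite lee_fin lap_ge0.
  have [m1 m2] := measurable_hit_stopped mb cb r0.
  apply: ge0_le_integral => //.
  - by move=> w _; rewrite lee_fin expR_ge0.
  - apply/measurable_EFinP; apply: measurableT_comp => //.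
    by apply: measurable_funB; exact: measurable_funM.
  - exact: emeasurable_funD.
  move=> w _; rewrite -EFinD lee_fin.
  have bs : 0 <= b (stopped r (hit (b ^~ w))) w.
    by apply: (path_stopped_ge0 (@cb w)); rewrite ?b0// ltW.
  apply: (@le_trans _ _ (expR (- a * stopped r (hit (b ^~ w))))).
    rewrite ler_expR -aE mulNr mulNr.
    have : 0 <= th * b (stopped r (hit (b ^~ w))) w by rewrite mulr_ge0// ltW.
    lra.
  have := path_stopped_le0 (@cb w) (ltW r0).
  have [hr _|rh _] := leP (hit (b ^~ w)) r%:E.
    have h0 : (0 <= hit (b ^~ w))%E by exact: entry_time_ge0.
    have hE : hit (b ^~ w) = (fine (hit (b ^~ w)))%:E.
      by rewrite fineK// ge0_fin_numE// (le_lt_trans hr) ?ltry.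
    move: hr; rewrite hE lee_fin => hr; rewrite stopped_r//= lerDl expR_ge0//.
  by rewrite stopped_l ?(ltW rh)// lerDr lap_ge0.
apply/lee_addgt0Pr => e e0.
have : expR (- a * n.+1%:R) @[n --> \oo] --> 0.
  rewrite (_ : (fun _ => _) = fun n => (expR (- (a * n.+1%:R)))); last first.
    by apply/funext => n; rewrite mulNr.
  apply: (cvg_comp (fun n : nat => a * n.+1%:R) (fun x => expR (- x))); last exact: cvgr_expR.
  exact: cvg_mul_natS.
move=> cv; have [n _ /(_ n (leqnn n))/= ne] : \forall n \near \oo, expR (- a * n.+1%:R) < e.
  exact: (cvgr_lt _ cv).
apply: (le_trans (key n.+1%:R _)) => //.
by rewrite leeD2l// lee_fin ltW.
Qed.

End stopped_exponential.

Lemma probability_full_setI d (T : measurableType d) (R : realType) (P : probability T R)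
    (N A : set T) : measurable N -> P N = 1%E -> measurable A -> P A = P (A `&` N).
Proof.
move=> mN PN mA; apply/eqP; rewrite eq_le; apply/andP; split; last first.
  by apply: le_measure; rewrite ?inE//; exact: measurableI.
rewrite -[in leLHS](setIT A) -(setUv N) setIUr.
apply: le_trans (measureU2 _ _ _) _; first exact: measurableI.
  by apply: measurableI => //; exact: measurableC.
rewrite [X in (_ + X)%E](_ : _ = 0%E) ?adde0//; apply/eqP; rewrite eq_le measure_ge0 andbT.
apply: (@le_trans _ _ (P (~` N))).
  by apply: le_measure; rewrite ?inE//; [apply: measurableI => //|]; exact: measurableC.
by rewrite probability_setC// PN subee.
Qed.

Lemma probability_full_integral d (T : measurableType d) (R : realType)
    (P : probability T R) (N : set T) (f g : T -> \bar R) :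
  measurable N -> P N = 1%E -> measurable_fun setT f -> measurable_fun setT g ->
  (forall x, 0 <= f x)%E -> (forall x, 0 <= g x)%E -> {in N, f =1 g} ->
  (\int[P]_x f x = \int[P]_x g x)%E.
Proof.
move=> mN PN mf mg f0 g0 fg; apply: ge0_ae_eq_integral => //.
have PNC : P (~` N) = 0%E by rewrite probability_setC// PN subee.
exists (~` N); split; [exact: measurableC|exact: PNC|].
move=> x /=; apply: contra_not => Nx _; apply: fg; rewrite inE; exact: contrapT.
Qed.

(** * Transfer to the given standard Brownian motion *)

Section standard_brownian.
Context (R : realType) d (Om : measurableType d) (B : standard_bm R Om) (y : R).
Hypothesis y0 : 0 < y.

(* Starts at [y] everywhere; [bm_path B] does so only almost surely. *)
Let b (t : R) (w : Om) : R := y + (bm_path B t w - bm_path B 0 w).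
Let N := [set w | bm_path B 0 w = y].

Let mB := @bm_measurable _ _ _ B.
Let cB := @bm_continuous _ _ _ B.

Let mN : measurable N.
Proof. rewrite -[N]setTI; exact: (mB (lexx 0) measurableT (measurable_set1 y)). Qed.

Let PN : bm_law B y N = 1%E.
Proof. exact: bm_start. Qed.

Let bB w t : N w -> b t w = bm_path B t w.
Proof. by rewrite /b => ->; rewrite addrC subrK. Qed.

Let bE w : N w -> b ^~ w = bm_path B ^~ w.
Proof. by move=> Nw; apply/funext => t; exact: bB. Qed.

Let mb t : 0 <= t -> measurable_fun setT (b t).
Proof.
by move=> t0; apply: measurable_funD => //; apply: measurable_funB; exact: mB.
Qed.

Let cb w : {within [set t | 0 <= t], continuous (b ^~ w)}.
Proof.
move=> t; apply: cvgD; first exact: cvg_cst.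
by apply: cvgB; [exact: cB|exact: cvg_cst].
Qed.

Let b0 w : b 0 w = y.
Proof. by rewrite /b subrr addr0. Qed.

Let incr n (t : nat -> R) (A : nat -> set R) :
  0 <= t 0%N -> (forall i, (i < n)%N -> t i < t i.+1) ->
  (forall i, measurable (A i)) ->
  bm_law B y (\bigcap_(i < n) [set w | A i (b (t i.+1) w - b (t i) w)]) =
  (\prod_(i < n) normal_prob 0 (Num.sqrt (t i.+1 - t i)) (A i))%E.
Proof.
move=> t0 tlt mA; rewrite -(bm_increments B y t0 tlt mA); congr (bm_law B y _).
apply: eq_bigcapr => i _; apply/seteqP; split => w /=;
  by rewrite /b opprD addrACA subrr add0r opprB addrA subrK.
Qed.

Lemma measurable_bm_hit (r : R) :
  measurable [set w | (hit (bm_path B ^~ w) <= r%:E)%E].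
Proof.
rewrite -[X in measurable X]setTI; apply: measurable_lee => //.
exact: (measurable_hit mB cB).
Qed.

Lemma bm_hit_lap (th a : R) (a0 : 0 < a) : 0 < th -> a = th ^+ 2 / 2 ->
  ((expR (- th * y))%:E <=
   \int[expo a0]_r bm_law B y [set w | (hit (bm_path B ^~ w) <= r%:E)%E])%E.
Proof.
move=> th0 aE; apply: (le_trans (hit_lap mb cb b0 incr a0 th0 aE y0)).
rewrite le_eqVlt; apply/orP; left; apply/eqP; apply: eq_integral => r _.
rewrite (probability_full_setI mN PN); last first.
  by rewrite -[X in measurable X]setTI; apply: measurable_lee => //; exact: (measurable_hit mb cb).
rewrite [RHS](probability_full_setI mN PN); last exact: measurable_bm_hit.
by congr (bm_law B y _); apply/seteqP; split => w [/= hw Nw]; split => //;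
  move: hw; rewrite bE.
Qed.

Lemma bm_stay_high (c r : R) : 0 <= c -> c + 3 <= y -> 0 < r -> r <= 1 ->
  ((1 - expR (-1))%:E <= \int[bm_law B y]_w
     (Num.min 1 (Num.max 0 (bm_path B (stopped r (hit (bm_path B ^~ w))) w - c)))%:E)%E.
Proof.
move=> c0 cy r0 r1; apply: (le_trans (stay_high mb cb b0 incr c0 cy r0 r1)).
rewrite le_eqVlt; apply/orP; left; apply/eqP.
have pos x : (0 <= (Num.min 1 (Num.max 0 (x - c)))%:E)%E.
  by rewrite lee_fin le_min ler01 le_max lexx.
apply: (probability_full_integral mN PN) => //.
- apply/measurable_EFinP; apply: measurable_minr => //; apply: measurable_maxr => //.
  by apply: measurable_funB => //; exact: (measurable_hit_stopped mb cb r0).2.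
- apply/measurable_EFinP; apply: measurable_minr => //; apply: measurable_maxr => //.
  by apply: measurable_funB => //; exact: (measurable_hit_stopped mB cB r0).2.
- by move=> w; rewrite inE => Nw; rewrite bE// bB.
Qed.

End standard_brownian.

(** * Topology and measurability on the star graph *)

Section cemetery_topology.
Context (T : topologicalType).

Lemma cemetery_openE (A : set (cemetery T)) : open A = open (Some @^-1` A : set T).
Proof. by []. Qed.

Lemma cemetery_continuous (Z : topologicalType) (f : cemetery T -> Z) :
  continuous (f \o Some) -> continuous f.
Proof.
move=> cf; apply/continuousP => A oA; rewrite cemetery_openE.
by move/continuousP : cf => /(_ A oA).
Qed.

Lemma cemetery_open_Some (A : set T) : open A -> open (Some @` A : set (cemetery T)).
Proof.
move=> oA; rewrite cemetery_openE (_ : _ @^-1` _ = A)//.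
by apply/seteqP; split => [x [y Ay [<-]]//|x Ax]; exists x.
Qed.

Lemma cemetery_open_Delta : open [set Delta : cemetery T].
Proof.
rewrite cemetery_openE (_ : _ @^-1` _ = set0); first exact: open0.
by apply/seteqP; split.
Qed.

End cemetery_topology.

Section star_topology.
Context (E : pfinType) (R : realType).
Local Notation star := (star E R).
Local Notation cem := (cemetery star).

Definition vdist (g : star) : R := mdist vertex g.

Lemma vdist_ge0 g : 0 <= vdist g. Proof. exact: mdist_ge0. Qed.

Lemma vdist_pt e x : 0 <= x -> vdist (pt e x) = x.
Proof. exact: mdist_vertex. Qed.

Lemma vdist_eq0 g : vdist g = 0 -> g = vertex.
Proof. by move=> /mdist_positivity. Qed.

Lemma star_continuousP (f : star -> R) :
  (forall g h, `|f g - f h| <= mdist g h) -> continuous f.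
Proof.
move=> lip g; apply/(@cvgrPdist_lt _ _ _ (nbhs g) _ f (f g)) => e e0.
apply/nbhs_ballP; exists e => //= h; rewrite ballEmdist/= => gh.
exact: le_lt_trans gh.
Qed.

Lemma continuous_vdist : continuous vdist.
Proof.
apply: star_continuousP => g h; rewrite ler_norml; apply/andP; split.
  have := metric_triangle (vertex : star) g h; rewrite /vdist; lra.
have := metric_triangle (vertex : star) h g; rewrite (metric_sym h g) /vdist; lra.
Qed.

Definition dist_bump (c : R) (g : star) : R := Num.min 1 (Num.max 0 (vdist g - c)).

Lemma dist_bump_ge0 c g : 0 <= dist_bump c g.
Proof. by rewrite le_min ler01 le_max lexx. Qed.

Lemma dist_bump_le1 c g : dist_bump c g <= 1.
Proof. by rewrite ge_min lexx. Qed.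

Lemma dist_bump_eq0 c g : vdist g <= c -> dist_bump c g = 0.
Proof. by move=> gc; rewrite /dist_bump max_l ?min_r//; lra. Qed.

Lemma continuous_dist_bump c : continuous (dist_bump c).
Proof.
move=> g; apply: (@continuous_min _ _ (fun=> 1) (fun g => Num.max 0 (vdist g - c))).
  exact: cst_continuous.
apply: (@continuous_max _ _ (fun=> 0) (fun g => vdist g - c)); first exact: cst_continuous.
exact: (cvgB (@continuous_vdist g) (cvg_cst c)).
Qed.

Lemma star_open_measurable (A : set star) : open A -> measurable A.
Proof. by move=> oA; exact: sub_sigma_algebra. Qed.

Lemma cem_open_measurable (A : set cem) : open A -> measurable A.
Proof. by move=> oA; exact: sub_sigma_algebra. Qed.

Lemma star_measurable_fun (f : star -> R) : continuous f -> measurable_fun setT f.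
Proof.
move=> cf; apply: (measurability _ (RGenOInfty.measurableE R)) => _ [_ [x ->] <-].
rewrite setTI; apply: star_open_measurable.
by move/continuousP : cf; apply; exact: rray_open.
Qed.

Lemma cem_measurable_fun (f : cem -> R) : continuous f -> measurable_fun setT f.
Proof.
move=> cf; apply: (measurability _ (RGenOInfty.measurableE R)) => _ [_ [x ->] <-].
rewrite setTI; apply: cem_open_measurable.
by move/continuousP : cf; apply; exact: rray_open.
Qed.

(** The image is a preimage under the left inverse of [Some], which is measurable on the open set of
    living points. *)
Lemma measurable_image_Some (A : set star) : measurable A -> measurable (Some @` A : set cem).
Proof.
move=> mA.
have mS : measurable (Some @` [set: star] : set cem).
  by apply: cem_open_measurable; apply: cemetery_open_Some; exact: openT.
pose f (y : cem) : star := if y is Some g then g else vertex.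
have mf : measurable_fun (Some @` [set: star] : set cem) f.
  apply: (measurability (f := f) _ erefl) => // _ [B oB <-].
  apply: cem_open_measurable; rewrite cemetery_openE.
  rewrite (_ : _ @^-1` _ = B)//; apply/seteqP; split => [g [_]//|g Bg]; split => //.
have := mf mS _ mA; rewrite (_ : _ `&` _ = Some @` A)//.
by apply/seteqP; split => [_ [[g _ <-] Ag]|_ [g Ag <-]]; [exists g|split => //; exists g].
Qed.

Lemma measurable_ext0 (f : star -> R) :
  measurable_fun setT f -> measurable_fun setT (ext0 f).
Proof.
move=> mf _ A mA; rewrite setTI.
have mD : measurable [set Delta : cem].
  by apply: cem_open_measurable; exact: cemetery_open_Delta.
have -> : ext0 f @^-1` A = (Some @` (f @^-1` A)) `|` ([set Delta] `&` [set _ | A 0]).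
  apply/seteqP; split => [[g|]/= Ag|y [[g Ag <-]//|[-> //]]].
    by left; exists g.
  by right.
apply: measurableU.
  by apply: measurable_image_Some; rewrite -[X in measurable X]setTI; exact: mf.
have [A0|A0] := pselect (A 0).
  by rewrite (_ : [set _ | _] = setT) ?setIT//; apply/seteqP; split.
by rewrite (_ : [set _ | _] = set0) ?setI0//; apply/seteqP; split.
Qed.

Lemma continuous_ext0 (f : star -> R) : continuous f -> continuous (ext0 f : cem -> R).
Proof. by move=> cf; apply: cemetery_continuous. Qed.

(* The distance to the complement of an open set is continuous, and an open set
   is where it is positive. *)
Lemma cem_measurable_cvg d (Om : measurableType d) (Y : nat -> Om -> cem) (Z : Om -> cem) :
  (forall n, measurable_fun setT (Y n)) ->
  (forall w, Y n w @[n --> \oo] --> Z w) -> measurable_fun setT Z.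
Proof.
move=> mY YZ.
have mD : measurable (Z @^-1` [set Delta]).
  (* The point [Delta] is isolated, so its indicator is continuous. *)
  pose h (y : cem) : R := if y is Some _ then 0 else 1.
  have ch : continuous h by apply: cemetery_continuous; exact: cst_continuous.
  have mh : measurable_fun setT (h \o Z).
    apply: (@measurable_fun_cvg _ _ _ _ (fun n => h \o Y n)).
      by move=> n; apply: measurableT_comp => //; exact: cem_measurable_fun.
    by move=> w _; apply: cvg_comp (YZ w) _; exact: ch.
  rewrite (_ : _ @^-1` _ = (h \o Z) @^-1` [set 1]).
    by rewrite -[X in measurable X]setTI; exact: mh.
  apply/seteqP; split => [w /= ->//|w /=]; rewrite /h.
  by case: (Z w) => // g /eqP; rewrite eq_sym oner_eq0.
have mV (V : set star) : open V -> measurable (Z @^-1` (Some @` V)).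
  move=> oV.
  pose h (y : cem) : \bar R := if y is Some g then edist_inf (~` V) g else 0%E.
  have ch : continuous h.
    by apply: cemetery_continuous; exact: edist_inf_continuous.
  have mch : measurable_fun setT h.
    apply: (measurability _ (ErealGenOInfty.measurableE R)) => _ [_ [x ->] <-].
    rewrite setTI; apply: cem_open_measurable.
    move/continuousP : ch; apply.
    rewrite (_ : [set` _] = [set z | (x%:E < z)%E]); first exact: open_ereal_gt_ereal.
    by apply/seteqP; split => z /=; rewrite in_itv/= andbT.
  have mh : measurable_fun setT (h \o Z).
    apply: (@emeasurable_fun_cvg _ _ _ _ (fun n => h \o Y n)).
      by move=> n; exact: measurableT_comp.
    by move=> w _; apply: cvg_comp (YZ w) _; exact: ch.
  rewrite (_ : _ @^-1` _ = [set w | (0 < (h \o Z) w)%E]).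
    by rewrite -[X in measurable X]setTI; exact: emeasurable_fun_o_infty.
  apply/seteqP; split => [w [g Vg] /= <-|w /=].
    have /nbhs_ballP[e /= e0 he] : nbhs g V by exact: open_nbhs_nbhs.
    apply: (@lt_le_trans _ _ e%:E); first by rewrite lte_fin.
    apply: le_ereal_inf_tmp => _ [h' nV <-]; rewrite leNgt; apply/negP => gh'.
    apply: nV; apply: he; exact: edist_lt_ball gh'.
  rewrite /h; case: (Z w) => // [g|]; last by rewrite ltxx.
  move=> h0; exists g => //; apply: contrapT => nVg.
  by move: h0; rewrite edist_inf0// ltxx.
apply: (measurability (f := Z) _ erefl) => // _ [U oU <-]; rewrite setTI.
have -> : Z @^-1` U = (Z @^-1` (Some @` (Some @^-1` U))) `|`
    (Z @^-1` [set Delta] `&` [set _ | U Delta]).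
  apply/seteqP; split => [w /=|w [[g Ug] /= <-//|[/= -> //]]].
  case: (Z w) => [g|] Ug; first by left; exists g.
  by right.
apply: measurableU; first by apply: mV; move: oU; rewrite cemetery_openE.
have [A0|A0] := pselect (U Delta).
  by rewrite (_ : [set _ | _] = setT) ?setIT//; apply/seteqP; split.
by rewrite (_ : [set _ | _] = set0) ?setI0//; apply/seteqP; split.
Qed.

Lemma open_open_edge (e : E) : open (open_edge e : set star).
Proof.
rewrite openE => _ [x /= x0 <-]; apply/nbhs_ballP; exists x => //= h.
rewrite ballEmdist/=.
have [e' [y [y0 ->]]] := starP h.
rewrite -[mdist _ _]/(star_dist _ _) star_dist_pt// ?ltW//.
case: eqP => [<-|_]; last by rewrite gtrDl ltNge y0.
move=> xy; exists y => //=; have := ler_norm (x - y); lra.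
Qed.

End star_topology.

(** * Transition semigroup *)

Section markov.
Context (E : pfinType) (R : realType) d (Om : measurableType d).
Variable X : markov_process E R Om.
Local Notation star := (star E R).
Local Notation cem := (cemetery star).

Lemma measurable_traj (t : R) : 0 <= t -> measurable_fun setT (traj X t).
Proof.
by move=> t0 _ A mA; rewrite setTI; apply: (filtr_measurable t0); exact: traj_adapted.
Qed.

(** Written like the inner expectation in [strong_markov], so that the strong Markov property
    applies to it as it stands. *)
Definition semigroup (f : star -> R) (t : R) (g : star) : R :=
  fine ('E_(law X g)[fun w => ext0 f (traj X t w)])%E.

Section test_function.
Variable f : star -> R.
Hypotheses (cf : continuous f) (f0 : forall g, 0 <= f g) (f1 : forall g, f g <= 1).

Lemma ext0_ge0 y : 0 <= ext0 f y. Proof. by case: y => /=. Qed.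
Lemma ext0_le1 y : ext0 f y <= 1. Proof. by case: y => /=. Qed.

Lemma test_borel : bounded_borel f.
Proof.
split; first exact: star_measurable_fun.
by exists 1 => g; rewrite ger0_norm.
Qed.

Lemma measurable_ext0_traj (t : R) : 0 <= t ->
  measurable_fun setT (fun w => ext0 f (traj X t w)).
Proof.
move=> t0; apply: measurableT_comp (measurable_traj t0).
by apply: measurable_ext0; exact: star_measurable_fun.
Qed.

Lemma semigroupE (t : R) g : 0 <= t ->
  (semigroup f t g)%:E = (\int[law X g]_w (ext0 f (traj X t w))%:E)%E.
Proof.
move=> t0; rewrite /semigroup unlock fineK// ge0_fin_numE; last first.
  by apply: integral_ge0 => w _; rewrite lee_fin ext0_ge0.
apply: (@le_lt_trans _ _ (\int[law X g]_w (cst 1%E w))%E); last first.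
  by rewrite integral_cst//= mul1e probability_setT ltry.
apply: ge0_le_integral => //.
- by move=> w _; rewrite lee_fin ext0_ge0.
- by apply/measurable_EFinP; exact: measurable_ext0_traj.
- by move=> w _; rewrite lee_fin ext0_le1.
Qed.

Lemma semigroup_ge0 (t : R) g : 0 <= semigroup f t g.
Proof.
rewrite /semigroup unlock fine_ge0//.
by apply: integral_ge0 => w _; rewrite lee_fin ext0_ge0.
Qed.

Lemma semigroup_le1 (t : R) g : 0 <= t -> semigroup f t g <= 1.
Proof.
move=> t0; rewrite -lee_fin semigroupE//.
apply: (@le_trans _ _ (\int[law X g]_w (cst 1%E w))%E); last first.
  by rewrite integral_cst//= mul1e probability_setT.
apply: ge0_le_integral => //.
- by move=> w _; rewrite lee_fin ext0_ge0.
- by apply/measurable_EFinP; exact: measurable_ext0_traj.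
- by move=> w _; rewrite lee_fin ext0_le1.
Qed.

Lemma measurable_semigroup (t : R) : 0 <= t -> measurable_fun setT (semigroup f t).
Proof.
move=> t0; apply/measurable_EFinP.
pose tr_pack : {mfun Om >-> cem} :=
  HB.pack (traj X t) (isMeasurableFun.Build _ _ _ _ _ (measurable_traj t0)).
pose l (g : star) : {measure set cem -> \bar R} := distribution (law X g) tr_pack.
rewrite (_ : _ \o _ = fun g => (\int[l g]_y (ext0 f y)%:E)%E).
  apply: measurable_fun_integral_kernel.
  - by move=> U mU; exact: law_measurable.
  - by move=> y; rewrite lee_fin ext0_ge0.
  - by apply/measurable_EFinP; apply: measurable_ext0; exact: star_measurable_fun.
apply/funext => g /=; rewrite semigroupE// /l ge0_integral_pushforward//.
- by apply/measurable_EFinP; apply: measurable_ext0; exact: star_measurable_fun.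
- by move=> y _; rewrite lee_fin ext0_ge0.
Qed.

Lemma ext0_traj_right (t : R) w : 0 <= t ->
  ext0 f (traj X s w) @[s --> t^'+] --> ext0 f (traj X t w).
Proof.
move=> t0; apply: (cvg_comp (fun s => traj X s w) (ext0 f)
  (@traj_right_continuous _ _ _ _ X w t t0)).
exact: continuous_ext0.
Qed.

(** Right continuity in time upgrades measurability at each time to joint measurability, through
    [measurable_right_continuous]; Tonelli in the exponential time rests on it. *)
Lemma semigroup_right (t : R) g : 0 <= t ->
  semigroup f s g @[s --> t^'+] --> semigroup f t g.
Proof.
move=> t0; apply/cvg_at_rightP => u [ut cu].
have u0 n : 0 <= u n by rewrite (le_trans t0)// ltW.
have [] := @dominated_convergence _ _ _ (law X g) setT measurableT
  (fun n w => (ext0 f (traj X (u n) w))%:E) (fun w => (ext0 f (traj X t w))%:E)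
  (fun=> 1%E).
- by move=> n; apply/measurable_EFinP; exact: measurable_ext0_traj.
- by apply/measurable_EFinP; exact: measurable_ext0_traj.
- apply: aeW => w _; apply: cvg_EFin; first exact: nearW.
  by have /cvg_at_rightP := @ext0_traj_right t w t0; apply.
- apply/integrableP; split => //; under eq_integral do rewrite abse1.
  by rewrite integral_cst//= probability_setT mul1e ltry.
- by apply: aeW => w n _; rewrite /= lee_fin ger0_norm ?ext0_ge0 ?ext0_le1.
move=> _ _ H; apply: fine_cvg.
rewrite -[X in _ --> X]semigroupE// in H.
apply: cvg_trans H; apply: near_eq_cvg; apply: nearW => n /=.
by rewrite unlock.
Qed.

End test_function.
End markov.

(** * Potentials at an exponential time *)

Lemma eq_integral_expo (R : realType) (a : R) (a0 : 0 < a) (f g : R -> \bar R) :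
  measurable_fun setT f -> measurable_fun setT g ->
  (forall t, 0 <= f t)%E -> (forall t, 0 <= g t)%E ->
  (forall t, 0 <= t -> f t = g t) -> (\int[expo a0]_t f t = \int[expo a0]_t g t)%E.
Proof.
move=> mf mg f0 g0 fg; rewrite !ge0_integral_expo//; apply: eq_integral => t _.
have [t0|t0] := leP 0 t; first by rewrite fg.
by rewrite lt0_exponential_pdf// !mule0.
Qed.

Section potential.
Context (E : pfinType) (R : realType) d (Om : measurableType d).
Variable X : markov_process E R Om.
Local Notation star := (star E R).
Local Notation cem := (cemetery star).
Variables (a : R) (a0 : 0 < a) (f : star -> R).
Hypotheses (cf : continuous f) (f0 : forall g, 0 <= f g) (f1 : forall g, f g <= 1).

Lemma max0E (t : R) : 0 <= t -> Num.max t 0 = t.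
Proof. by move=> t0; rewrite max_l. Qed.

Lemma max0_pos (t : R) : 0 <= Num.max t 0.
Proof. by rewrite le_max lexx orbT. Qed.

(** This is [a] times the resolvent of [f] at [a]. The truncation at 0 changes a null set of
    times. *)
Definition potential (g : star) : \bar R :=
  (\int[expo a0]_t (semigroup X f (Num.max t 0) g)%:E)%E.

Definition potential_ext (y : cem) : \bar R :=
  if y is Some g then potential g else 0%E.

Lemma measurable_semigroup_time g :
  measurable_fun [set: measurableTypeR R] (fun t => semigroup X f (Num.max t 0) g).
Proof.
have H : measurable_fun setT (fun z : unit * measurableTypeR R =>
    semigroup X f (Num.max z.2 0) g).
  apply: (@measurable_right_continuous R _ unit (fun t _ => semigroup X f t g)).
    by move=> t _; exact: measurable_cst.
  by move=> _ t t0; exact: semigroup_right.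
exact: (measurable_fun_pair2 tt H).
Qed.

Lemma potential_ge0 g : (0 <= potential g)%E.
Proof. by apply: integral_ge0 => t _; rewrite lee_fin semigroup_ge0. Qed.

Lemma potential_ext_ge0 y : (0 <= potential_ext y)%E.
Proof. by case: y => //= g; exact: potential_ge0. Qed.

Lemma potential_le1 g : (potential g <= 1)%E.
Proof.
have -> : (1 = \int[expo a0]_t cst 1 t)%E.
  by rewrite integral_cst// mul1e; exact/esym/(probability_setT (expo a0)).
apply: ge0_le_integral => //.
- by move=> t _; rewrite lee_fin semigroup_ge0.
- by apply/measurable_EFinP; exact: measurable_semigroup_time.
- by move=> t _; rewrite lee_fin semigroup_le1// max0_pos.
Qed.

Lemma potential_fin g : potential g \is a fin_num.
Proof.
rewrite ge0_fin_numE ?potential_ge0//; apply: le_lt_trans (potential_le1 g) _.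
by rewrite ltry.
Qed.

Lemma measurable_potential : measurable_fun setT potential.
Proof.
pose G (z : star * measurableTypeR R) := (semigroup X f (Num.max z.2 0) z.1)%:E.
have mG : measurable_fun setT G.
  apply/measurable_EFinP; apply: (measurable_right_continuous (u := semigroup X f)).
    by move=> t t0; exact: measurable_semigroup.
  by move=> g t t0; exact: semigroup_right.
apply: (@measurable_fun_fubini_tonelli_F _ _ star _ R (expo a0) G mG).
by move=> z; rewrite lee_fin semigroup_ge0.
Qed.

Lemma measurable_potential_ext : measurable_fun setT potential_ext.
Proof.
rewrite (_ : potential_ext = EFin \o ext0 (fine \o potential)).
  apply/measurable_EFinP; apply: measurable_ext0.
  by apply: measurableT_comp => //; exact: measurable_potential.
by apply/funext => -[g|]//=; rewrite fineK// potential_fin.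
Qed.

Section stopping.
Variable sg : Om -> \bar R.
Hypotheses (SM : strong_markov X) (sgS : stopping_time X sg).

Lemma measurable_stopping (tau : Om -> \bar R) :
  stopping_time X tau -> measurable_fun setT tau.
Proof.
move=> [tau0 tauS]; apply: (measurability _ (ErealGenOInfty.measurableE R)).
move=> _ [_ [x ->] <-]; rewrite setTI.
rewrite (_ : _ @^-1` _ = ~` [set w | (tau w <= x%:E)%E]); last first.
  apply/seteqP; split => w /=; rewrite in_itv/= andbT ltNge; first by move/negP.
  by move=> ?; apply/negP.
apply: measurableC; have [x0|x0] := ltP x 0.
  rewrite (_ : [set w | _] = set0)//.
  apply/seteqP; split => // w /= tx.
  by have := le_trans (tau0 w) tx; rewrite lee_fin leNgt x0.
by apply: (filtr_measurable x0); exact: tauS.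
Qed.

Lemma stopping_shift (s : R) : 0 <= s ->
  stopping_time X (fun w => (sg w + s%:E)%E).
Proof.
move=> s0; split => [w|t t0]; first by rewrite adde_ge0// ?lee_fin//; exact: (sgS.1 w).
have [st|ts] := leP s t; last first.
  rewrite (_ : [set w | _] = set0).
    by have [] := filtr_sigma X t0.
  apply/seteqP; split => // w /= h.
  have : (s%:E <= t%:E)%E by apply: le_trans h; rewrite leeDr//; exact: (sgS.1 w).
  by rewrite lee_fin leNgt ts.
rewrite (_ : [set w | _] = [set w | (sg w <= (t - s)%:E)%E]).
  have ts0 : 0 <= t - s by rewrite subr_ge0.
  by apply: (filtr_le ts0 _ (sgS.2 _ ts0)); rewrite gerBl.
by apply/seteqP; split => w /=; rewrite EFinB leeBrDr.
Qed.

(** These are the events on which the strong Markov property gets applied; averaged over an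
    exponential [r], their indicators give the discount [lap a (sg w)]. *)
Lemma stopped_filtr_le (r : R) : 0 <= r ->
  stopped_filtr X sg [set w | (sg w <= r%:E)%E].
Proof.
move=> r0; split; first by apply: (filtr_measurable r0); exact: sgS.2.
move=> t t0.
have m0 : 0 <= Num.min r t by rewrite le_min r0.
rewrite (_ : _ `&` _ = [set w | (sg w <= (Num.min r t)%:E)%E]).
  by apply: (filtr_le m0 _ (sgS.2 _ m0)); rewrite ge_min lexx orbT.
by apply/seteqP; split => w /=; rewrite EFin_min le_min => /andP.
Qed.

Lemma measurable_traj_at (tau : Om -> \bar R) : stopping_time X tau ->
  measurable_fun setT (fun w => traj_at X (tau w) w).
Proof.
by move=> tauS _ A mA; rewrite setTI; exact: ((SM tauS).1 A mA).1.
Qed.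

Let Q (s : R) (w : Om) : R := ext0 (semigroup X f s) (traj_at X (sg w) w).
Let U (s : R) (w : Om) : R := ext0 f (traj_at X (sg w + s%:E)%E w).

Let mQ (s : R) : 0 <= s -> measurable_fun setT (Q s).
Proof.
move=> s0; apply: measurableT_comp (measurable_traj_at sgS).
by apply: measurable_ext0; exact: measurable_semigroup.
Qed.

Let mU (s : R) : 0 <= s -> measurable_fun setT (U s).
Proof.
move=> s0; apply: measurableT_comp (measurable_traj_at (stopping_shift s0)).
by apply: measurable_ext0; exact: star_measurable_fun.
Qed.

Let Q0 s w : 0 <= Q s w.
Proof. by rewrite /Q; case: (traj_at _ _ _) => //= g; exact: semigroup_ge0. Qed.

Let U0 s w : 0 <= U s w.
Proof. exact: ext0_ge0. Qed.

Let Qr w (t : R) : 0 <= t -> Q s w @[s --> t^'+] --> Q t w.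
Proof.
move=> t0; rewrite /Q; case: (traj_at _ _ _) => [g|] /=; last exact: cvg_cst.
exact: semigroup_right.
Qed.

Let Ur w (t : R) : 0 <= t -> U s w @[s --> t^'+] --> U t w.
Proof.
move=> t0; rewrite /U; have := sgS.1 w; case: (sg w) => [c| |]//= c0.
  apply/cvg_at_rightP => u [ut cu].
  have ct0 : 0 <= c + t by rewrite addr_ge0.
  have /cvg_at_rightP := @ext0_traj_right _ _ _ _ X f cf (c + t) w ct0; apply; split.
    by move=> n; rewrite ltrD2l.
  by apply: cvgD => //; exact: cvg_cst.
exact: cvg_cst.
Qed.

(** [integral_lap] replaces the discount by the events [sg <= r], on each of which the identity is
    the strong Markov property. *)
Let QU (g : star) (s : R) : 0 <= s ->
  (\int[law X g]_w ((lap a (sg w))%:E * (Q s w)%:E) =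
   \int[law X g]_w ((lap a (sg w))%:E * (U s w)%:E))%E.
Proof.
move=> s0.
have sg0 w : (0 <= sg w)%E by exact: sgS.1.
have msg := measurable_stopping sgS.
have mQE : measurable_fun setT (fun w => (Q s w)%:E) by apply/measurable_EFinP; exact: mQ.
have mUE : measurable_fun setT (fun w => (U s w)%:E) by apply/measurable_EFinP; exact: mU.
rewrite (integral_lap a0 (law X g) msg sg0 mQE); last by move=> w; rewrite lee_fin.
rewrite (integral_lap a0 (law X g) msg sg0 mUE); last by move=> w; rewrite lee_fin.
apply: eq_integral => r _.
have [r0|r0] := leP 0 r; last first.
  rewrite (_ : [set w | _] = set0) ?integral_set0//.
  apply/seteqP; split => // w /= h.
  by have := le_trans (sg0 w) h; rewrite lee_fin leNgt r0.
have := (SM sgS).2 g s f _ s0 (test_borel cf f0 f1) (stopped_filtr_le r0).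
by move=> ->.
Qed.

(* Since exponential times have no memory, the left-hand side is the part of the
   potential which is collected after [sg]. *)
Lemma potential_supermedian (g : star) :
  (\int[law X g]_w ((lap a (sg w))%:E * potential_ext (traj_at X (sg w) w))
   <= potential g)%E.
Proof.
have sg0 w : (0 <= sg w)%E by exact: sgS.1.
have msg := measurable_stopping sgS.
have lap0 w : (0 <= (lap a (sg w))%:E)%E by rewrite lee_fin lap_ge0.
have mlap := measurable_lap a0 msg sg0.
have mQQ : measurable_fun setT (fun z : Om * measurableTypeR R => (Q (Num.max z.2 0) z.1)%:E).
  by apply/measurable_EFinP; exact: (measurable_right_continuous mQ Qr).
have mUU : measurable_fun setT (fun z : Om * measurableTypeR R => (U (Num.max z.2 0) z.1)%:E).
  by apply/measurable_EFinP; exact: (measurable_right_continuous mU Ur).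
pose ff (t : R) w := ext0 f (traj X t w).
have mff : measurable_fun setT (fun z : Om * measurableTypeR R => (ff (Num.max z.2 0) z.1)%:E).
  apply/measurable_EFinP; apply: (measurable_right_continuous (u := ff)).
  - by move=> t t0; exact: measurable_ext0_traj.
  - by move=> w t t0; exact: ext0_traj_right.
have pE w : potential_ext (traj_at X (sg w) w) = (\int[expo a0]_s (Q (Num.max s 0) w)%:E)%E.
  by rewrite /Q; case: (traj_at _ _ _) => //=; rewrite integral0.
pose H1 (z : Om * measurableTypeR R) := ((lap a (sg z.1))%:E * (Q (Num.max z.2 0) z.1)%:E)%E.
pose H2 (z : Om * measurableTypeR R) := ((lap a (sg z.1))%:E * (U (Num.max z.2 0) z.1)%:E)%E.
have mlap' : measurable_fun setT (fun z : Om * measurableTypeR R => (lap a (sg z.1))%:E).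
  exact: (measurableT_comp mlap).
have mH1 : measurable_fun setT H1 by exact: (emeasurable_funM mlap' mQQ).
have mH2 : measurable_fun setT H2 by exact: (emeasurable_funM mlap' mUU).
have H10 z : (0 <= H1 z)%E by rewrite mule_ge0// lee_fin.
have H20 z : (0 <= H2 z)%E by rewrite mule_ge0// lee_fin.
apply: (@le_trans _ _ (\int[law X g]_w \int[expo a0]_s H1 (w, s)))%E.
  rewrite le_eqVlt; apply/orP; left; apply/eqP; apply: eq_integral => w _.
  rewrite pE -ge0_integralZl//; last by move=> s _; rewrite lee_fin.
  exact: (measurable_fun_pair2 (f := fun z : Om * measurableTypeR R => (Q (Num.max z.2 0) z.1)%:E) w).
rewrite (@fubini_tonelli _ _ _ _ _ (law X g) (expo a0) H1)//.
rewrite (eq_integral (fun s : measurableTypeR R => \int[law X g]_w H2 (w, s))%E); last first.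
  by move=> s _; rewrite /H1 /H2 /= QU// max0_pos.
rewrite -(@fubini_tonelli _ _ _ _ _ (law X g) (expo a0) H2)//.
apply: (@le_trans _ _ (\int[law X g]_w \int[expo a0]_s (ff (Num.max s 0) w)%:E))%E; last first.
  rewrite (@fubini_tonelli _ _ _ _ _ (law X g) (expo a0) (fun z => (ff (Num.max z.2 0) z.1)%:E))//; last first.
    by move=> z; rewrite lee_fin; exact: ext0_ge0.
  rewrite le_eqVlt; apply/orP; left; apply/eqP; apply: eq_integral => s _.
  by rewrite semigroupE// max0_pos.
apply: ge0_le_integral => //.
- by move=> w _; apply: integral_ge0.
- exact: (@measurable_fun_fubini_tonelli_F _ _ Om _ R (expo a0) H2).
- apply: (@measurable_fun_fubini_tonelli_F _ _ Om _ R (expo a0) (fun z => (ff (Num.max z.2 0) z.1)%:E)) => //.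
  by move=> z; rewrite lee_fin; exact: ext0_ge0.
move=> w _; have ffw : measurable_fun [set: measurableTypeR R] (fun s => (ff (Num.max s 0) w)%:E).
  exact: (measurable_fun_pair2 (f := fun z : Om * measurableTypeR R => (ff (Num.max z.2 0) z.1)%:E) w).
have ffw0 s : (0 <= (ff (Num.max s 0) w)%:E)%E by rewrite lee_fin; exact: ext0_ge0.
have Uw : measurable_fun [set: measurableTypeR R] (fun s => (U (Num.max s 0) w)%:E).
  exact: (measurable_fun_pair2 (f := fun z : Om * measurableTypeR R => (U (Num.max z.2 0) z.1)%:E) w).
rewrite /H2 /= ge0_integralZl//; last by move=> s _; rewrite lee_fin.
have := sg0 w; rewrite /U; case sgw : (sg w) => [c| |]//= c0; last first.
  by rewrite mul0e; exact: integral_ge0.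
rewrite lee_fin in c0.
rewrite (@eq_integral_expo _ _ a0 _ (fun s => (ff (Num.max (c + s) 0) w)%:E)); last 5 first.
- by move: Uw; rewrite /U sgw.
- apply: (measurableT_comp ffw); exact: measurable_funD.
- by move=> s; rewrite lee_fin; exact: ext0_ge0.
- by move=> s.
- by move=> s s0; rewrite !max0E// addr_ge0.
rewrite (expo_memoryless a0 c0 ffw ffw0).
apply: ge0_le_integral => //.
- by move=> s _; rewrite mule_ge0// lee_fin.
- by apply: (emeasurable_funM ffw); apply/measurable_EFinP.
- move=> s _; rewrite -[leRHS]mule1; apply: lee_wpmul2l => //.
  by rewrite lee_fin indicE; case: (_ \in _).
Qed.

End stopping.
End potential.

(** * Behaviour on the edges *)

Section right_continuous.
Context (R : realType) (T : topologicalType) (Y : R -> T).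
Hypothesis rc : forall t : R, 0 <= t -> Y s @[s --> t^'+] --> Y t.

Lemma right_open (t : R) (O : set T) : 0 <= t -> open O -> O (Y t) ->
  exists2 e, 0 < e & forall s, t <= s < t + e -> O (Y s).
Proof.
move=> t0 oO Ot.
have : nbhs (Y t) O by exact: open_nbhs_nbhs.
move=> /(rc t0); rewrite /= /at_right /within/= => -[e /= e0 he]; exists e => // s.
move=> /andP[]; rewrite le_eqVlt => /orP[/eqP<-//|ts] se.
by apply: he => //=; rewrite distrC gtr0_norm ?subr_gt0//; lra.
Qed.

Lemma entry_time_closed (A : set T) (h : R) : closed A ->
  entry_time Y A = h%:E -> A (Y h).
Proof.
move=> cA hE; have h0 : 0 <= h by rewrite -lee_fin -hE; exact: entry_time_ge0.
apply: contrapT => nA.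
have [e e0 he] := right_open h0 (closed_openC cA) nA.
have : (entry_time Y A < (h + e)%:E)%E by rewrite hE lte_fin ltrDl.
move=> /entry_time_lt[t [t0 te At]]; apply: (he t _ At).
by rewrite -[t < _]lte_fin te andbT -lee_fin -hE; exact: entry_time_le.
Qed.

Lemma entry_time_notin (A : set T) (t : R) : 0 <= t ->
  (t%:E < entry_time Y A)%E -> ~ A (Y t).
Proof. by move=> t0 tA At; move: tA; rewrite ltNge entry_time_le. Qed.

End right_continuous.

Section edge.
Context (E : pfinType) (R : realType) dB (OmB : measurableType dB) (B : standard_bm R OmB)
  d (Om : measurableType d) (X : markov_process E R Om).
Local Notation star := (star E R).
Local Notation cem := (cemetery star).
Hypothesis hX : brownian_motion X B.
Variable e : E.
Let H := edge_exit_time X e.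

Lemma star_measurable_vertex : measurable [set vertex : star].
Proof.
rewrite (_ : [set vertex] = [set g | vdist g = 0]).
  rewrite -[X in measurable X]setTI.
  exact: (star_measurable_fun (@continuous_vdist E R) measurableT (measurable_set1 0)).
apply/seteqP; split => [_ ->|g /vdist_eq0//] /=.
by rewrite /vdist mdistxx.
Qed.

Lemma pt_neg (x : R) : x <= 0 -> pt e x = vertex :> star.
Proof.
move=> x0; apply: star_dist_eq0; rewrite -(pt0 R e) star_distE /halflines_dist /=.
by rewrite eqxx max_r// maxxx subrr normr0.
Qed.

Lemma edge_exit_stopping : stopping_time X H.
Proof. by have [] := hX.2 e 0 (lexx 0). Qed.

Lemma one_time (x t : R) (f : star -> R) : 0 <= x -> 0 <= t -> bounded_borel f ->
  (\int[law X (pt e x)]_w (ext0 f (traj X (stopped t (H w)) w))%:E =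
   \int[bm_law B x]_w (f (pt e (bm_path B (stopped t (hit (bm_path B ^~ w))) w)))%:E)%E.
Proof.
move=> x0 t0 bf; have [_ /(_ 1%N (fun=> f) (fun=> t))] := hX.2 e x x0.
rewrite unlock => /(_ (fun=> bf) (fun=> t0)).
under eq_integral do rewrite big_ord1.
move=> ->; by under eq_integral do rewrite big_ord1.
Qed.

Lemma traj_edge (t : R) w : 0 <= t -> (t%:E < H w)%E ->
  (inG @` open_edge e) (traj X t w).
Proof.
by move=> t0 tH; apply: contrapT => nt; exact: (entry_time_notin t0 tH nt).
Qed.

Lemma traj_exit (h : R) w : H w = h%:E -> ~ (inG @` open_edge e) (traj X h w).
Proof.
apply: (@entry_time_closed _ _ (fun t => traj X t w)).
  by move=> t t0; exact: traj_right_continuous.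
by apply: open_closedC; apply: cemetery_open_Some; exact: open_open_edge.
Qed.

Lemma vertex_notin_edge : ~ (open_edge e : set star) vertex.
Proof.
move=> [x /= x0 xv]; have := vdist_pt e (ltW x0).
by rewrite xv /vdist mdistxx => x0'; rewrite -x0' ltxx in x0.
Qed.

(** Counterpart of [path_stopped_le0]: before the exit the process is inside the open edge, which
    omits the vertex. So an exit through the vertex by time [r] shows in one stopped position, to
    which [one_time] applies. *)
Lemma traj_stopped_vertex (r : R) w : 0 <= r ->
  (traj X (stopped r (H w)) w = inG vertex) <->
  ((H w <= r%:E)%E /\ traj_at X (H w) w = inG vertex).
Proof.
move=> r0; have H0 : (0 <= H w)%E by exact: entry_time_ge0.
have [Hr|rH] := leP (H w) r%:E.
  have HE : H w = (fine (H w))%:E.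
    by rewrite fineK// ge0_fin_numE// (le_lt_trans Hr) ?ltry.
  move: Hr; rewrite HE lee_fin => Hr; rewrite stopped_r//=.
  by split => // -[].
rewrite stopped_l ?(ltW rH)//; split => [xv|[//]].
have := traj_edge r0 rH; rewrite xv => -[g eg [gv]].
by case: vertex_notin_edge; rewrite -gv.
Qed.

(** [one_time] describes the process stopped at the exit from the edge. The indicator of the open
    edge annihilates the paths that have left by time [t]; on the others nothing has been stopped
    yet. So passing to the free process can only increase the expectation. *)
Lemma bump_stay (c t y : R) : 0 <= c -> c + 3 <= y -> 0 < t -> t <= 1 ->
  1 - expR (-1) <= semigroup X (dist_bump c) t (pt e y).
Proof.
move=> c0 cy t0 t1.
have y0 : 0 < y by lra.
have mD : measurable (open_edge e : set star).
  by apply: star_open_measurable; exact: open_open_edge.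
pose f (g : star) := dist_bump c g * \1_(open_edge e) g.
have f0 g : 0 <= f g by rewrite mulr_ge0// dist_bump_ge0.
have mf : measurable_fun setT f.
  apply: measurable_funM; last exact: measurable_indic.
  exact: star_measurable_fun (@continuous_dist_bump _ _ c).
have bf : bounded_borel f.
  split => //; exists 1 => g; rewrite ger0_norm// /f indicE.
  by case: (_ \in _); rewrite ?mulr1 ?mulr0// dist_bump_le1.
rewrite -lee_fin semigroupE; [|exact: continuous_dist_bump|exact: dist_bump_ge0|exact: dist_bump_le1|exact: ltW].
apply: (le_trans (bm_stay_high B c0 cy t0 t1)).
apply: (@le_trans _ _ (\int[law X (pt e y)]_w (ext0 f (traj X (stopped t (H w)) w))%:E)%E).
  rewrite (one_time (ltW y0) (ltW t0) bf) le_eqVlt; apply/orP; left; apply/eqP.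
  apply: eq_integral => w _; congr (_%:E); set z := bm_path _ _ _; rewrite /f.
  have [z0|z0] := ltP 0 z.
    rewrite indicE mem_set ?mulr1; last by exists z.
    by rewrite /dist_bump vdist_pt// ltW.
  rewrite pt_neg// dist_bump_eq0 ?mul0r; last by rewrite /vdist mdistxx.
  by rewrite max_l ?min_r//; lra.
apply: ge0_le_integral => //.
- by move=> w _; rewrite lee_fin; case: (traj _ _ _) => /=.
- apply/measurable_EFinP.
  have mext : measurable_fun setT (ext0 f : cem -> R) by exact: measurable_ext0.
  (* The minimum of [t] and the exit time is again a stopping time, so the position there is
     measurable by [strong_markov]. *)
  have mHt : stopping_time X (fun w => (stopped t (H w))%:E).
    have [H0 HS] := edge_exit_stopping; split => [w|s s0].
      by rewrite lee_fin stopped_ge0// ltW.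
    have [ts|st] := leP t s.
      rewrite (_ : [set w | _] = setT).
        have [/= _ sc _] := filtr_sigma X s0.
        rewrite -(setD0 [set: Om]); apply: sc.
        by have [] := filtr_sigma X s0.
      apply/seteqP; split => // w _ /=; rewrite lee_fin.
      by apply: (le_trans _ ts); apply: stopped_le => //; exact: ltW.
    rewrite (_ : [set w | _] = [set w | (H w <= s%:E)%E]); first exact: HS.
    apply/seteqP; split => w /=; rewrite stoppedE ?(ltW t0)// ge_min lee_fin.
      by rewrite (leNgt t) st.
    by move=> ->; rewrite orbT.
  exact: (measurableT_comp mext (measurable_traj_at hX.1 mHt)).
- by apply/measurable_EFinP; apply: measurable_ext0_traj (ltW t0); exact: continuous_dist_bump.
- move=> w _; rewrite lee_fin.
  have H0 : (0 <= H w)%E by exact: entry_time_ge0.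
  have ext_le y' : ext0 f y' <= ext0 (dist_bump c) y'.
    case: y' => //= g; rewrite /f indicE.
    by case: (_ \in _); rewrite ?mulr1 ?mulr0// dist_bump_ge0.
  have [Hr|rH] := leP (H w) t%:E; last by rewrite stopped_l// ltW.
  have HE : H w = (fine (H w))%:E.
    by rewrite fineK// ge0_fin_numE// (le_lt_trans Hr) ?ltry.
  have nE := traj_exit HE.
  move: Hr; rewrite HE lee_fin => Hr; rewrite stopped_r//.
  case tE : (traj X (fine (H w)) w) nE => [g|] nE /=.
    rewrite /f indicE memNset ?mulr0; last by move=> eg; apply: nE; exists g.
    by case: (traj _ _ _) => //= g'; exact: dist_bump_ge0.
  by case: (traj _ _ _) => //= g'; exact: dist_bump_ge0.
Qed.

End edge.

Section edge_potential.
Context (E : pfinType) (R : realType) dB (OmB : measurableType dB) (B : standard_bm R OmB)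
  d (Om : measurableType d) (X : markov_process E R Om).
Local Notation star := (star E R).
Local Notation cem := (cemetery star).
Hypothesis hX : brownian_motion X B.
Variables (th a : R) (a0 : 0 < a) (th0 : 0 < th) (aE : a = th ^+ 2 / 2).

(** The first factor is the bound of [bump_stay] for times in []0, 1]]; the second is the
    probability that the exponential time lies in [[1/2, 1[]. *)
Definition far_mass : R := (1 - expR (-1)) * (expR (- a * 2^-1) - expR (- a * 1)).

Lemma far_mass_gt0 : 0 < far_mass.
Proof.
apply: mulr_gt0; rewrite subr_gt0; last by rewrite ltr_expR; have := a0; lra.
by rewrite -[ltRHS]expR0 ltr_expR; lra.
Qed.

Lemma potential_far (c : R) (g : star) : 0 <= c -> c + 3 <= vdist g ->
  (far_mass%:E <= potential X a0 (dist_bump c) g)%E.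
Proof.
move=> c0; have [e [y [y0 ->]]] := starP g; rewrite vdist_pt// => cy.
have expoE : expo a0 `[2^-1, 1[%classic = (expR (- a * 2^-1) - expR (- a * 1))%:E.
  have -> : `[2^-1, 1[%classic = `[2^-1, +oo[%classic `\` `[1, +oo[%classic :> set R.
    apply/seteqP; split => t /=; rewrite !in_itv/= !andbT.
      by move=> /andP[-> ?]; split => //; apply/negP; rewrite -ltNge.
    by move=> [-> /negP]; rewrite -ltNge.
  rewrite measureD//=; last by rewrite [X in (X < _)%E](expo_itvcy a0)// ltry.
  rewrite setIidr; last first.
    by move=> t /=; rewrite !in_itv/= !andbT; apply: le_trans; lra.
  by rewrite [X in (X - _)%E](expo_itvcy a0)// [X in (_ - X)%E](expo_itvcy a0).
have k0 : 0 <= 1 - expR (-1) :> R by rewrite subr_ge0 -[leRHS]expR0 ler_expR; lra.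
rewrite /far_mass EFinM -expoE.
have -> : expo a0 `[2^-1, 1[%classic = expo a0 (`[2^-1, 1[%classic `&` setT).
  by rewrite setIT.
rewrite -(integral_indic (expo a0) measurableT (measurable_itv `[2^-1, 1[)).
rewrite -ge0_integralZl//; last first.
  by apply/measurable_EFinP; exact: measurable_indic.
apply: ge0_le_integral => //.
- by apply/measurable_EFinP; apply: measurable_funM => //; exact: measurable_indic.
- apply/measurable_EFinP; apply: measurable_semigroup_time;
    [exact: continuous_dist_bump|exact: dist_bump_ge0|exact: dist_bump_le1].
move=> t _; rewrite -EFinM lee_fin indicE.
have [|_] := boolP (t \in _); last by rewrite mulr0; apply: semigroup_ge0; exact: dist_bump_ge0.
rewrite inE/= in_itv/= => /andP[t0 t1]; rewrite mulr1 max0E; last lra.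
by apply: (bump_stay hX) => //; lra.
Qed.

(** Supermedian inequality at the exit from the edge, keeping only exits through the vertex. The
    discount averages, over exponential [r], the events that the exit has occurred by [r]; for each
    [r] their probability is that of [hit <= r], by [one_time]. *)
Lemma potential_near (f : star -> R) (g : star) : continuous f ->
  (forall h, 0 <= f h) -> (forall h, f h <= 1) ->
  ((expR (- th * vdist g))%:E * potential X a0 f vertex <= potential X a0 f g)%E.
Proof.
move=> cf f0 f1; have [e [x [+ ->]]] := starP g.
rewrite le_eqVlt => /orP[/eqP<-|x0].
  by rewrite pt0 /vdist mdistxx mulr0 expR0 mul1e.
rewrite vdist_pt ?(ltW x0)//.
have sH := edge_exit_stopping hX e; set H := edge_exit_time X e in sH *.
have mH := measurable_stopping sH.
have H0 w : (0 <= H w)%E by exact: sH.1.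
have mXH := measurable_traj_at hX.1 sH.
apply: le_trans (potential_supermedian a0 cf f0 f1 hX.1 sH (pt e x)).
pose D := [set w | traj_at X (H w) w = inG vertex].
have mD : measurable D.
  rewrite -[D]setTI; apply: (mXH measurableT [set inG vertex]).
  rewrite -[X in measurable X](image_set1 Some vertex).
  by apply: measurable_image_Some; exact: star_measurable_vertex.
have mlap := measurable_lap a0 mH H0.
have pv := potential_ge0 X a0 f0 vertex.
apply: (@le_trans _ _ (\int[law X (pt e x)]_w (potential X a0 f vertex *
    ((lap a (H w))%:E * (\1_D w)%:E)))%E); last first.
  apply: ge0_le_integral => //.
  - by move=> w _; rewrite !mule_ge0// lee_fin// lap_ge0.
  - apply: (emeasurable_funM (measurable_cst _)); apply: (emeasurable_funM mlap).
    by apply/measurable_EFinP; exact: measurable_indic.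
  - apply: (emeasurable_funM mlap); apply: measurableT_comp mXH.
    exact: measurable_potential_ext.
  - move=> w _; rewrite muleCA; apply: lee_wpmul2l; first by rewrite lee_fin lap_ge0.
    rewrite indicE; have [|_] := boolP (w \in D).
      by rewrite inE /D/= => ->; rewrite mule1.
    by rewrite mule0; exact: potential_ext_ge0.
rewrite ge0_integralZl//; last 2 first.
- apply: (emeasurable_funM mlap).
  by apply/measurable_EFinP; exact: measurable_indic.
- by move=> w _; rewrite mule_ge0// lee_fin// lap_ge0.
rewrite muleC; apply: lee_wpmul2l => //.
apply: (le_trans (bm_hit_lap B x0 a0 th0 aE)).
rewrite (integral_lap a0 (law X (pt e x)) mH H0); last 2 first.
- by apply/measurable_EFinP; exact: measurable_indic.
- by move=> w; rewrite lee_fin.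
rewrite le_eqVlt; apply/orP; left; apply/eqP; apply: eq_integral => r _.
have [r0|r0] := ltP r 0.
  rewrite (_ : [set w | (H w <= r%:E)%E] = set0); last first.
    apply/seteqP; split => // w /= h.
    by have := le_trans (H0 w) h; rewrite lee_fin leNgt r0.
  rewrite integral_set0 (_ : [set w | _] = set0) ?measure0//.
  apply/seteqP; split => // w /= h.
  have h0 : (0 <= hit (bm_path B ^~ w))%E by exact: entry_time_ge0.
  by have := le_trans h0 h; rewrite lee_fin leNgt r0.
have mV : measurable_fun setT (\1_[set vertex : star] : star -> R).
  by apply: measurable_indic; exact: star_measurable_vertex.
(* The Brownian property on the edge covers Borel test functions, in particular this discontinuous
   one. *)
have bV : bounded_borel (\1_[set vertex : star] : star -> R).
  by split => //; exists 1 => g'; rewrite ger0_norm// indicE; case: (_ \in _).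
transitivity (\int[law X (pt e x)]_w
    (ext0 (\1_[set vertex : star] : star -> R) (traj X (stopped r (H w)) w))%:E)%E; last first.
  have mHr : measurable [set w | (H w <= r%:E)%E] by apply: (filtr_measurable r0); exact: sH.2.
  rewrite (integral_mkcond [set w | (H w <= r%:E)%E]); apply: eq_integral => w _.
  rewrite patchE; have := traj_stopped_vertex X e w r0.
  rewrite -/H => tE; have [|] := boolP (w \in [set w | (H w <= r%:E)%E]).
    rewrite inE/= => Hr; rewrite [in RHS]indicE; congr (_%:E).
    case: (traj X _ w) tE => [g'|] /= tE.
      rewrite indicE; congr (_ : bool)%:R; apply/idP/idP.
        by rewrite !inE/= => gv; apply: (tE.1 _).2; rewrite gv.
      by rewrite !inE /D/= => Xv; have [] : inG g' = inG (vertex : star) by exact/tE.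
    by rewrite memNset//= => Xv; have : Delta = inG (vertex : star) by exact/tE.
  move/negP => nH; case: (traj X _ w) tE => [g'|//] /= tE.
  rewrite indicE memNset//= => gv; apply: nH; rewrite inE/=.
  by apply: (tE.1 _).1; rewrite gv.
rewrite (one_time hX e (ltW x0) r0 bV).
rewrite -[X in bm_law B x X]setIT -(integral_indic (bm_law B x) measurableT (measurable_bm_hit B r)).
apply: eq_integral => w _; rewrite !indicE; congr ((_ : bool)%:R%:E).
have cB : {within [set t | 0 <= t], continuous (bm_path B ^~ w)} by exact: bm_continuous.
have := path_stopped_le0 cB r0; set z := bm_path B _ w => zE.
apply/idP/idP; rewrite !inE/=.
  by rewrite -zE => z0; exact: pt_neg.
move=> zv; rewrite -zE leNgt; apply/negP => z0; apply: (@vertex_notin_edge E R e).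
by exists z.
Qed.

End edge_potential.

(** * Exit from a ball *)

Section ball_exit.
Context (E : pfinType) (R : realType) d (Om : measurableType d) (X : markov_process E R Om).
Local Notation star := (star E R).
Local Notation cem := (cemetery star).
Hypothesis SM : strong_markov X.
Variable eps : R.
Let A : set cem := ~` (inG @` closure (ball vertex eps)).
Let tau := ball_exit_time X eps.

Lemma open_ball_compl : open A.
Proof.
rewrite cemetery_openE (_ : _ @^-1` _ = ~` closure (ball vertex eps)).
  by apply: closed_openC; exact: closed_closure.
apply/seteqP; split => g /= ng.
  by move=> cg; apply: ng; exists g.
by move=> [g' cg' [gg']]; apply: ng; rewrite -gg'.
Qed.

Lemma ball_exit_ge0 w : (0 <= tau w)%E.
Proof. exact: entry_time_ge0. Qed.

(** An entry into an open set persists for a while by right continuity, so an entry strictly before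
    [s] is seen at some fraction before [s]. *)
Lemma ball_exit_lt (s : R) : 0 <= s -> filtr X s [set w | (tau w < s%:E)%E].
Proof.
move=> s0; have [fs0 fsC fsU] := filtr_sigma X s0.
rewrite (_ : [set w | _] = \bigcup_n \bigcup_k
    (if k%:R / n.+1%:R < s then traj X (k%:R / n.+1%:R) @^-1` A else set0)).
  apply: (fsU (fun n => \bigcup_k _)) => n; apply: (fsU (fun k => _)) => k; case: ifP => // ks.
  have k0 : 0 <= k%:R / n.+1%:R :> R by rewrite divr_ge0.
  apply: (filtr_le k0 (ltW ks)); apply: traj_adapted => //.
  by apply: cem_open_measurable; exact: open_ball_compl.
apply/seteqP; split => w /=; last first.
  move=> [n _ [k _]]; case: ifP => // ks Ak.
  apply: (@le_lt_trans _ _ (k%:R / n.+1%:R)%:E); last by rewrite lte_fin.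
  by apply: entry_time_le => //; rewrite divr_ge0.
move=> /entry_time_lt[t [t0 ts At]].
have rc u : 0 <= u -> traj X v w @[v --> u^'+] --> traj X u w.
  by move=> u0; exact: traj_right_continuous.
have [e e0 he] := right_open rc t0 open_ball_compl At.
(* The fraction has to lie before [s] and within the time during which the path stays in the open
   set. *)
have tm : t < Num.min s (t + e) by rewrite lt_min -lte_fin ts ltrDl.
have [n _ /(_ n (leqnn n))] : \forall n \near \oo, up n t < Num.min s (t + e).
  exact: (cvgr_lt _ (cvg_up t0) _ tm).
rewrite lt_min => /andP[us ut].
exists n => //; exists (Num.truncn (n.+1%:R * t)).+1 => //.
by rewrite us; apply: he; rewrite ltW ?up_gt.
Qed.

(* The exit time from the closed ball need not be a stopping time, as the
   filtration is not assumed to be right continuous. *)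
Definition exit_up (n : nat) (w : Om) : \bar R :=
  if tau w is r%:E then (up n r)%:E else +oo%E.

(** With [K] the integer part of [n.+1%:R * t], the rounded time is at most [t] exactly when [tau]
    is strictly before [K%:R / n.+1%:R], and strict events are adapted by [ball_exit_lt]. *)
Lemma exit_up_stopping n : stopping_time X (exit_up n).
Proof.
split => [w|t t0].
  by rewrite /exit_up; case: (tau w) => [r| |]; rewrite ?lee_fin ?up_ge0 ?leey.
pose K := Num.truncn (n.+1%:R * t).
have K0 : 0 <= K%:R / n.+1%:R :> R by rewrite divr_ge0.
have Kt : K%:R / n.+1%:R <= t.
  by rewrite ler_pdivrMr// mulrC Num.Theory.truncn_le// mulr_ge0.
rewrite (_ : [set w | _] = [set w | (tau w < (K%:R / n.+1%:R)%:E)%E]).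
  exact: (filtr_le K0 Kt (ball_exit_lt K0)).
apply/seteqP; split => w /=; rewrite /exit_up; have := ball_exit_ge0 w;
  case: (tau w) => [r| |] //; rewrite !lee_fin ?lte_fin => r0; rewrite /up.
- rewrite ler_pdivrMr// ltr_pdivlMr// => h; apply: (lt_le_trans (y := (Num.truncn (n.+1%:R * r)).+1%:R)).
    by rewrite mulrC; exact: Num.Theory.truncnS_gt.
  by rewrite ler_nat /K Num.Theory.truncn_ge_nat ?mulr_ge0// [leRHS]mulrC.
- rewrite ler_pdivrMr// ltr_pdivlMr// => h; rewrite [leRHS]mulrC -Num.Theory.truncn_ge_nat ?mulr_ge0//.
  by rewrite -/K ltnNge; apply/negP; rewrite Num.Theory.truncn_ge_nat ?mulr_ge0// leNgt mulrC h.
Qed.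

Lemma cvg_exit_up w : exit_up n w @[n --> \oo] --> tau w.
Proof.
rewrite /exit_up; have := ball_exit_ge0 w.
case: (tau w) => [r| |]// r0; last exact: cvg_cst.
by apply: cvg_EFin; [exact: nearW|apply: cvg_up; rewrite -lee_fin].
Qed.

Lemma cvg_lap_exit_up (a : R) w : lap a (exit_up n w) @[n --> \oo] --> lap a (tau w).
Proof.
rewrite /exit_up; have := ball_exit_ge0 w.
case: (tau w) => [r| |]// r0; last exact: cvg_cst.
rewrite /=; apply: (cvg_comp (fun n => - a * up n r) expR); last exact: continuous_expR.
by apply: cvgMl_tmp; apply: cvg_up; rewrite -lee_fin.
Qed.

Lemma cvg_traj_exit_up w :
  traj_at X (exit_up n w) w @[n --> \oo] --> ball_exit_point X eps w.
Proof.
rewrite /exit_up /ball_exit_point -/tau; have := ball_exit_ge0 w; rewrite -/tau.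
case: (tau w) => [r| |]// r0; last exact: cvg_cst.
rewrite lee_fin in r0.
exact: (cvg_comp (fun n => up n r) (fun t => traj X t w) (cvg_up_right r0)
  (@traj_right_continuous _ _ _ _ X w r r0)).
Qed.

Lemma measurable_ball_exit_time : measurable_fun setT tau.
Proof.
apply: (@emeasurable_fun_cvg _ _ _ _ exit_up) => [n|w _]; last exact: cvg_exit_up.
exact: measurable_stopping (exit_up_stopping n).
Qed.

Lemma measurable_ball_exit_point : measurable_fun setT (ball_exit_point X eps).
Proof.
apply: (cem_measurable_cvg (Y := fun n w => traj_at X (exit_up n w) w)).
  by move=> n; exact: (measurable_traj_at SM (exit_up_stopping n)).
exact: cvg_traj_exit_up.
Qed.

Section supermedian.
Variables (a : R) (a0 : 0 < a) (f Psi : star -> R).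
Hypotheses (cf : continuous f) (f0 : forall g, 0 <= f g) (f1 : forall g, f g <= 1).
Hypotheses (cPsi : continuous Psi) (Psi0 : forall g, 0 <= Psi g).
Hypothesis PsiU : forall g, ((Psi g)%:E <= potential X a0 f g)%E.

(** The inequality holds at the stopping times [exit_up n], with the potential and a fortiori with
    [Psi]. Continuity of [Psi] and right continuity of the paths carry it to [tau] by dominated
    convergence. *)
Lemma ball_exit_supermedian (g : star) :
  (\int[law X g]_w ((lap a (tau w))%:E * (ext0 Psi (ball_exit_point X eps w))%:E)
   <= potential X a0 f g)%E.
Proof.
have Psi1 g' : Psi g' <= 1.
  by rewrite -lee_fin; apply: (le_trans (PsiU g')); exact: potential_le1.
have mPsi : measurable_fun setT (ext0 Psi : cem -> R).
  by apply: measurable_ext0; exact: star_measurable_fun.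
have bd (x y : \bar R) z : (0 <= x)%E -> 0 <= lap a x * ext0 Psi z <= 1.
  move=> x0; rewrite mulr_ge0 ?lap_ge0//=; last by case: z.
  rewrite -[leRHS]mulr1 ler_pM ?lap_ge0 ?lap_le1//; by case: z => /=.
have mn n : measurable_fun setT (fun w =>
    ((lap a (exit_up n w))%:E * (ext0 Psi (traj_at X (exit_up n w) w))%:E)%E).
  apply: emeasurable_funM.
    by apply: measurable_lap => //; [exact: measurable_stopping (exit_up_stopping n)|
      exact: (exit_up_stopping n).1].
  apply/measurable_EFinP; apply: (measurableT_comp mPsi).
  exact: (measurable_traj_at SM (exit_up_stopping n)).
have [] := @dominated_convergence _ _ _ (law X g) setT measurableT
  (fun n w => (lap a (exit_up n w))%:E * (ext0 Psi (traj_at X (exit_up n w) w))%:E)%E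
  (fun w => (lap a (tau w))%:E * (ext0 Psi (ball_exit_point X eps w))%:E)%E
  (fun=> 1%E).
- exact: mn.
- apply: emeasurable_funM.
    by apply: measurable_lap => //; [exact: measurable_ball_exit_time|exact: ball_exit_ge0].
  by apply/measurable_EFinP; apply: (measurableT_comp mPsi); exact: measurable_ball_exit_point.
- apply: aeW => w _; rewrite -EFinM; apply: cvg_EFin; first exact: nearW.
  suff : lap a (exit_up n w) * ext0 Psi (traj_at X (exit_up n w) w) @[n --> \oo] -->
      lap a (tau w) * ext0 Psi (ball_exit_point X eps w) by [].
  apply: cvgM; first exact: cvg_lap_exit_up.
  apply: (cvg_comp (fun n => traj_at X (exit_up n w) w) (ext0 Psi) (@cvg_traj_exit_up w)).
  exact: continuous_ext0.
- apply/integrableP; split => //; under eq_integral do rewrite abse1.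
  by rewrite integral_cst//= probability_setT mul1e ltry.
- apply: aeW => w n _; rewrite -EFinM /= lee_fin ger0_norm.
    by have /andP[] := bd (exit_up n w) 0%E (traj_at X (exit_up n w) w) ((exit_up_stopping n).1 w).
  by have /andP[] := bd (exit_up n w) 0%E (traj_at X (exit_up n w) w) ((exit_up_stopping n).1 w).
move=> _ _ H; apply: (cvge_to_le H); apply: nearW => n.
apply: le_trans (potential_supermedian a0 cf f0 f1 SM (exit_up_stopping n) g).
apply: ge0_le_integral => //.
- move=> w _; rewrite -EFinM lee_fin.
  by have /andP[] := bd (exit_up n w) 0%E (traj_at X (exit_up n w) w) ((exit_up_stopping n).1 w).
- apply: emeasurable_funM.
    by apply: measurable_lap => //; [exact: measurable_stopping (exit_up_stopping n)|
      exact: (exit_up_stopping n).1].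
  apply: measurableT_comp (measurable_traj_at SM (exit_up_stopping n)).
  exact: measurable_potential_ext.
- move=> w _; apply: lee_wpmul2l; first by rewrite lee_fin lap_ge0.
  by case: (traj_at _ _ _) => //= g'.
Qed.

End supermedian.

(** Started at the vertex, almost every path stays in the ball for a while, by normality and right
    continuity. The inverse of the mean exit time is therefore finite. *)
Lemma mean_exit_gt0 : 0 < eps -> (0 < mean_exit_time X eps)%E.
Proof.
move=> eps0; have mt := measurable_ball_exit_time.
rewrite lt_neqAle integral_ge0 ?andbT//; last by move=> w _; exact: ball_exit_ge0.
apply/eqP => t0.
have : ae_eq (law X vertex) setT tau (cst 0%E).
  apply/(ae_eq_integral_abs _ _) => //; rewrite [RHS]t0; apply: eq_integral => w _.
  by rewrite gee0_abs// ball_exit_ge0.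
move=> [N [mN N0 hN]].
have : (law X vertex [set w | traj X 0 w = inG (vertex : star)] <= law X vertex N)%E.
  apply: le_measure; rewrite ?inE//.
    rewrite -[X in measurable X]setTI; apply: (@measurable_traj _ _ _ _ X 0 _ measurableT [set inG vertex]) => //.
    rewrite -[X in measurable X](image_set1 Some vertex).
    by apply: measurable_image_Some; exact: star_measurable_vertex.
  move=> w /= wv; apply: hN => /= /(_ Logic.I) tw.
  have rc u : 0 <= u -> traj X v w @[v --> u^'+] --> traj X u w.
    by move=> u0; exact: traj_right_continuous.
  have oB : open (Some @` (ball (vertex : star) eps)° : set cem).
    by apply: cemetery_open_Some; exact: open_interior.
  have [|e e0 he] := right_open rc (lexx 0) oB.
    rewrite wv; exists vertex => //; exact: nbhsx_ballx.
  have : (tau w < e%:E)%E by rewrite tw lte_fin.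
  move=> /entry_time_lt[t [t0' te]]; apply.
  have [|g Bg <-] := he t; first by rewrite t0' add0r -lte_fin.
  by exists g => //; apply: subset_closure; exact: interior_subset.
by rewrite law_normal N0 lee_fin ler10.
Qed.

End ball_exit.

(** * Barrier and escape estimate *)

Section escape.
Context (E : pfinType) (R : realType) dB (OmB : measurableType dB) (B : standard_bm R OmB)
  d (Om : measurableType d) (X : markov_process E R Om).
Local Notation star := (star E R).
Local Notation cem := (cemetery star).
Hypothesis hX : brownian_motion X B.
Variables (th a : R) (a0 : 0 < a) (th0 : 0 < th) (th1 : th <= 1) (aE : a = th ^+ 2 / 2).
Variables (c : R) (c0 : 0 <= c) (eps : R).

Definition vertex_potential : R := fine (potential X a0 (dist_bump c) vertex).

Local Notation V := vertex_potential.
Local Notation F := (far_mass a).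
Hypothesis VF : V <= F.

Lemma vertex_potentialE : V%:E = potential X a0 (dist_bump c) vertex.
Proof.
by rewrite /V fineK// potential_fin//; [exact: continuous_dist_bump|
  exact: dist_bump_ge0|exact: dist_bump_le1].
Qed.

Lemma vertex_potential_ge0 : 0 <= V.
Proof. by rewrite -lee_fin vertex_potentialE potential_ge0//; exact: dist_bump_ge0. Qed.

Definition barrier (g : star) : R :=
  V * expR (- th * vdist g) + (F - V) * dist_bump (c + 3) g.

Lemma barrier_ge0 g : 0 <= barrier g.
Proof.
by rewrite addr_ge0// mulr_ge0 ?expR_ge0 ?vertex_potential_ge0 ?subr_ge0 ?dist_bump_ge0.
Qed.

Lemma exp_vdist_le1 (g : star) : expR (- th * vdist g) <= 1.
Proof. by rewrite -[leRHS]expR0 ler_expR mulNr oppr_le0 mulr_ge0 ?vdist_ge0// ltW. Qed.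

Lemma barrier_le g : barrier g <= F.
Proof.
rewrite (_ : F = V * 1 + (F - V) * 1); last by rewrite !mulr1 addrC subrK.
apply: lerD; apply: ler_wpM2l; rewrite ?subr_ge0 ?vertex_potential_ge0 ?dist_bump_le1//.
exact: exp_vdist_le1.
Qed.

Lemma continuous_barrier : continuous barrier.
Proof.
move=> g; apply: (@cvgD _ _ _ (nbhs g)); apply: cvgMl_tmp; last exact: continuous_dist_bump.
apply: (cvg_comp (fun g => - th * vdist g) expR); last exact: continuous_expR.
by apply: cvgMl_tmp; exact: continuous_vdist.
Qed.

(** Within distance [c + 3] only the exponential part is present, and [potential_near] applies.
    Beyond it [barrier] is at most [F], since [V <= F] and both profiles are at most 1. *)
Lemma barrier_potential g : ((barrier g)%:E <= potential X a0 (dist_bump c) g)%E.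
Proof.
have [gc|gc] := leP (vdist g) (c + 3).
  rewrite /barrier dist_bump_eq0// mulr0 addr0 mulrC EFinM vertex_potentialE.
  apply: (potential_near hX a0 th0 aE); [exact: continuous_dist_bump|
    exact: dist_bump_ge0|exact: dist_bump_le1].
apply: le_trans (potential_far hX a0 c0 (ltW gc)).
by rewrite lee_fin barrier_le.
Qed.

Local Notation tau := (ball_exit_time X eps).
Local Notation XT := (ball_exit_point X eps).
Local Notation P := (law X vertex).

Definition vertex_defect (g : star) : R := 1 - expR (- vdist g).

Lemma vertex_defect_ge0 g : 0 <= vertex_defect g.
Proof. by rewrite subr_ge0 -[leRHS]expR0 ler_expR oppr_le0 vdist_ge0. Qed.

Lemma vertex_defect_le1 g : vertex_defect g <= 1.
Proof. by rewrite gerBl expR_ge0. Qed.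

Lemma continuous_vertex_defect : continuous vertex_defect.
Proof.
move=> g; apply: (@cvgB _ _ _ (nbhs g)); first exact: cvg_cst.
apply: (cvg_comp (fun g => - vdist g) expR); last exact: continuous_expR.
by apply: cvgN; exact: continuous_vdist.
Qed.

(* [Delta] counts as a point at infinite distance, so that the normalization
   [exit_K] is [1 + E (defect X_tau) / E tau]. *)
Definition defect (y : cem) : R := if y is Some g then vertex_defect g else 1.

Lemma defect_ge0 y : 0 <= defect y.
Proof. by case: y => //= g; exact: vertex_defect_ge0. Qed.

Lemma defect_le1 y : defect y <= 1.
Proof. by case: y => //= g; exact: vertex_defect_le1. Qed.

Lemma measurable_defect : measurable_fun setT defect.
Proof.
apply: cem_measurable_fun; apply: cemetery_continuous.
exact: continuous_vertex_defect.
Qed.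

(** The leading [V] on the left is there to be cancelled: after integration the first term on the
    right is at most [V] by [ball_exit_supermedian]. *)
Lemma escape_pointwise w :
  (V%:E + ((F - V) * ext0 (dist_bump (c + 3)) (XT w))%:E <=
   (lap a (tau w))%:E * (ext0 barrier (XT w))%:E + (F * a)%:E * tau w
   + (V * defect (XT w))%:E)%E.
Proof.
have V0 := vertex_potential_ge0.
have F0 : 0 < F by exact: far_mass_gt0.
have t0 : (0 <= tau w)%E by exact: ball_exit_ge0.
have Fa : 0 < F * a by rewrite mulr_gt0.
(* If the ball is never left, the right-hand side is infinite because [F * a] is positive. *)
rewrite /ball_exit_point; case: (tau w) t0 => [t| |]//= t0; last first.
  by rewrite gt0_muley ?lte_fin// mul0e add0e addye ?leey.
rewrite lee_fin in t0; rewrite -!EFinM -!EFinD lee_fin.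
have L1 : 1 - a * t <= expR (- a * t) by have := expR_ge1Dx (- a * t); lra.
(* At [Delta] the bump and the barrier are 0 and the defect is 1, so the last term pays for the
   whole of [V]. *)
case: (traj X t w) => [g|] /=; last first.
  by have := mulr_ge0 (ltW Fa) t0; lra.
have bg0 := barrier_ge0 g; have bgF := barrier_le g.
have step1 : (1 - a * t) * barrier g <= expR (- a * t) * barrier g by exact: ler_wpM2r.
have step2 : a * t * barrier g <= F * a * t.
  by rewrite -[leRHS]mulrA [leRHS]mulrC ler_wpM2l// mulr_ge0// ltW.
(* Here [th <= 1] trades the exponent of the barrier for that of the defect. *)
have step3 : V * expR (- vdist g) <= V * expR (- th * vdist g).
  apply: ler_wpM2l => //; rewrite ler_expR mulNr lerN2.
  by rewrite -[leRHS]mul1r ler_wpM2r// vdist_ge0.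
rewrite /vertex_defect; move: step1 step2 step3; rewrite /barrier; lra.
Qed.

Lemma escape_bound :
  ((F - V)%:E * \int[P]_w (ext0 (dist_bump (c + 3)) (XT w))%:E <=
   (F * a)%:E * mean_exit_time X eps + V%:E * \int[P]_w (defect (XT w))%:E)%E.
Proof.
have SM := hX.1.
have V0 := vertex_potential_ge0.
have F0 : 0 < F by exact: far_mass_gt0.
have Fa : 0 <= F * a by rewrite mulr_ge0// ltW.
have FV : 0 <= F - V by rewrite subr_ge0.
have mXT := measurable_ball_exit_point SM eps.
have mtau := @measurable_ball_exit_time _ _ _ _ X eps.
have tau0 w : (0 <= tau w)%E by exact: ball_exit_ge0.
have mb : measurable_fun setT (fun w => (ext0 (dist_bump (c + 3)) (XT w))%:E).
  apply/measurable_EFinP; apply: (measurableT_comp _ mXT); apply: measurable_ext0.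
  by apply: star_measurable_fun; exact: continuous_dist_bump.
have b0 w : (0 <= (ext0 (dist_bump (c + 3)) (XT w))%:E)%E.
  by rewrite lee_fin; apply: ext0_ge0; exact: dist_bump_ge0.
have md : measurable_fun setT (fun w => (defect (XT w))%:E).
  by apply/measurable_EFinP; exact: (measurableT_comp measurable_defect mXT).
have d0 w : (0 <= (defect (XT w))%:E)%E by rewrite lee_fin defect_ge0.
pose Lw w : \bar R := ((lap a (tau w))%:E * (ext0 barrier (XT w))%:E)%E.
have mL : measurable_fun setT Lw.
  apply: emeasurable_funM; first exact: measurable_lap.
  apply/measurable_EFinP; apply: (measurableT_comp _ mXT); apply: measurable_ext0.
  by apply: star_measurable_fun; exact: continuous_barrier.
have L0 w : (0 <= Lw w)%E.
  rewrite /Lw -EFinM lee_fin mulr_ge0 ?lap_ge0//; apply: ext0_ge0.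
  exact: barrier_ge0.
have sup : (\int[P]_w Lw w <= V%:E)%E.
  rewrite vertex_potentialE; apply: ball_exit_supermedian => //.
  - exact: continuous_dist_bump.
  - exact: dist_bump_ge0.
  - exact: dist_bump_le1.
  - exact: continuous_barrier.
  - exact: barrier_ge0.
  - exact: barrier_potential.
have mFb : measurable_fun setT (fun w => ((F - V) * ext0 (dist_bump (c + 3)) (XT w))%:E).
  by apply/measurable_EFinP; apply: measurable_funM => //; apply/measurable_EFinP.
have mVd : measurable_fun setT (fun w => (V * defect (XT w))%:E).
  by apply/measurable_EFinP; apply: measurable_funM => //; apply/measurable_EFinP.
have mFt : measurable_fun setT (fun w => (F * a)%:E * tau w)%E.
  exact: (emeasurable_funM (measurable_cst _) mtau).
have Fb0 w : (0 <= ((F - V) * ext0 (dist_bump (c + 3)) (XT w))%:E)%E.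
  by rewrite lee_fin mulr_ge0// -lee_fin.
have Vd0 w : (0 <= (V * defect (XT w))%:E)%E by rewrite lee_fin mulr_ge0// defect_ge0.
have Ft0 w : (0 <= (F * a)%:E * tau w)%E by rewrite mule_ge0// lee_fin.
have := @ge0_le_integral _ _ _ P setT measurableT
  (fun w => V%:E + ((F - V) * ext0 (dist_bump (c + 3)) (XT w))%:E)%E
  (fun w => Lw w + (F * a)%:E * tau w + (V * defect (XT w))%:E)%E.
move=> /(_ (fun w _ => adde_ge0 _ (Fb0 w))).
move=> /(_ V0).
move=> /(_ (emeasurable_funD (f := fun=> V%:E) (measurable_cst _) mFb)).
move=> /(_ (emeasurable_funD (emeasurable_funD mL mFt) mVd)).
move=> /(_ (fun w _ => escape_pointwise w)).
rewrite ge0_integralD//.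
rewrite ge0_integralD//; last 2 first.
  by move=> w _; rewrite adde_ge0.
  exact: emeasurable_funD.
rewrite ge0_integralD//.
rewrite integral_cst//= probability_setT mule1.
under eq_integral do rewrite EFinM.
rewrite ge0_integralZl//.
rewrite ge0_integralZl//.
under [X in (_ <= _ + X)%E -> _]eq_integral do rewrite EFinM.
rewrite ge0_integralZl//.
move=> H; have {}H := le_trans H (leeD (leeD sup (lexx _)) (lexx _)).
by move: H; rewrite -addeA leeD2lE.
Qed.

End escape.

(** * Exit measures *)

Section density_measure.
Local Open Scope ereal_scope.
Context d (T : measurableType d) (R : realType) (mu : {measure set T -> \bar R}) (k : T -> \bar R).
Hypotheses (mk : measurable_fun setT k) (k0 : forall x, 0 <= k x).

(** Integrals against the exit measures are formally integrals against set functions; pushforward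
    and density formulas ask for actual measures. *)
Lemma density_measure : exists nu : {measure set T -> \bar R},
  forall A, nu A = \int[mu]_(x in A) k x.
Proof.
pose n (A : set T) := \int[mu]_(x in A) k x.
have n0 : n set0 = 0 by exact: integral_set0.
have nge A : 0 <= n A by exact: integral_ge0.
have nsig : semi_sigma_additive n.
  move=> F mF tF mUF; rewrite /n ge0_integral_bigcup//; last exact: measurable_funTS.
  by apply: is_cvg_ereal_nneg_natsum => i _; exact: integral_ge0.
pose nu : {measure set T -> \bar R} := HB.pack n (isMeasure.Build _ _ _ n n0 nge nsig).
by exists nu.
Qed.

End density_measure.

Section to_bar.
Context (E : pfinType) (R : realType).
Local Notation star := (star E R).
Local Notation cem := (cemetery star).
Local Notation cstar := (star_compact E R).

Lemma measurable_odflt : measurable_fun setT (odflt vertex : cem -> star).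
Proof.
move=> _ A mA; rewrite setTI.
have mD : measurable [set Delta : cem].
  by apply: cem_open_measurable; exact: cemetery_open_Delta.
have -> : odflt vertex @^-1` A = (Some @` A) `|` ([set Delta : cem] `&` [set _ | A vertex]).
  apply/seteqP; split => [[g|]/= Ag|y [[g Ag <-]//|[-> //]]].
    by left; exists g.
  by right.
apply: measurableU; first exact: measurable_image_Some.
have [A0|A0] := pselect (A vertex).
  by rewrite (_ : [set _ | _] = setT) ?setIT//; apply/seteqP; split.
by rewrite (_ : [set _ | _] = set0) ?setI0//; apply/seteqP; split.
Qed.

Lemma continuous_bar_pt (e : E) : continuous (fun x : R => bar_pt e x%:E : cstar).
Proof.
move=> x; apply: (cvg_comp (fun x : R => exist _ (Order.max x%:E 0%E) (bar_pt_subproof x%:E) :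
  set_type [set x : \bar R | (0 <= x)%E]) (existT _ e)); last exact: existT_continuous.
move: x; apply: continuous_comp_initial => x /=.
have -> : set_val \o (fun x : R => exist (fun y => y \in [set y : \bar R | (0 <= y)%E])
    (Order.max x%:E 0%E) (bar_pt_subproof x%:E)) = EFin \o (fun x => Num.max x 0).
  by apply/funext => y /=; rewrite EFin_max.
apply: cvg_EFin; first exact: nearW.
apply: (@continuous_max _ _ (fun x : R => x) (fun=> 0)); first by move=> ?.
exact: cst_continuous.
Qed.

(** At the vertex [to_bar] takes an arbitrary value and need not be continuous, so this point is
    split off; elsewhere preimages of open sets are open. *)
Lemma measurable_to_bar : measurable_fun setT (@to_bar E R).
Proof.
apply: (measurability (f := @to_bar E R) _ erefl) => // _ [U oU <-]; rewrite setTI.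
rewrite (_ : _ @^-1` U = (@to_bar E R @^-1` U `&` ~` [set vertex]) `|`
    ([set vertex] `&` [set _ | U (to_bar (vertex : star))])); last first.
  apply/seteqP; split => [g Ug|g [[]//|[-> //]]].
  have [gv|gv] := pselect (g = vertex); last by left.
  by right; split => //=; rewrite -gv.
apply: measurableU; last first.
  apply: measurableI; first exact: star_measurable_vertex.
  have [A0|A0] := pselect (U (to_bar (vertex : star))).
    by rewrite (_ : [set _ | _] = setT); [exact: measurableT|apply/seteqP; split].
  by rewrite (_ : [set _ | _] = set0); [exact: measurable0|apply/seteqP; split].
apply: star_open_measurable; rewrite openE => g [].
have [e [x [x0 ->]]] := starP g.
move: x0; rewrite le_eqVlt => /orP[/eqP<-|x0]; first by rewrite pt0 => _ [].
rewrite /= to_bar_pt// => Ux _.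
have : nbhs x ((fun y : R => bar_pt e y%:E) @^-1` U).
  apply: open_nbhs_nbhs; split => //.
  by apply: open_comp => // y _; exact: continuous_bar_pt.
(* The bound [x] on the radius keeps the ball inside the edge, away from the vertex. *)
move=> [r /= r0 hr]; apply/nbhs_ballP; exists (Num.min r x); first by rewrite /= lt_min r0.
move=> h; rewrite ballEmdist/=; have [e' [y [y0 ->]]] := starP h.
rewrite -[mdist _ _]/(star_dist _ _) star_dist_pt// ?ltW//.
case: eqP => [<-|_]; last by rewrite lt_min gtrDl [X in _ && X]ltNge y0 andbF.
rewrite lt_min => /andP[xyr xyx].
have y0' : 0 < y by have := ler_norm (x - y); lra.
split; first by rewrite /= to_bar_pt//; exact: hr.
move=> /= yv; have := vdist_pt e (ltW y0').
by rewrite yv /vdist mdistxx => yy; rewrite -yy ltxx in y0'.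
Qed.

End to_bar.

Section exit_measures.
Context (E : pfinType) (R : realType) dB (OmB : measurableType dB) (B : standard_bm R OmB)
  d (Om : measurableType d) (X : markov_process E R Om).
Local Notation star := (star E R).
Local Notation cem := (cemetery star).
Hypothesis hX : brownian_motion X B.
Variables (eps : R) (eps0 : 0 < eps).
Local Notation XT := (ball_exit_point X eps).
Local Notation P := (law X vertex).

Definition exit_rate : R := fine ((mean_exit_time X eps)^-1)%E.
Local Notation m := exit_rate.

Lemma exit_rateE : m%:E = ((mean_exit_time X eps)^-1)%E.
Proof.
rewrite /exit_rate; have := mean_exit_gt0 X eps0.
by case: (mean_exit_time X eps) => [r| |]//; rewrite lte_fin => r0; rewrite inver gt_eqF.
Qed.

Lemma exit_rate_ge0 : 0 <= m.
Proof. by rewrite -lee_fin exit_rateE inve_ge0 ltW// (mean_exit_gt0 X eps0). Qed.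

(** Sending [Delta] to the vertex makes the exit point a variable in the graph; restricting its law
    to the complement of the vertex then discards killed paths as well. As [f] vanishes at the
    vertex, the restriction does not affect the integral. *)
Lemma integral_exit_nu (f : star -> R) : measurable_fun setT f -> (forall g, 0 <= f g) ->
  f vertex = 0 ->
  (exists nu : {measure set star -> \bar R}, exit_nu X eps = nu) /\
  (\int[exit_nu X eps]_g (f g)%:E = m%:E * \int[P]_w (ext0 f (XT w))%:E)%E.
Proof.
move=> mf f0 fv.
have mXT := measurable_ball_exit_point hX.1 eps.
have mZ : measurable_fun setT (odflt vertex \o XT).
  exact: (measurableT_comp (@measurable_odflt E R) mXT).
pose Z : {mfun Om >-> star} := HB.pack (odflt vertex \o XT) (isMeasurableFun.Build _ _ _ _ _ mZ).
pose pZ : {measure set star -> \bar R} := distribution P Z.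
have mv : measurable (~` [set vertex : star]).
  by apply: measurableC; exact: star_measurable_vertex.
pose nv : {measure set star -> \bar R} := mrestr pZ mv.
pose nu : {measure set star -> \bar R} := mscale (NngNum exit_rate_ge0) nv.
have nuE : exit_nu X eps = nu.
  apply/funext => A; rewrite /exit_nu /nu /mscale /= /mscale/= exit_rateE muleC; congr (_ * _)%E.
  rewrite /nv /= /mrestr /pZ/= /distribution /pushforward/=; congr (P _).
  apply/seteqP; split => w /=.
    by move=> [g [Ag gv] gE]; rewrite -gE.
  case: (XT w) => [g|] /= [Ag gv]; last by case: gv.
  by exists g.
split; first by exists nu.
have mfE : measurable_fun setT (fun g => (f g)%:E) by apply/measurable_EFinP.
rewrite nuE /nu ge0_integral_mscale//; last by move=> g _; rewrite lee_fin.
congr (_ * _)%E.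
have mi : measurable_fun setT (\1_(~` [set vertex : star]) : star -> R) by exact: measurable_indic.
rewrite (@ge0_integral_density _ star R pZ nv (\1_(~` [set vertex])) mi)//; last first.
  by move=> A mA; rewrite integral_indic// /nv /= /mrestr setIC.
rewrite /pZ ge0_integral_pushforward//; last 2 first.
- by apply: (emeasurable_funM mfE); apply/measurable_EFinP.
- by move=> g _; rewrite mule_ge0// lee_fin.
apply: eq_integral => w _ /=; rewrite -EFinM; congr (_%:E).
case: (XT w) => [g|] /=; last by rewrite fv mul0r.
have [->|gv] := pselect (g = vertex); first by rewrite fv mul0r.
by rewrite indicE mem_set ?mulr1.
Qed.

Lemma measurable_vertex_defect : measurable_fun setT (@vertex_defect E R).
Proof. by apply: star_measurable_fun; exact: continuous_vertex_defect. Qed.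

Lemma vertex_defect_vertex : vertex_defect (vertex : star) = 0.
Proof. by rewrite /vertex_defect /vdist mdistxx oppr0 expR0 subrr. Qed.

Lemma integral_setD_vertex (mu : {measure set star -> \bar R}) (A : set star) :
  (\int[mu]_(g in A `\ vertex) (vertex_defect g)%:E = \int[mu]_(g in A) (vertex_defect g)%:E)%E.
Proof.
rewrite integral_mkcond [RHS]integral_mkcond; apply: eq_integral => g _.
rewrite !patchE; have [->|gv] := pselect (g = vertex).
  by rewrite vertex_defect_vertex !if_same.
congr (if _ then _ else _); apply/idP/idP; rewrite !inE; first by case.
by move=> Ag; split.
Qed.

Lemma exit_KE : exit_K X eps = (1 + m%:E * \int[P]_w (defect (XT w))%:E)%E.
Proof.
have [[nu nuE] I] := integral_exit_nu measurable_vertex_defect (@vertex_defect_ge0 E R)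
  vertex_defect_vertex.
have mXT := measurable_ball_exit_point hX.1 eps.
have mD : measurable [set w | XT w = Delta].
  rewrite -[X in measurable X]setTI; apply: (mXT measurableT [set Delta]).
  by apply: cem_open_measurable; exact: cemetery_open_Delta.
rewrite /exit_K -setTD nuE integral_setD_vertex -nuE I -addeA; congr (1 + _)%E.
rewrite /killing_ratio -exit_rateE muleC -ge0_muleDr//; last first.
  apply: integral_ge0 => w _; rewrite lee_fin; apply: ext0_ge0; exact: vertex_defect_ge0.
congr (_ * _)%E; rewrite -[X in (P X + _)%E]setIT -(integral_indic P measurableT mD).
rewrite -ge0_integralD//.
- apply: eq_integral => w _; rewrite -EFinD indicE; congr (_%:E).
  case XE : (XT w) => [g|] /=; first by rewrite memNset ?add0r//= XE.
  by rewrite mem_set ?addr0.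
- by apply/measurable_EFinP; exact: measurable_indic.
- move=> w _; rewrite lee_fin; apply: ext0_ge0; exact: vertex_defect_ge0.
- apply/measurable_EFinP; apply: (measurableT_comp _ mXT); apply: measurable_ext0.
  exact: measurable_vertex_defect.
Qed.

Definition mean_defect : R := fine (\int[P]_w (defect (XT w))%:E)%E.
Local Notation kappa := mean_defect.

Lemma mean_defectE : kappa%:E = (\int[P]_w (defect (XT w))%:E)%E.
Proof.
have mXT := measurable_ball_exit_point hX.1 eps.
rewrite fineK// ge0_fin_numE; last by apply: integral_ge0 => w _; rewrite lee_fin defect_ge0.
apply: (@le_lt_trans _ _ (\int[P]_w (cst 1%E w))%E); last first.
  by rewrite integral_cst//= mul1e probability_setT ltry.
apply: ge0_le_integral => //.
- by move=> w _; rewrite lee_fin defect_ge0.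
- by apply/measurable_EFinP; exact: (measurableT_comp (@measurable_defect E R) mXT).
- by move=> w _; rewrite lee_fin defect_le1.
Qed.

Lemma mean_defect_ge0 : 0 <= kappa.
Proof. by apply: fine_ge0; apply: integral_ge0 => w _; rewrite lee_fin defect_ge0. Qed.

Lemma integral_exit_mu_bar (f : star_compact E R -> R) : continuous f -> (forall y, 0 <= f y) ->
  (\int[exit_mu_bar X eps]_y (f y)%:E =
   ((1 + m * kappa)^-1 * m)%:E *
   \int[P]_w (ext0 (fun g => f (to_bar g) * vertex_defect g) (XT w))%:E)%E.
Proof.
move=> cf f0; have m0 := exit_rate_ge0; have k0 := mean_defect_ge0.
have K1 : 0 < 1 + m * kappa by rewrite ltr_wpDr// mulr_ge0.
have KE : exit_K X eps = (1 + m * kappa)%:E by rewrite exit_KE -mean_defectE.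
have Ki0 : 0 <= (1 + m * kappa)^-1 by rewrite invr_ge0 ltW.
have mf : measurable_fun setT f.
  apply: (measurability _ (RGenOInfty.measurableE R)) => _ [_ [x ->] <-].
  rewrite setTI; apply: sub_sigma_algebra.
  by move/continuousP : cf; apply; exact: rray_open.
have mft : measurable_fun setT (f \o @to_bar E R) := measurableT_comp mf (@measurable_to_bar E R).
have mfd : measurable_fun setT (fun g => f (to_bar g) * @vertex_defect E R g).
  by apply: measurable_funM => //; exact: measurable_vertex_defect.
have fd0 g : 0 <= f (to_bar g) * @vertex_defect E R g by rewrite mulr_ge0// vertex_defect_ge0.
have fdv : f (to_bar (vertex : star)) * vertex_defect (vertex : star) = 0.
  by rewrite vertex_defect_vertex mulr0.
have [[nu nuE] I] := integral_exit_nu mfd fd0 fdv.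
have [||lam lamE] := @density_measure _ star R nu (fun g => (vertex_defect g)%:E).
- by apply/measurable_EFinP; exact: measurable_vertex_defect.
- by move=> g; rewrite lee_fin vertex_defect_ge0.
pose mu : {measure set star -> \bar R} := mscale (NngNum Ki0) lam.
have muE : exit_mu X eps = mu.
  apply/funext => A; rewrite /exit_mu /mu /= /mscale /= lamE nuE integral_setD_vertex KE.
  by rewrite muleC inver gt_eqF.
pose tb : {mfun star >-> star_compact E R} :=
  HB.pack (@to_bar E R) (isMeasurableFun.Build _ _ _ _ _ (@measurable_to_bar E R)).
rewrite /exit_mu_bar muE -[pushforward _ _]/(pushforward mu tb).
rewrite ge0_integral_pushforward//; last 2 first.
- exact/measurable_EFinP.
- by move=> y _; rewrite lee_fin.
rewrite preimage_setT /mu ge0_integral_mscale//; last 2 first.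
- exact/measurable_EFinP.
- by move=> y _; rewrite lee_fin.
rewrite (@ge0_integral_density _ star R nu lam (@vertex_defect E R))//; last 4 first.
- exact: measurable_vertex_defect.
- exact: vertex_defect_ge0.
- exact/measurable_EFinP.
- by move=> g; rewrite lee_fin.
under eq_integral do rewrite -EFinM.
by rewrite -nuE I muleA -EFinM.
Qed.

Section bound.
Variables (th a : R) (a0 : 0 < a) (th0 : 0 < th) (th1 : th <= 1) (aE : a = th ^+ 2 / 2).
Variables (c : R) (c0 : 0 <= c).
Local Notation V := (vertex_potential X a0 c).
Local Notation F := (far_mass a).
Hypothesis VF : V <= F.

Lemma exit_mu_bar_bound (f : star_compact E R -> R) : continuous f -> (forall y, 0 <= f y) ->
  (forall g, f (to_bar g) * vertex_defect g <= dist_bump (c + 3) g) ->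
  ((F - V)%:E * \int[exit_mu_bar X eps]_y (f y)%:E <= (F * a + V)%:E)%E.
Proof.
move=> cf f0 fb.
have m0 := exit_rate_ge0; have k0 := mean_defect_ge0.
have mk0 := mulr_ge0 m0 k0.
have K1 : 0 < 1 + m * kappa by rewrite ltr_wpDr.
have Ki0 : 0 <= (1 + m * kappa)^-1 by rewrite invr_ge0 ltW.
have F0 : 0 < F by exact: far_mass_gt0.
have Fa : 0 <= F * a by rewrite mulr_ge0// ltW.
have V0 := vertex_potential_ge0 X a0 c.
have FV : 0 <= F - V by rewrite subr_ge0.
have mXT := measurable_ball_exit_point hX.1 eps.
have M0 := mean_exit_gt0 X eps0.
set M := mean_exit_time X eps in M0 *.
pose bt := (\int[P]_w (ext0 (dist_bump (c + 3)) (XT w))%:E)%E.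
have bt0 : (0 <= bt)%E.
  by apply: integral_ge0 => w _; rewrite lee_fin; apply: ext0_ge0; exact: dist_bump_ge0.
have mb : measurable_fun setT (fun w => (ext0 (dist_bump (c + 3)) (XT w))%:E).
  apply/measurable_EFinP; apply: (measurableT_comp _ mXT); apply: measurable_ext0.
  by apply: star_measurable_fun; exact: continuous_dist_bump.
have btf : bt \is a fin_num.
  rewrite ge0_fin_numE//; apply: (@le_lt_trans _ _ (\int[P]_w (cst 1%E w))%E); last first.
    by rewrite integral_cst//= mul1e probability_setT ltry.
  apply: ge0_le_integral => //.
  - by move=> w _; rewrite lee_fin; apply: ext0_ge0; exact: dist_bump_ge0.
  - by move=> w _; rewrite lee_fin; apply: ext0_le1; exact: dist_bump_le1.
pose b := fine bt; have bE : bt = b%:E by rewrite /b fineK.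
have b0 : 0 <= b by rewrite -lee_fin -bE.
(* This is [escape_bound] divided by the mean exit time. If that mean is infinite, [m] is 0 and the
   claim is [0 <= F * a]. *)
have key : m * ((F - V) * b) <= F * a + V * (m * kappa).
  have := escape_bound hX th0 th1 aE c0 eps VF; rewrite -mean_defectE -/M -/bt bE.
  have := exit_rateE; rewrite -/M; case: (M) M0 => [r| |]//.
    rewrite lte_fin => r0; rewrite inver gt_eqF// => -[mE].
    rewrite -!EFinM -EFinD lee_fin => h; rewrite mE.
    have ri0 : 0 <= r^-1 by rewrite invr_ge0 ltW.
    have := ler_wpM2l ri0 h; congr (_ <= _).
    by field; rewrite gt_eqF.
  rewrite invey => _ [->] _; rewrite !mul0r mulr0 addr0//.
rewrite (integral_exit_mu_bar cf f0).
apply: (@le_trans _ _ ((F - V)%:E * (((1 + m * kappa)^-1 * m)%:E * bt)))%E.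
  apply: lee_wpmul2l; first by rewrite lee_fin.
  apply: lee_wpmul2l; first by rewrite lee_fin mulr_ge0.
  apply: ge0_le_integral => //.
  - move=> w _; rewrite lee_fin; apply: ext0_ge0 => g.
    by rewrite mulr_ge0// vertex_defect_ge0.
  - apply/measurable_EFinP; apply: (measurableT_comp _ mXT); apply: measurable_ext0.
    apply: measurable_funM; last exact: measurable_vertex_defect.
    apply: (measurableT_comp _ (@measurable_to_bar E R)).
    apply: (measurability _ (RGenOInfty.measurableE R)) => _ [_ [x ->] <-].
    rewrite setTI; apply: sub_sigma_algebra.
    by move/continuousP : cf; apply; exact: rray_open.
  - by move=> w _; rewrite lee_fin; case: (XT w) => //= g; exact: fb.
rewrite bE -!EFinM lee_fin.
have -> : (F - V) * ((1 + m * kappa)^-1 * m * b) = (m * ((F - V) * b)) / (1 + m * kappa).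
  have alg (p i q r : R) : p * (i * q * r) = q * (p * r) * i by ring.
  exact: alg.
(* The normalization [1 + m * kappa] dominates 1 and [m * kappa], the respective weights of [F * a]
   and [V] in [key]. *)
rewrite ler_pdivrMr//; apply: (le_trans key).
have alg (p q r : R) : (p + q) * (1 + r) - (p + q * r) = p * r + q by ring.
by rewrite -subr_ge0 alg addr_ge0// mulr_ge0.
Qed.

End bound.
End exit_measures.

(** * Passage to the limit *)

Section vanishing.
Context (E : pfinType) (R : realType) d (Om : measurableType d) (X : markov_process E R Om).
Local Notation star := (star E R).
Variables (a : R) (a0 : 0 < a) (g : star).

Lemma cvg_dist_bump (h : star) : dist_bump n%:R h @[n --> \oo] --> (0 : R).
Proof.
apply: cvg_near_cst; have [n hn] : exists n : nat, vdist h <= n%:R.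
  by exists (Num.truncn (vdist h)).+1; exact/ltW/Num.Theory.truncnS_gt.
exists n => // k /= nk; rewrite dist_bump_eq0//; apply: (le_trans hn).
by rewrite ler_nat.
Qed.

(** At a fixed time the process is dead or at finite distance, so the bumps vanish pointwise and
    dominated convergence applies. *)
Lemma cvg_semigroup_bump (t : R) : 0 <= t ->
  semigroup X (dist_bump n%:R) t g @[n --> \oo] --> (0 : R).
Proof.
move=> t0.
have [] := @dominated_convergence _ _ _ (law X g) setT measurableT
  (fun n w => (ext0 (dist_bump n%:R) (traj X t w))%:E) (fun=> 0%E) (fun=> 1%E).
- by move=> n; apply/measurable_EFinP; apply: measurable_ext0_traj => //; exact: continuous_dist_bump.
- exact: measurable_cst.
- apply: aeW => w _; apply: cvg_EFin; first exact: nearW.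
  case: (traj X t w) => [h|]; last exact: cvg_cst.
  exact: cvg_dist_bump.
- apply/integrableP; split => //; under eq_integral do rewrite abse1.
  by rewrite integral_cst//= probability_setT mul1e ltry.
- apply: aeW => w n _; rewrite /= lee_fin ger0_norm.
    by apply: ext0_le1; exact: dist_bump_le1.
  by apply: ext0_ge0; exact: dist_bump_ge0.
move=> _ _; rewrite integral0 => H.
apply: (fine_cvg (a := 0)); apply: cvg_trans H; apply: near_eq_cvg; apply: nearW => n /=.
by rewrite unlock.
Qed.

Lemma cvg_potential_bump : potential X a0 (dist_bump n%:R) g @[n --> \oo] --> 0%E.
Proof.
have [] := @dominated_convergence _ _ _ (expo a0) setT measurableT
  (fun n t => (semigroup X (dist_bump n%:R) (Num.max t 0) g)%:E) (fun=> 0%E) (fun=> 1%E).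
- move=> n; apply/measurable_EFinP; apply: measurable_semigroup_time;
    [exact: continuous_dist_bump|exact: dist_bump_ge0|exact: dist_bump_le1].
- exact: measurable_cst.
- apply: aeW => t _; apply: cvg_EFin; first exact: nearW.
  by apply: cvg_semigroup_bump; exact: max0_pos.
- apply/integrableP; split => //; under eq_integral do rewrite abse1.
  by rewrite integral_cst//= [X in (1 * X)%E](probability_setT (expo a0)) mul1e ltry.
- apply: aeW => t n _; rewrite /= lee_fin ger0_norm.
    apply: semigroup_le1; [exact: continuous_dist_bump|exact: dist_bump_ge0|
      exact: dist_bump_le1|exact: max0_pos].
  by apply: semigroup_ge0; exact: dist_bump_ge0.
by move=> _ _; rewrite integral0.
Qed.

End vanishing.

(** * A continuous test function for the end of an edge *)

Section edge_end.
Context (E : pfinType) (R : realType) (c : R) (e : E).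
Local Notation cstar := (star_compact E R).

(** [contract] maps the extended line homeomorphically onto [[-1, 1]]; the affine rescaling sends
    [c] to 0 and [+oo], and no other point, to 1. *)
Definition ramp (x : \bar R) : R :=
  Num.max 0 ((contract x - contract c%:E) / (1 - contract c%:E)).

Definition edge_end (y : cstar) : R :=
  if projT1 y == e then ramp (val (projT2 y)) else 0.

Let contract_c : 0 < 1 - contract c%:E.
Proof. by rewrite subr_gt0; have := contract_lt1 c; rewrite ltr_norml => /andP[]. Qed.

Lemma ramp_ge0 x : 0 <= ramp x. Proof. by rewrite le_max lexx. Qed.

Lemma ramp_le1 x : ramp x <= 1.
Proof.
rewrite ge_max ler01/= ler_pdivrMr ?contract_c// mul1r lerD2r.
by have := contract_le1 x; rewrite ler_norml => /andP[].
Qed.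

Lemma ramp_eq0 x : (x <= c%:E)%E -> ramp x = 0.
Proof.
move=> xc; apply: max_l; rewrite pmulr_lle0 ?invr_gt0 ?contract_c// subr_le0.
by rewrite (le_contract x c%:E).
Qed.

Lemma ramp_eq1 x : (ramp x == 1) = (x == +oo%E).
Proof.
rewrite -(inj_eq (@contract_inj R) x +oo%E) /=; apply/idP/idP => /eqP h; apply/eqP.
  move: h; rewrite /ramp; case: (leP 0 _) => _; last by move=> /eqP; rewrite eq_sym oner_eq0.
  by move=> /divr1_eq/addIr.
by rewrite /ramp h divff ?max_r// gt_eqF// contract_c.
Qed.

Lemma continuous_contract : continuous (@contract R).
Proof.
move=> x; apply/(@cvgrPdist_lt _ _ _ (nbhs x)) => eps eps0.
by apply/nbhs_ballP; exists eps => //= y.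
Qed.

Lemma continuous_ramp : continuous ramp.
Proof.
move=> x; apply: (@continuous_max _ _ (fun=> 0) (fun x => (contract x - contract c%:E) / (1 - contract c%:E))).
  exact: cst_continuous.
apply: cvgMr_tmp; apply: (@cvgB _ _ _ (nbhs x)); last exact: cvg_cst.
exact: continuous_contract.
Qed.

Lemma continuous_edge_end : continuous edge_end.
Proof.
have ce e' : continuous (fun x : set_type [set x : \bar R | (0 <= x)%E] =>
    edge_end (existT _ e' x)).
  rewrite /edge_end/=; case: (e' == e); last exact: cst_continuous.
  move=> x; apply: (@continuous_comp _ _ _ _ ramp); last exact: continuous_ramp.
  exact: initial_continuous.
by move=> [e' x] U nU; exact: (ce e' x U nU).
Qed.

Lemma edge_end_ge0 y : 0 <= edge_end y.
Proof. by case: y => e' x; rewrite /edge_end/=; case: ifP => // _; exact: ramp_ge0. Qed.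

Lemma edge_end_le1 y : edge_end y <= 1.
Proof. by case: y => e' x; rewrite /edge_end/=; case: ifP => // _; exact: ramp_le1. Qed.

(** Serves twice: the added end is a measurable point, and its indicator is dominated by the
    continuous function [edge_end]. *)
Lemma edge_end_preimage1 : edge_end @^-1` [set 1] = [set bar_pt e +oo%E].
Proof.
apply/seteqP; split => [[e' x]|_ ->] /=; rewrite /edge_end/=; last first.
  by apply/eqP; rewrite eqxx ramp_eq1/= max_l ?leey.
case: eqP => [-> /eqP|_ /eqP]; last by rewrite eq_sym oner_eq0.
rewrite ramp_eq1 => /eqP xoo; congr (existT _ e _); apply: val_inj.
by rewrite /= xoo max_l ?leey.
Qed.

Lemma edge_end_to_bar (x : R) e' : 0 < x -> x <= c -> edge_end (to_bar (pt e' x)) = 0.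
Proof.
move=> x0 xc; rewrite to_bar_pt// /edge_end/=; case: ifP => // _.
by rewrite ramp_eq0//= max_l ?lee_fin// ltW.
Qed.

End edge_end.

(** The ramp starts at [c + 4], where [dist_bump (c + 3)] has reached 1. At the vertex, whose image
    under [to_bar] is arbitrary, the factor [vertex_defect] vanishes. *)
Lemma edge_end_bump (E : pfinType) (R : realType) (c : R) (e : E) (g : star E R) :
  edge_end (c + 4) e (to_bar g) * vertex_defect g <= dist_bump (c + 3) g.
Proof.
have [e' [x [+ ->]]] := starP g; rewrite le_eqVlt => /orP[/eqP<-|x0].
  by rewrite pt0 vertex_defect_vertex mulr0 dist_bump_ge0.
have [xc|cx] := leP x (c + 4).
  by rewrite edge_end_to_bar// mul0r dist_bump_ge0.
have -> : dist_bump (c + 3) (pt e' x) = 1.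
  by rewrite /dist_bump vdist_pt ?ltW// min_l// le_max; apply/orP; right; lra.
by rewrite mulr_ile1 ?edge_end_ge0 ?edge_end_le1 ?vertex_defect_ge0 ?vertex_defect_le1.
Qed.

Section limit.
Context (E : pfinType) (R : realType) dB (OmB : measurableType dB) (B : standard_bm R OmB)
  d (Om : measurableType d) (X : markov_process E R Om).
Hypothesis hX : brownian_motion X B.
Variables (eps : nat -> R) (mubar : {finite_measure set (star_compact E R) -> \bar R}).
Hypothesis hmu : limit_measure X eps mubar.

(** [a] is fixed through [th = del], then [c = n] is taken so large that [V <= del * F]. With
    [a <= del / 2] and [F - V >= F / 2] the quotient [(F * a + V) / (F - V)] is at most
    [3 * del]. *)
Lemma limit_measure_end_le (e : E) (del : R) : 0 < del -> del <= 2^-1 ->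
  (mubar [set bar_pt e +oo%E] <= (3 * del)%:E)%E.
Proof.
move=> del0 del2; have [[eps0 _] wc _ _] := hmu.
pose a : R := del ^+ 2 / 2.
have a0 : 0 < a by rewrite divr_gt0// exprn_gt0.
have F0 : 0 < far_mass a by exact: far_mass_gt0.
have aF0 : 0 < del * far_mass a by rewrite mulr_gt0.
have [n Vn] : exists n : nat, vertex_potential X a0 n%:R <= del * far_mass a.
  have := cvgr_lt _ (fine_cvg (cvg_potential_bump X a0 vertex)) _ aF0.
  by move=> -[n _ /(_ n (leqnn n)) h]; exists n; exact: ltW.
have VF : vertex_potential X a0 n%:R <= far_mass a.
  by apply: (le_trans Vn); rewrite ger_pMl//; lra.
pose f := edge_end (n%:R + 4) e : star_compact E R -> R.
have cf : continuous f by exact: continuous_edge_end.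
have f0 y : 0 <= f y by exact: edge_end_ge0.
have f1 y : f y <= 1 by exact: edge_end_le1.
have mf : measurable_fun setT f.
  apply: (measurability _ (RGenOInfty.measurableE R)) => _ [_ [x ->] <-].
  rewrite setTI; apply: sub_sigma_algebra.
  by move/continuousP : cf; apply; exact: rray_open.
have mS : measurable [set bar_pt e +oo%E : star_compact E R].
  rewrite -(edge_end_preimage1 (n%:R + 4)) -[X in measurable X]setTI.
  by apply: mf => //; exact: measurable_set1.
have bn k : (\int[exit_mu_bar X (eps k)]_y (f y)%:E <= (3 * del)%:E)%E.
  have del1 : del <= 1 by lra.
  have := exit_mu_bar_bound hX (eps0 k) del0 del1 (erefl a) (ler0n _ n) VF cf f0
    (edge_end_bump n%:R e).
  set V := vertex_potential _ _ _ in Vn VF *; set F := far_mass a in F0 aF0 Vn VF *.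
  have FV : F / 2 <= F - V by nra.
  have FV0 : 0 < F - V by apply: lt_le_trans FV; rewrite divr_gt0.
  rewrite -(lee_pdivlMl _ _ FV0) => /le_trans; apply.
  rewrite -EFinM lee_fin ler_pdivrMl//.
  have ad : a <= del / 2 by rewrite /a expr2; nra.
  by nra.
apply: (@le_trans _ _ (\int[mubar]_y (f y)%:E)%E).
  rewrite -[X in mubar X]setIT -(integral_indic mubar measurableT mS).
  apply: ge0_le_integral => //.
  - by apply/measurable_EFinP; exact: measurable_indic.
  - exact/measurable_EFinP.
  - move=> y _; rewrite lee_fin indicE; have [|_//] := boolP (y \in _).
    rewrite inE -(edge_end_preimage1 (n%:R + 4)) /preimage/= => fy.
    by rewrite /f fy.
have : (\int[exit_mu_bar X (eps k)]_y (f y)%:E)%E @[k --> \oo] --> (\int[mubar]_y (f y)%:E)%E.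
  by apply: wc => //; exists 1 => y; rewrite ger0_norm.
by move=> /cvge_to_le; apply; exact: nearW.
Qed.

Lemma limit_measure_end (e : E) : mubar [set bar_pt e +oo%E] = 0%E.
Proof.
have := limit_measure_end_le e.
have : (0 <= mubar [set bar_pt e +oo%E])%E by exact: measure_ge0.
case: (mubar _) => [m| |]// m0 h; last first.
  have h0 : 0 < 2^-1 :> R by lra.
  by have := h _ h0 (lexx _).
rewrite lee_fin in m0; move: m0; rewrite le_eqVlt => /orP[/eqP<-//|m0].
(* For [del <= m / 6] the bound [3 * del] is at most [m / 2], which contradicts [m > 0]. *)
have [] : 0 < Num.min 2^-1 (m / 6) /\ Num.min 2^-1 (m / 6) <= 2^-1 :> R.
  by rewrite lt_min ge_min lexx; split => //; apply/andP; split; lra.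
move=> h1 h2; have := h _ h1 h2; rewrite lee_fin.
have : Num.min 2^-1 (m / 6) <= m / 6 by rewrite ge_min lexx orbT.
by move=> ? ?; exfalso; lra.
Qed.

End limit.

Theorem theorem1p4 (R : realType) (E : pfinType)
  (dB : measure_display) (OmegaB : measurableType dB) (B : standard_bm R OmegaB)
  (d : measure_display) (Omega : measurableType d) (X : markov_process E R Omega)
  (hX : brownian_motion X B)
  (eps : nat -> R)
  (mubar : {finite_measure set (star_compact E R) -> \bar R})
  (hmu : limit_measure X eps mubar) :
  c1_infty mubar = 0%E.
Proof. by rewrite /c1_infty big1// => e _; exact: limit_measure_end hX _ _ hmu e. Qed.
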